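(* Let $k\ge 0$ be an integer. For $n=2k+2$, the map $\Phi:\mathrm{VHC}(S_{n-1})\to\widetilde{\mathcal P}^c(n)$ (defined in the context) restricts to a bijection $$\Phi':\mathrm{VHC}^k(S_{2k+1})\to\widetilde{\mathcal M}^c(2k+2).$$ In particular, $\left|\mathrm{VHC}^k(S_{2k+1})\right|=A_{k+1}$.
   Context: Lassalle's sequence $(A_m)_{m\geq 1}$ is defined by $A_1=1$ and $A_m=(-1)^{m-1}C_m+\sum_{j=1}^{m-1}(-1)^{j-1}\binom{2m-1}{2m-2j-1}A_{m-j}C_j$, where $C_n=\frac{1}{n+1}\binom{2n}{n}$. Valid hook configurations. $S_n$ is the set of permutations of $\{1,\ldots,n\}$, written $\pi=\pi_1\cdots\pi_n$. A descent of $\pi$ is an index $i\in\{1,\ldots,n-1\}$ with $\pi_i>\pi_{i+1}$. The plot of $\pi$ is the set of points $(i,\pi_i)$. A hook of $\pi$ is given by a southwest endpoint $(i,\pi_i)$ and a northeast endpoint $(j,\pi_j)$ with $i<j$ and $\pi_i<\pi_j$; it is the L-shaped set $(\{i\}\times[\pi_i,\pi_j])\cup([i,j]\times\{\pi_j\})$. If $\pi$ has descents $d_1<\cdots<d_k$, a valid hook configuration of $\pi$ is a tuple $\mathcal H=(H_1,\ldots,H_k)$ of hooks of $\pi$ such that: (1) for each $i$, the southwest endpoint of $H_i$ is $(d_i,\pi_{d_i})$; (2) no point of the plot lies directly above a hook (i.e., if a hook has endpoints $(i,\pi_i)$ and $(j,\pi_j)$ and $i<l<j$, then $\pi_l<\pi_j$);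 (3) hooks do not intersect each other, except that the northeast endpoint of one hook may be the southwest endpoint of another. $\mathrm{VHC}(\pi)$ is the set of valid hook configurations of $\pi$, and $\mathrm{VHC}(S_{n})=\bigcup_{\pi\in S_{n}}\mathrm{VHC}(\pi)$ (a disjoint union; a configuration carries its underlying permutation). $\mathrm{VHC}^h(S_{n})$ is the set of those with exactly $h$ hooks. Set partitions. For a partition $\rho$ of $\{1,\ldots,n\}$, two distinct blocks $B,B'$ form a crossing if there are $i,k\in B$ and $j,\ell\in B'$ with $i<j<k<\ell$ or $i>j>k>\ell$. The crossing graph $G(\rho)$ has the blocks of $\rho$ as vertices, two blocks being adjacent iff they form a crossing. $\widetilde{\mathcal P}^c(n)$ is the set of pairs $(\rho,\alpha)$ where $\rho$ is a partition of $\{1,\ldots,n\}$ with $G(\rho)$ connected and $\alpha$ is an acyclic orientation of $G(\rho)$ whose only source (vertex of in-degree $0$) is the block containing $n$. $\widetilde{\mathcal M}^c(2m)$ is the set of $(\rho,\alpha)\in\widetilde{\mathcal P}^c(2m)$ such that $\rho$ is a matching (all blocks have exactly $2$ elements). The map $\Phi$. Let $\mathcal H\in\mathrm{VHC}(\pi)$ with $\pi\in S_{n-1}$. Draw a blue ''sky'' above the plot and give the hooks distinct colors other than blue. A point $(l,\pi_l)$ that is not a northeast endpoint of a hook looks directly upward and gets the color of the first hook it sees, or blue if it sees no hook; a southwest endpoint of a hook looks around (on the left side of) the vertical part of that hook, so it does not see its own hook. (That is: among hooks with endpoints $(d,\pi_d)$, $(j,\pi_j)$ satisfying $d<l<j$,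 take the one with smallest $\pi_j$; the color is that hook's color, or blue if there is no such hook.) The northeast endpoint of a hook gets the color of that hook. Color $\pi_i$ like the point $(i,\pi_i)$, and color $n$ blue; this gives a partition $\rho$ of $\{1,\ldots,n\}$ into color classes. For a block $B$ let $\widehat B=\{i:1\le i\le n-1,\ \pi_i\in B\}$. Orient each edge of $G(\rho)$ between $B$ and $B'$ from $B$ to $B'$ if $\min\widehat B<\min\widehat{B'}$ and from $B'$ to $B$ otherwise; call this orientation $\alpha$. Then $\Phi(\mathcal H)=(\rho,\alpha)$. *)

(* Defs.v *)
From mathcomp Require Import all_boot all_order all_algebra all_fingroup.
From mathcomp Require Import boolp Rstruct.

Set Implicit Arguments.
Unset Strict Implicit.
Unset Printing Implicit Defensive.

Import Order.TTheory GRing.Theory Num.Theory.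

(* {1, ..., n} is rendered by 'I_n = {0, ..., n-1}, for positions and values
   alike; every notion below depends only on the order. *)

(** Lassalle's sequence *)

Definition catalan (n : nat) : nat := 'C(2 * n, n) %/ n.+1.

Definition lassalle_rhs (A : nat -> int) (m : nat) : int :=
  ((-1) ^+ (m - 1) * (catalan m)%:Z +
   \sum_(1 <= j < m)
     (-1) ^+ (j - 1) * ('C(2 * m - 1, 2 * m - 2 * j - 1))%:Z
       * A (m - j)%N * (catalan j)%:Z)%R.

(* [:: 0; A_1; ...; A_n]; the entry of index 0 is a dummy. *)
Fixpoint lassalle_prefix (n : nat) : seq int :=
  if n is n'.+1 then
    let s := lassalle_prefix n' in rcons s (lassalle_rhs (nth 0%R s) n)
  else [:: 0%R].

Definition lassalle (m : nat) : int := nth 0%R (lassalle_prefix m) m.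

Lemma size_lassalle_prefix n : size (lassalle_prefix n) = n.+1.
Proof. by elim: n => //= n IH; rewrite size_rcons IH. Qed.

Lemma nth_lassalle_prefix n i :
  i <= n -> nth 0%R (lassalle_prefix n) i = lassalle i.
Proof.
elim: n => [|n IH]; first by rewrite leqn0 => /eqP->.
rewrite leq_eqVlt => /predU1P[->//|le_in].
by rewrite /= nth_rcons size_lassalle_prefix le_in IH.
Qed.

Lemma lassalle1 : lassalle 1 = 1%R.
Proof. by rewrite /lassalle /= /lassalle_rhs big_geq. Qed.

Lemma lassalleE m : 0 < m -> lassalle m = lassalle_rhs lassalle m.
Proof.
case: m => // m _.
rewrite {1}/lassalle /= nth_rcons size_lassalle_prefix ltnn eqxx.
rewrite /lassalle_rhs; congr (_ + _)%R; apply: eq_big_nat => j /andP[j_gt0 _].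
by rewrite nth_lassalle_prefix // leq_subLR; case: j j_gt0 => // j _;
   rewrite addSn ltnS leq_addl.
Qed.

(** Valid hook configurations *)

Definition descents m (p : 'S_m) : {set 'I_m} :=
  [set i : 'I_m | [exists j : 'I_m, (j == i.+1 :> nat) && (p j < p i)]].

(* (i, j) encodes the hook with southwest endpoint (i, p i) and northeast
   endpoint (j, p j). *)
Definition hook m : Type := ('I_m * 'I_m)%type.

Definition is_hook m (p : 'S_m) (h : hook m) : bool :=
  (h.1 < h.2) && (p h.1 < p h.2).

Section Plane.
Local Open Scope ring_scope.
Local Notation R := Rdefinitions.R.

Definition plot_point m (p : 'S_m) (i : 'I_m) : R * R := (i%:R, (p i)%:R).

Definition hook_shape m (p : 'S_m) (h : hook m) (q : R * R) : Prop :=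
  (q.1 = h.1%:R /\ (p h.1)%:R <= q.2 <= (p h.2)%:R) \/
  (h.1%:R <= q.1 <= h.2%:R /\ q.2 = (p h.2)%:R).

Definition hooks_compatible m (p : 'S_m) (h h' : hook m) : Prop :=
  forall q : R * R, hook_shape p h q -> hook_shape p h' q ->
    (q = plot_point p h.2 /\ q = plot_point p h'.1) \/
    (q = plot_point p h'.2 /\ q = plot_point p h.1).

End Plane.

(* A permutation together with one candidate hook per descent. *)
Definition hook_tuple m : Type :=
  {p : 'S_m & (#|descents p|).-tuple (hook m)}.

Definition conf_perm m (H : hook_tuple m) : 'S_m := tag H.

Definition conf_hooks m (H : hook_tuple m) : seq (hook m) := tval (tagged H).

(* The hooks come in increasing order of their southwest endpoints, since
   [enum] lists ordinals increasingly. *)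
Definition valid_hook_configuration m (p : 'S_m) (H : seq (hook m)) : Prop :=
  [/\ {in H, forall h : hook m, is_hook p h},
      [seq (h : hook m).1 | h <- H] = enum (descents p),
      {in H, forall (h : hook m) (l : 'I_m), h.1 < l < h.2 -> p l < p h.2}
    & {in H &, forall h h' : hook m, h != h' -> hooks_compatible p h h'}].

Definition VHC m : {set hook_tuple m} :=
  [set H : hook_tuple m |
     `[< valid_hook_configuration (conf_perm H) (conf_hooks H) >]].

Definition VHCh (h m : nat) : {set hook_tuple m} :=
  [set H in VHC m | size (conf_hooks H) == h].

(** Connected set partitions with an acyclic orientation *)

Definition crossing n (B B' : {set 'I_n}) : bool :=
  [exists i in B, exists k in B, exists j in B', exists l in B',
     ((i < j) && (j < k) && (k < l)) || ((i > j) && (j > k) && (k > l))].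

Definition crossing_graph n (rho : {set {set 'I_n}}) : rel {set 'I_n} :=
  fun B B' => [&& B \in rho, B' \in rho, B != B' & crossing B B'].

Definition connected_partition n (rho : {set {set 'I_n}}) : bool :=
  [forall B in rho, forall B' in rho, connect (crossing_graph rho) B B'].

(* A set of arcs; (B, B') is an arc from B to B'. *)
Definition arcs n : Type := {set {set 'I_n} * {set 'I_n}}.

Definition orientation n (rho : {set {set 'I_n}}) (a : arcs n) : bool :=
  [forall B, forall B',
     if crossing_graph rho B B' then ((B, B') \in a) (+) ((B', B) \in a)
     else (B, B') \notin a].

Definition acyclic n (a : arcs n) : bool :=
  [forall B, forall B', ((B, B') \in a) ==>
     ~~ connect (fun C C' => (C, C') \in a) B' B].

Definition sources n (rho : {set {set 'I_n}}) (a : arcs n) :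
    {set {set 'I_n}} :=
  [set B in rho | [forall C, (C, B) \notin a]].

Definition oriented_partition n : Type := ({set {set 'I_n}} * arcs n)%type.

(* For n > 0 and a partition rho of 'I_n, the singleton of the block containing
   the largest element. *)
Definition top_block n (rho : {set {set 'I_n}}) : {set {set 'I_n}} :=
  [set B in rho | [exists i in B, i.+1 == n :> nat]].

Definition Ptilde n : {set oriented_partition n} :=
  [set x : oriented_partition n |
     [&& partition x.1 [set: 'I_n], connected_partition x.1,
         orientation x.1 x.2, acyclic x.2
       & sources x.1 x.2 == top_block x.1]].

Definition Mtilde n : {set oriented_partition n} :=
  [set x : oriented_partition n in Ptilde n |
     [forall B : {set 'I_n} in x.1, #|B| == 2]].

(** The map Phi *)

(* [None] is blue, [Some h] is the color of the hook h. *)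
Definition color m := option (hook m).

Definition sees m (H : seq (hook m)) (l : 'I_m) : pred (hook m) :=
  [pred h : hook m | (h \in H) && (h.1 < l < h.2)].

Definition point_color m (p : 'S_m) (H : seq (hook m)) (l : 'I_m) : color m :=
  if [pick h : hook m in H | h.2 == l] is Some h then Some h
  else if [pick h | sees H l h] is Some h0 then
    Some [arg min_(h < h0 | sees H l h) (p h.2 : nat)]
  else None.

(* [lift ord_max : 'I_m -> 'I_m.+1] preserves the underlying number, and
   [unlift ord_max] is [None] exactly at the largest value. *)
Definition value_color m (p : 'S_m) (H : seq (hook m)) (v : 'I_m.+1) :
    color m :=
  if unlift ord_max v is Some w then point_color p H ((p^-1)%g w) else None.

Definition color_classes m (p : 'S_m) (H : seq (hook m)) :
    {set {set 'I_m.+1}} :=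
  preim_partition (value_color p H) [set: 'I_m.+1].

Definition hat m (p : 'S_m) (B : {set 'I_m.+1}) : {set 'I_m} :=
  [set i | lift ord_max (p i) \in B].

(* The value m of an empty minimum is harmless: [hat p B] is empty only for
   B = set0 and for B = [set ord_max], which cross no block. *)
Definition min_hat m (p : 'S_m) (B : {set 'I_m.+1}) : nat :=
  \big[minn/m]_(i in hat p B) i.

Definition Phi m (H : hook_tuple m) : oriented_partition m.+1 :=
  let p := conf_perm H in
  let rho := color_classes p (conf_hooks H) in
  (rho, [set e : {set 'I_m.+1} * {set 'I_m.+1} |
           crossing_graph rho e.1 e.2 & min_hat p e.1 < min_hat p e.2]).

(* Main.v *)
(* Write t_B for the maximum of a block B.  In a valid hook configuration the
   point following a descent has the color of the hook H that starts there, so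
   the colored blocks are ordered by these points, and the leftmost point whose
   height lies between those of this point and of the northeast endpoint of H
   belongs to an earlier block crossing the block of H.  Hence the blue block is
   the only source.

   When all blocks are pairs, the order of the blocks is the linear extension
   obtained greedily, always taking the available block with smallest t_B: this
   extension is determined by the orientation, and the relative positions of the
   values are determined by it.  Conversely, inserting the pairs {s < t} in
   greedy order, with s t placed right after the last value below t, yields a
   valid hook configuration with the prescribed image.

   Finally (-1)^(i-1) A_i is the 2i-th classical cumulant of the semicircle law,
   whose 2i-th moment C_i counts noncrossing matchings.  The moment-cumulant
   recurrence is a signed count of triples of a matching of [2m], a set of blocks
   containing the top one and leaving the others pairwise noncrossing, and an
   acyclic orientation of these with the top block as only source; moving one
   block across the cut, as a sink, cancels everything unless the whole matching
   is noncrossing. *)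

Require Import Defs.
From mathcomp Require Import all_boot all_order all_algebra all_fingroup.
From mathcomp Require Import boolp Rstruct zify ring.

Set Implicit Arguments.
Unset Strict Implicit.
Unset Printing Implicit Defensive.

Import Order.TTheory GRing.Theory Num.Theory.

(** * Valid hook configurations and their color classes *)

(** With [k] hooks there are [k+1] colors on [2k+2] values, and each color has at least two of them:
    the point after a descent and the northeast endpoint of its hook, or the first point and the
    added top value. Hence all blocks are pairs, and a block carries nothing beyond the start and
    the end of its hook. The obstacle to injectivity is that the orientation compares only crossing
    blocks, while the permutation depends on the order of all blocks. Greediness closes this gap in
    a local form, [normal_rank]: each block has an earlier crossing block after which only blocks of
    smaller maximum intervene. The same condition legalizes each insertion in the converse: a
    crossing pair opens a place for the new one, and pairs of smaller maximum do not close it. The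
    count is made for matchings of arbitrary point sets containing the largest point, because the
    blocks chosen in a triple cover such a set; the binomial coefficients of Lassalle's recurrence
    count these sets. *)

Lemma ord_neq n (i j : 'I_n) : i != j -> nat_of_ord i <> j.
Proof. by move=> neq E; case/eqP: neq; apply/val_inj. Qed.

(** If [h'] reached the height of [h], its vertical leg would meet the horizontal leg of [h] at
    abscissa [h'.1], strictly between the ends of [h]; neither permitted contact of endpoints occurs
    there. *)
Lemma hooks_compatible_inner m (p : 'S_m) (h h' : hook m) :
  is_hook p h -> is_hook p h' -> hooks_compatible p h h' ->
  h.1 < h'.1 < h.2 -> p h'.1 < p h.2 -> p h'.2 < p h.2.
Proof.
move=> /andP[h12 ph] /andP[h12' ph'] comp /andP[lt1 lt2] plt.
rewrite ltnNge; apply/negP => le.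
pose q : Rdefinitions.R * Rdefinitions.R := ((h'.1 : nat)%:R, (p h.2 : nat)%:R)%R.
have q1 : hook_shape p h q by right; split=> //=; rewrite !ler_nat; apply/andP; split; lia.
have q2 : hook_shape p h' q by left; split=> //=; rewrite !ler_nat; apply/andP; split; lia.
case: (comp q q1 q2) => -[] /(congr1 fst) /= E /(congr1 fst) /= E'.
  by move/eqP: E; rewrite eqr_nat => /eqP E; lia.
by move/eqP: E; rewrite eqr_nat => /eqP E; lia.
Qed.

Lemma hooks_compatible_target m (p : 'S_m) (h h' : hook m) :
  is_hook p h -> is_hook p h' -> hooks_compatible p h h' -> h.2 != h'.2.
Proof.
move=> /andP[h12 ph] /andP[h12' ph'] comp; apply/eqP => E.
have q1 : hook_shape p h (plot_point p h.2).
  by right; split=> //=; rewrite !ler_nat; apply/andP; split; lia.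
have q2 : hook_shape p h' (plot_point p h.2).
  by right; rewrite E; split=> //=; rewrite !ler_nat; apply/andP; split; lia.
have Ev : h.2 = h'.2 :> nat by rewrite E.
by case: (comp _ q1 q2) => -[E1 E2]; [move: E2|move: E2] => /(congr1 fst) /= /eqP;
  rewrite eqr_nat => /eqP; lia.
Qed.

Lemma hooks_compatibleC m (p : 'S_m) (h h' : hook m) :
  hooks_compatible p h h' -> hooks_compatible p h' h.
Proof. by move=> comp q q1 q2; case: (comp q q2 q1) => ?; [right|left]. Qed.

(** Two legs of the same kind never meet here, nor does the vertical leg of [h] meet the later hook;
    the only possible contact is the vertical leg of [h'] with the horizontal leg of [h]. This turns
    the condition on real points into comparisons of indices, for use on constructed hooks. *)
Lemma hooks_compatible_lt m (p : 'S_m) (h h' : hook m) :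
  h.1 < h'.1 -> p h.2 != p h'.2 :> nat -> (h'.1 < h.2 -> p h'.2 < p h.2) ->
  hooks_compatible p h h'.
Proof.
move=> lt1 neq H [x y] s s'.
case: s => /= -[Ex Ey]; case: s' => /= -[Ex' Ey'].
- by move: Ex'; rewrite Ex => /eqP; rewrite eqr_nat => /eqP; lia.
- by move: Ex'; rewrite Ex !ler_nat; lia.
- left; move: Ex Ey'; rewrite Ex' Ey !ler_nat /plot_point => L1 L2.
  have E : h'.1 = h.2 by apply/val_inj => /=; have := H; lia.
  by rewrite E.
- by move: Ey'; rewrite Ey => /eqP; rewrite eqr_nat (negPf neq).
Qed.

(** * Crossings, acyclicity and connectedness *)

Lemma crossingC n (B B' : {set 'I_n}) : crossing B B' = crossing B' B.
Proof.
suff imp (C C' : {set 'I_n}) : crossing C C' -> crossing C' C by apply/idP/idP; apply: imp.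
case/exists_inP=> i iB /exists_inP[k kB /exists_inP[j jB /exists_inP[l lB lt]]].
apply/exists_inP; exists l => //; apply/exists_inP; exists j => //.
by apply/exists_inP; exists k => //; apply/exists_inP; exists i => //; lia.
Qed.

Lemma crossing_interval n (B B' : {set 'I_n}) (a b z y : 'I_n) :
  a \in B -> b \in B -> z \in B' -> y \in B' -> a < z < b -> ~~ (a <= y <= b) ->
  crossing B' B.
Proof.
move=> aB bB zB yB lt out; apply/exists_inP; exists y => //.
apply/exists_inP; exists z => //.
have [lt'|le] := ltnP y a; apply/exists_inP.
  by exists a => //; apply/exists_inP; exists b => //; lia.
by exists b => //; apply/exists_inP; exists a => //; lia.
Qed.

Lemma crossing_graphC n (rho : {set {set 'I_n}}) B B' :
  crossing_graph rho B B' = crossing_graph rho B' B.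
Proof. by rewrite /crossing_graph crossingC eq_sym andbCA. Qed.

(** The notion [acyclic] over any finite type, since the later cancellation of pyramids takes place
    in an abstract graph; on blocks the two are convertible. *)
Definition acyclic_arcs (T : finType) (a : {set T * T}) : bool :=
  [forall B, forall C, ((B, C) \in a) ==> ~~ connect (fun D D' => (D, D') \in a) C B].

Lemma acyclic_arcsP (T : finType) (a : {set T * T}) :
  reflect (exists r : T -> nat, forall B C, (B, C) \in a -> r B < r C) (acyclic_arcs a).
Proof.
apply: (iffP idP) => [/forallP ac|[r mono]].
  (* The rank counts the vertices from which [B] can be reached; along an arc from [B] to [C] the
     vertex [C] itself is new. *)
  exists (fun B => #|[set C | connect (fun D D' => (D, D') \in a) C B]|) => B C BC.
  apply/proper_card/properP; split.
    by apply/subsetP => D; rewrite !inE => /connect_trans; apply; apply: connect1.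
  exists C; rewrite inE ?connect0 //.
  by have /forallP/(_ C)/implyP/(_ BC) := ac B.
apply/forallP => B; apply/forallP => C; apply/implyP => BC.
apply/negP => /connectP[s].
suff le D t : path (fun D D' => (D, D') \in a) D t -> r D <= r (last D t).
  by move=> /le le' E; have := mono _ _ BC; rewrite E; lia.
elim: t D => //= D' t IH D /andP[/mono lt /IH]; lia.
Qed.

Lemma acyclicP n (a : arcs n) :
  reflect (exists r : {set 'I_n} -> nat, forall B C, (B, C) \in a -> r B < r C) (acyclic a).
Proof. exact: acyclic_arcsP. Qed.

(** Descending along [r] links every block to [top]. The rank comes from hook starts for
    configurations and from acyclicity for abstract orientations. *)
Lemma connected_from_top n (rho : {set {set 'I_n}}) top (r : {set 'I_n} -> nat) :
  (forall B, B \in rho -> B != top -> exists2 C, crossing_graph rho C B & r C < r B) ->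
  connected_partition rho.
Proof.
move=> pred.
have conn B : B \in rho -> connect (crossing_graph rho) top B.
  have [k] := ubnP (r B); elim: k B => // k IH B lt Bin.
  have [->|/(pred B Bin)[C cr lt']] := eqVneq B top; first exact: connect0.
  apply: connect_trans (connect1 cr); apply: IH; first lia.
  by case/and4P: cr.
have sym : connect_sym (crossing_graph rho).
  by apply: sym_connect_sym => B C; rewrite crossing_graphC.
apply/forall_inP => B Bin; apply/forall_inP => C Cin.
by apply: connect_trans (conn _ Cin); rewrite sym conn.
Qed.

(** * Colors of points and their classes *)

Section ValidConfiguration.
Variables (m : nat) (p : 'S_m) (H : seq (hook m)).
Hypothesis valid : valid_hook_configuration p H.

Lemma vhc_hook (h : hook m) : h \in H -> h.1 < h.2 /\ p h.1 < p h.2.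
Proof. by case: valid => H1 _ _ _ /H1/andP. Qed.

Lemma vhc_below (h : hook m) (l : 'I_m) : h \in H -> h.1 < l < h.2 -> p l < p h.2.
Proof. by case: valid => _ _ H3 _ /H3; apply. Qed.

Lemma vhc_uniq_sources : uniq [seq (h : hook m).1 | h <- H].
Proof. by case: valid => _ -> _ _; apply: enum_uniq. Qed.

Lemma vhc_uniq : uniq H.
Proof. exact: map_uniq vhc_uniq_sources. Qed.

Lemma vhc_source_inj : {in H &, injective (fun h : hook m => h.1)}.
Proof.
have := vhc_uniq_sources; elim: (H) => // h s IH /= /andP[nin us] a b.
rewrite !inE => /predU1P[->|ain] /predU1P[->|bin] //= E.
- by case/negP: nin; rewrite E; apply: (map_f (fun h : hook m => h.1)).
- by case/negP: nin; rewrite -E; apply: (map_f (fun h : hook m => h.1)).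
- exact: IH.
Qed.

Lemma vhc_inner (h h' : hook m) : h \in H -> h' \in H -> h.1 < h'.1 < h.2 -> p h'.2 < p h.2.
Proof.
move=> hH h'H lt; case: valid => V1 _ V3 V4.
have neq : h != h' by apply: contraTneq lt => ->; rewrite ltnn.
by apply: (hooks_compatible_inner _ _ _ lt); [exact: V1|exact: V1|exact: V4|exact: V3].
Qed.

Lemma vhc_target_inj : {in H &, injective (fun h : hook m => h.2)}.
Proof.
move=> h h' hH h'H /= E; case: valid => V1 _ _ V4.
apply/eqP/negPn/negP => neq.
by have := hooks_compatible_target (V1 _ hH) (V1 _ h'H) (V4 _ _ hH h'H neq); rewrite E eqxx.
Qed.

(** The point after the descent at [h.1], which turns out to be the leftmost point of the color of
    [h]. For a hook of the configuration [h.1.+1] is in range, so the default of [insubd] is not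
    taken. *)
Definition hook_start (h : hook m) : 'I_m := insubd h.1 h.1.+1.

Lemma hook_startE (h : hook m) : h \in H -> hook_start h = h.1.+1 :> nat.
Proof.
move=> /vhc_hook[lt _]; rewrite val_insubd ifT //.
exact: leq_ltn_trans lt (ltn_ord _).
Qed.

Lemma hook_start_lt (h : hook m) : h \in H -> p (hook_start h) < p h.1.
Proof.
move=> hH; have := map_f (fun h : hook m => h.1) hH.
case: (valid) => _ -> _ _; rewrite mem_enum inE => /existsP[j /andP[/eqP E lt]].
by have -> : hook_start h = j by apply/val_inj; rewrite /= hook_startE.
Qed.

Lemma hook_of_descent (i j : 'I_m) :
  j = i.+1 :> nat -> p j < p i -> exists2 h : hook m, h \in H & h.1 = i.
Proof.
move=> E lt; have: i \in enum (descents p).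
  by rewrite mem_enum inE; apply/existsP; exists j; rewrite E eqxx.
by case: (valid) => _ <- _ _ => /mapP[h hH ->]; exists h.
Qed.

Lemma hook_start_lt_target (h : hook m) : h \in H -> hook_start h < h.2 /\ p (hook_start h) < p h.2.
Proof.
move=> hH; have [lt plt] := vhc_hook hH.
have := hook_start_lt hH; have := hook_startE hH => E lt'.
split; last lia.
have neq: hook_start h != h.2 by apply/eqP => E'; move: lt'; rewrite E'; lia.
by have := ord_neq neq; lia.
Qed.

(** A hook ending right after the descent at [h.1] either starts there and would have to rise along
    a descent, or starts earlier and has the higher point at [h.1] above it. *)
Lemma hook_start_not_target (h h' : hook m) : h \in H -> h' \in H -> h'.2 != hook_start h.
Proof.
move=> hH h'H; apply/eqP => E.
have [lt' plt'] := vhc_hook h'H; have lt := hook_start_lt hH.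
have Es := hook_startE hH.
have [E1|neq] := eqVneq h'.1 h.1.
  by move: plt'; rewrite E1 E; lia.
have Ev : h'.2 = hook_start h :> nat by rewrite E.
have : p h.1 < p h'.2.
  apply: vhc_below => //; have := ord_neq neq => neqn; apply/andP; split; lia.
by rewrite E; lia.
Qed.

Lemma point_color_target (h : hook m) : h \in H -> point_color p H h.2 = Some h.
Proof.
move=> hH; rewrite /point_color; case: pickP => [h' /andP[h'H /eqP E]|/(_ h)].
  by congr Some; apply: vhc_target_inj.
by rewrite hH eqxx.
Qed.

Variant point_color_spec (l : 'I_m) : color m -> Prop :=
| ColorTarget (h : hook m) of h \in H & h.2 = l : point_color_spec l (Some h)
| ColorSeen (h : hook m) of h \in H & h.1 < l < h.2
    & (forall h' : hook m, h' \in H -> h'.1 < l < h'.2 -> p h.2 <= p h'.2)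
    : point_color_spec l (Some h)
| ColorBlue of (forall h : hook m, h \in H -> ~~ (h.1 < l <= h.2)) : point_color_spec l None.

Lemma point_colorP l : point_color_spec l (point_color p H l).
Proof.
rewrite /point_color; case: pickP => [h /andP[hH /eqP E]|not_target].
  exact: ColorTarget.
case: pickP => [h0 sees0|not_seen].
  case: arg_minnP => // h /andP[hH lt] min; apply: ColorSeen => // h' h'H lt'.
  by apply: min; rewrite /sees /= h'H.
apply: ColorBlue => h hH; apply/negP => /andP[lt].
rewrite leq_eqVlt => /predU1P[E|lt'].
  have := not_target h; rewrite hH /= => /negP; apply.
  by rewrite -val_eqE /= E.
by have /negP[] := negbT (not_seen h); apply/and3P; split.
Qed.

Lemma point_color_range (l : 'I_m) (h : hook m) :
  point_color p H l = Some h -> h \in H /\ h.1 < l <= h.2.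
Proof.
case: point_colorP => // h' h'H.
  by move=> <- [<-]; split=> //; have [-> _] := vhc_hook h'H; rewrite leqnn.
by move=> /andP[lt lt'] _ [<-]; rewrite lt (ltnW lt').
Qed.

(** Another hook over this point starts further left, so [h] starts strictly under it and
    [vhc_inner] makes [h] the lower of the two. *)
Lemma point_color_start (h : hook m) : h \in H -> point_color p H (hook_start h) = Some h.
Proof.
move=> hH; have Es := hook_startE hH; have [lt plt] := hook_start_lt_target hH.
case: point_colorP => [h' h'H E|h' h'H lt' min|/(_ _ hH)].
- by have := hook_start_not_target hH h'H; rewrite E eqxx.
- congr Some; apply/eqP/negPn/negP => neq.
  have neq1 : h'.1 != h.1 :> nat.
    by apply: contraNneq neq => E; apply/eqP/vhc_source_inj => //; apply/val_inj.
  have le : p h'.2 <= p h.2 by apply: min => //; lia.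
  have : p h.2 < p h'.2 by apply: vhc_inner => //; lia.
  lia.
- by move=> /negP[]; lia.
Qed.

Lemma point_color0 (l : 'I_m) : l = 0 :> nat -> point_color p H l = None.
Proof.
move=> E; case C: (point_color p H l) => [h|//].
by have [_] := point_color_range C; rewrite E.
Qed.

Definition color_class (c : color m) : {set 'I_m.+1} := [set v | value_color p H v == c].

Lemma color_classesE :
  color_classes p H = [set color_class (value_color p H v) | v in [set: 'I_m.+1]].
Proof.
apply: eq_in_imset => v _; apply/setP => w.
by rewrite !inE eq_sym.
Qed.

Lemma value_color_lift l : value_color p H (lift ord_max (p l)) = point_color p H l.
Proof. by rewrite /value_color liftK permK. Qed.

Lemma value_color_max : value_color p H ord_max = None.
Proof. by rewrite /value_color unlift_none. Qed.

Lemma mem_color_class_lift c l :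
  (lift ord_max (p l) \in color_class c) = (point_color p H l == c).
Proof. by rewrite inE value_color_lift. Qed.

Lemma lift_ord_max_val n (i : 'I_n) : lift ord_max i = i :> nat.
Proof. by rewrite /= /bump leqNgt ltn_ord. Qed.

Lemma color_class_in_hook (h : hook m) : h \in H -> color_class (Some h) \in color_classes p H.
Proof.
move=> hH; rewrite color_classesE; apply/imsetP.
by exists (lift ord_max (p h.2)) => //; rewrite value_color_lift point_color_target.
Qed.

Lemma color_class_in_blue : color_class None \in color_classes p H.
Proof.
rewrite color_classesE; apply/imsetP.
by exists ord_max => //; rewrite value_color_max.
Qed.

Lemma color_classes_elim (P : {set 'I_m.+1} -> Prop) :
  P (color_class None) -> (forall h : hook m, h \in H -> P (color_class (Some h))) ->
  forall B, B \in color_classes p H -> P B.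
Proof.
move=> P0 P1 B; rewrite color_classesE => /imsetP[v _ ->].
rewrite /value_color; case: unliftP => [w _|] //.
by case C: point_color => [h|//]; apply: P1; case: (point_color_range C).
Qed.

Lemma color_class_inj c c' v : v \in color_class c -> v \in color_class c' -> c = c'.
Proof. by rewrite !inE => /eqP-> /eqP. Qed.

Lemma max_in_color_class c : (ord_max \in color_class c) = (c == None).
Proof. by rewrite inE value_color_max eq_sym. Qed.

Lemma bigmin_eq (A : {set 'I_m}) i0 :
  i0 \in A -> (forall i, i \in A -> i0 <= i) -> \big[minn/m]_(i in A) (i : nat) = i0.
Proof.
move=> iA min; apply/eqP; rewrite eqn_leq; apply/andP; split; last first.
  elim/big_ind: _ => [|x y|i /min] //; first exact/ltnW.
  by rewrite leq_min => -> ->.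
have : i0 \in index_enum 'I_m by rewrite mem_index_enum.
elim: (index_enum _) => // i r IH; rewrite inE big_cons => /predU1P[<-|/IH le].
  by rewrite iA geq_minl.
by case: ifP => // _; rewrite geq_min le orbT.
Qed.

Lemma min_hat_hook (h : hook m) : h \in H -> min_hat p (color_class (Some h)) = hook_start h.
Proof.
move=> hH; apply: bigmin_eq => [|i]; rewrite inE mem_color_class_lift.
  by rewrite point_color_start.
by move=> /eqP/point_color_range[_ /andP[]]; rewrite hook_startE.
Qed.

Lemma min_hat_blue : 0 < m -> min_hat p (color_class None) = 0.
Proof.
move=> m0; apply: (@bigmin_eq _ (Ordinal m0)) => [|i _] //.
by rewrite inE mem_color_class_lift point_color0.
Qed.

(* Choosing the leftmost point forces its color class to leave the value
   interval of [h], unless its hook starts before [q]. *)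
Lemma point_in_hook_interval (h : hook m) q : h \in H -> q <= h.1 ->
  exists l : 'I_m, [/\ q <= l <= h.1, p (hook_start h) < p l < p h.2,
     point_color p H l != Some h &
     crossing (color_class (point_color p H l)) (color_class (Some h)) \/
     exists h' : hook m, [/\ h' \in H, point_color p H l = Some h', h'.1 < q & p h'.2 < p h.2]].
Proof.
move=> hH qh; have [lt1 lt2] := vhc_hook hH; have lt3 := hook_start_lt hH.
pose P := [pred l : 'I_m | (q <= l <= h.1) && (p (hook_start h) < p l < p h.2)].
have P0 : P h.1 by rewrite /= qh leqnn lt2 lt3.
case: (arg_minnP (fun l : 'I_m => l : nat) P0) => l /andP[ql pl] min.
have nh : point_color p H l != Some h.
  by apply/eqP => /point_color_range[_]; lia.
exists l; split=> //.
have [|ncross] := boolP (crossing _ _); [by left | right].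
(* Without a crossing the class of [l] is confined to the value interval of [h]. This excludes blue,
   whose class contains the top value. *)
have inside v : v \in color_class (point_color p H l) ->
    p (hook_start h) <= v <= p h.2.
  move=> vB; apply: contraNT ncross => out.
  apply: (@crossing_interval _ _ _ (lift ord_max (p (hook_start h)))
    (lift ord_max (p h.2)) (lift ord_max (p l)) v); rewrite ?mem_color_class_lift //.
  - by rewrite point_color_start.
  - by rewrite point_color_target.
  - by rewrite !lift_ord_max_val.
  - by rewrite !lift_ord_max_val.
move: nh inside; case C: (point_color p H l) => [h'|] nh inside; last first.
  have := inside ord_max; rewrite max_in_color_class eqxx => /(_ isT) /=.
  by have := ltn_ord (p h.2); lia.
have [h'H lt'] := point_color_range C.
have := inside (lift ord_max (p h'.2)).
rewrite mem_color_class_lift point_color_target // eqxx lift_ord_max_val => /(_ isT) in2.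
have := inside (lift ord_max (p (hook_start h'))).
rewrite mem_color_class_lift point_color_start // eqxx lift_ord_max_val => /(_ isT) in1.
have neq : p h'.2 <> p h.2 :> nat.
  by move=> /val_inj/perm_inj/(vhc_target_inj h'H hH) E; rewrite E eqxx in nh.
exists h'; split=> //; last lia.
rewrite ltnNge; apply/negP => le.
have [lt1' lt2'] := vhc_hook h'H; have lt3' := hook_start_lt h'H.
(* If [h'] started at or after [q], its southwest endpoint would also have a height in the interval
   and lie to the left of [l]. *)
have : P h'.1 by rewrite /P /=; lia.
by move=> /min; lia.
Qed.

Lemma crossing_graph_classes c c' : color_class c \in color_classes p H ->
  color_class c' \in color_classes p H -> c != c' ->
  crossing_graph (color_classes p H) (color_class c) (color_class c') =
  crossing (color_class c) (color_class c').
Proof.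
move=> cin c'in neq; rewrite /crossing_graph cin c'in /=.
suff -> : color_class c != color_class c' by [].
apply: contra neq => /eqP E; move: cin; rewrite color_classesE => /imsetP[v _ Ev].
have vc : v \in color_class c by rewrite Ev inE.
by apply/eqP/(color_class_inj vc); rewrite -E.
Qed.

Lemma color_class_in l : color_class (point_color p H l) \in color_classes p H.
Proof.
rewrite color_classesE; apply/imsetP.
by exists (lift ord_max (p l)) => //; rewrite value_color_lift.
Qed.

Lemma min_hat_le l : min_hat p (color_class (point_color p H l)) <= l.
Proof.
case C: (point_color p H l) => [h|].
  by have [hH lt] := point_color_range C; rewrite min_hat_hook // hook_startE //; lia.
by rewrite min_hat_blue //; case: (l) => i; apply: leq_ltn_trans.
Qed.

Lemma top_block_blue : top_block (color_classes p H) = [set color_class None].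
Proof.
apply/setP => B; rewrite !inE; apply/andP/eqP => [[Bin /exists_inP[i iB /eqP[E]]]|->].
  have Ei : i = ord_max by apply/val_inj.
  move: Bin iB; rewrite color_classesE Ei => /imsetP[v _ ->].
  by rewrite max_in_color_class => /eqP->.
by rewrite color_class_in_blue; split=> //; apply/exists_inP; exists ord_max;
  rewrite ?max_in_color_class.
Qed.

Lemma hook_has_predecessor (h : hook m) : h \in H ->
  exists2 B, crossing_graph (color_classes p H) B (color_class (Some h)) &
    min_hat p B < min_hat p (color_class (Some h)).
Proof.
(* With [q = 0] the second alternative is void: no hook starts before position 0. *)
move=> hH; have [l [l1 l2 nh]] := point_in_hook_interval hH (leq0n _).
case=> [cr|[h' []] //]; exists (color_class (point_color p H l)).
  by rewrite crossing_graph_classes ?color_class_in ?color_class_in_hook.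
by have := min_hat_le l; rewrite min_hat_hook // hook_startE //; lia.
Qed.

End ValidConfiguration.

Lemma min_hat_neq m (p : 'S_m) (H : seq (hook m)) (B B' : {set 'I_m.+1}) :
  0 < m -> valid_hook_configuration p H ->
  B \in color_classes p H -> B' \in color_classes p H -> B != B' ->
  min_hat p B <> min_hat p B'.
Proof.
move=> m0 V Bin B'in; move: B' B'in; move: B Bin.
apply: (color_classes_elim V) => [|h hH].
  apply: (color_classes_elim V) => [/eqP //|h hH _].
  by rewrite (min_hat_blue V) // (min_hat_hook V) // (hook_startE V).
apply: (color_classes_elim V) => [_|h' h'H neq].
  by rewrite (min_hat_blue V) // (min_hat_hook V) // (hook_startE V).
rewrite !(min_hat_hook V) // !(hook_startE V) // => -[/val_inj E].
by case/eqP: neq; congr (color_class _ _ (Some _)); apply: (vhc_source_inj V).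
Qed.

Lemma Phi_in_Ptilde m (H : hook_tuple m) : 0 < m -> H \in VHC m -> Phi H \in Ptilde m.+1.
Proof.
move=> m0; rewrite inE => /asboolP V; rewrite inE /Phi /=.
set p := conf_perm H in V *; set s := conf_hooks H in V *.
set rho := color_classes p s; set a := [set _ | _].
have inaE B B' : ((B, B') \in a) = crossing_graph rho B B' && (min_hat p B < min_hat p B').
  by rewrite inE.
have mono B B' : (B, B') \in a -> min_hat p B < min_hat p B' by rewrite inaE => /andP[].
(* This one fact yields both the connectedness of the crossing graph and the uniqueness of the
   source. *)
have pred B : B \in rho -> B != color_class p s None -> exists B', (B', B) \in a.
  move=> Bin; move: B Bin; apply: (color_classes_elim V) => [/eqP //|h hs _].
  by have [B cr lt] := hook_has_predecessor V hs; exists B; rewrite inaE cr.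
apply/and5P; split.
- exact: preim_partitionP.
- apply: (@connected_from_top _ _ (color_class p s None) (min_hat p)) => B Bin /(pred B Bin)[C].
  by rewrite inaE => /andP[]; exists C.
- apply/forallP => B; apply/forallP => B'; rewrite !inaE (crossing_graphC _ B' B).
  case: ifP => [cr|-> //]; case/and4P: (cr) => Bin B'in neq _; rewrite cr /=.
  by have := min_hat_neq m0 V Bin B'in neq; case: ltngtP.
- by apply/acyclicP; exists (min_hat p).
- rewrite top_block_blue; apply/eqP/setP => B; rewrite !inE.
  apply/andP/eqP => [[Bin /forallP nin]|->].
    apply/eqP/negPn/negP => /(pred B Bin)[B' B'B]; by have := nin B'; rewrite B'B.
  split; first exact: color_class_in_blue.
  apply/forallP => C; apply/negP => /mono; by rewrite (min_hat_blue V).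
Qed.

(** * Injectivity on matchings *)

Definition block_max n (B : {set 'I_n}) : nat := \max_(i in B) i.

Lemma block_max_pair n (x y : 'I_n) : x < y -> block_max [set x; y] = y.
Proof.
move=> lt; apply/eqP; rewrite eqn_leq; apply/andP; split.
  by apply/bigmax_leqP => i; rewrite !inE => /predU1P[->|/eqP->] //; apply: ltnW.
by rewrite /block_max (bigD1 y) ?leq_maxl // !inE eqxx orbT.
Qed.

(* Among all linear extensions of the acyclic orientation read off a rank, the
   normal one is the greedy one: it always takes the available block with the
   smallest maximum. *)
Definition normal_rank n (rho : {set {set 'I_n}}) (top : {set 'I_n})
    (r : {set 'I_n} -> nat) : Prop :=
  forall B, B \in rho -> B != top ->
    exists B', [/\ crossing_graph rho B' B, r B' < r B &
      forall C, C \in rho -> r B' < r C < r B -> block_max C < block_max B].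

Section NormalRank.
Variables (n : nat) (rho : {set {set 'I_n}}) (top : {set 'I_n}).

Lemma normal_rank_top r B : normal_rank rho top r -> B \in rho -> r top <= r B.
Proof.
move=> nr; have [k] := ubnP (r B); elim: k B => // k IH B lt Bin.
have [->//|neq] := eqVneq B top.
have [B' [/and4P[B'in _ _ _] lt' _]] := nr B Bin neq.
have : r B' < k by lia.
by move=> /IH/(_ B'in); lia.
Qed.

(* Two normal ranks agree by comparing the first blocks at which they differ. *)
Lemma normal_rank_unique r r' :
  {in rho &, injective (@block_max n)} -> {in rho &, injective r} ->
  {in rho &, injective r'} -> normal_rank rho top r -> normal_rank rho top r' ->
  (forall B C, crossing_graph rho B C -> (r B < r C) = (r' B < r' C)) ->
  {in rho &, forall B C, (r B < r C) = (r' B < r' C)}.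
Proof.
move=> bmax_inj r_inj r'_inj nr nr' same.
pose below (f : {set 'I_n} -> nat) B := [set C in rho | f C < f B].
suff eq_below B : B \in rho -> below r B = below r' B.
  by move=> B C Bin Cin; move/setP/(_ B): (eq_below C Cin); rewrite !inE Bin.
have [k] := ubnP (r B); elim: k B => // k IH B ltk Bin.
have {}IH C : C \in rho -> r C < r B ->
    forall E, E \in rho -> (r E < r C) = (r' E < r' C).
  move=> Cin lt E Ein; have /setP/(_ E) : below r C = below r' C by apply: IH => //; lia.
  by rewrite !inE Ein.
(* After the common initial segment the next block is [B] for [r] and, for [r'], the block [B']
   chosen below. *)
pose P := [pred C | (C \in rho) && (r B <= r C)].
have PB : P B by rewrite /P /= Bin leqnn.
case: (arg_minnP r' PB) => B' /andP[B'in leB'] min.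
have [EB'|neq] := eqVneq B' B.
  apply/setP => C; rewrite !inE; case Cin: (C \in rho) => //=.
  apply/idP/idP => [lt|lt].
    rewrite ltnNge; apply/negP; rewrite leq_eqVlt => /predU1P[/r'_inj|lt'].
      by move=> /(_ Bin Cin) E; rewrite E in lt; lia.
    by have := IH C Cin lt B Bin; rewrite lt'; lia.
  rewrite ltnNge; apply/negP => le; have := min C; rewrite /= Cin le EB' => /(_ isT).
  lia.
have rlt : r B < r B'.
  rewrite ltn_neqAle leB' andbT; apply: contra neq => /eqP/r_inj E.
  by rewrite E.
have r'lt : r' B' < r' B.
  rewrite ltn_neqAle min // andbT; apply: contra neq => /eqP/r'_inj E.
  by rewrite E.
have B'top : B' != top.
  by apply: contraTneq rlt => ->; have := normal_rank_top nr Bin; lia.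
have Btop : B != top.
  by apply: contraTneq r'lt => ->; have := normal_rank_top nr' B'in; lia.
have early E : E \in rho -> r' E < r' B' -> r E < r B.
  move=> Ein; rewrite !ltnNge; apply: contra => le; apply: min.
  by rewrite /P /= Ein.
(* One of the two ranks delays the block with the smaller maximum. In that rank the other block lies
   between the delayed one and its crossing witness, which normality forbids. *)
case: (ltngtP (block_max B) (block_max B')) => [lt|lt|/bmax_inj E]; last first.
- by move: neq; rewrite E ?eqxx.
- have [E [cr ltE between]] := nr B' B'in B'top; case/and4P: (cr) => Ein _ _ _.
  have ltE' : r E < r B by apply: early => //; rewrite -same.
  by have := between B Bin; rewrite ltE' rlt => /(_ isT)/(ltn_trans lt); rewrite ltnn.
- have [E [cr ltE between]] := nr' B Bin Btop; case/and4P: (cr) => Ein _ _ _.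
  have ltE' : r E < r B by rewrite same.
  have := between B' B'in; rewrite r'lt andbT => bt; suff /bt/(ltn_trans lt) : r' E < r' B' by rewrite ltnn.
  rewrite ltnNge leq_eqVlt; apply/negP => /predU1P[/r'_inj EE|lt'].
    by move: (ltn_trans ltE' rlt); rewrite EE // ltnn.
  by have := IH E Ein ltE' B' B'in; rewrite lt' ltnNge ltnW // (ltn_trans ltE').
Qed.

End NormalRank.

Lemma card_ord_lt q (i : nat) : i <= q -> #|[set j : 'I_q | j < i]| = i.
Proof.
move=> le; have inj : injective (widen_ord le) by move=> j j' [] /val_inj.
rewrite -[RHS]card_ord -(card_imset predT inj).
apply: eq_card => u; rewrite inE; apply/idP/imsetP => [lt|[j _ ->]] /=; last exact: ltn_ord.
by exists (Ordinal lt) => //; apply/val_inj.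
Qed.

Lemma perm_ord_order n (q q' : 'S_n) :
  (forall v w, (q v < q w) = (q' v < q' w)) -> q = q'.
Proof.
move=> same; have count (f : 'S_n) v : #|[set w | f w < f v]| = f v.
  have -> : [set w | f w < f v] = f @^-1: [set u : 'I_n | u < f v].
    by apply/setP => w; rewrite !inE.
  by rewrite (card_preimset _ (@perm_inj _ f)) card_ord_lt // ltnW.
apply/permP => v; apply/val_inj; rewrite /= -(count q) -(count q').
by apply: eq_card => w; rewrite !inE same.
Qed.

(** * Configurations whose color classes are pairs *)

Section MatchingConfiguration.
Variables (k : nat) (p : 'S_(2 * k).+1) (H : seq (hook (2 * k).+1)).
Hypotheses (valid : valid_hook_configuration p H) (size_H : size H = k).

Let cc := color_class p H.
Let rho := color_classes p H.
Let L (i : 'I_(2 * k).+1) := lift ord_max (p i).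

Lemma lift_in_class c i : (L i \in cc c) = (point_color p H i == c).
Proof. exact: mem_color_class_lift. Qed.

Lemma lift_perm_neq (i j : 'I_(2 * k).+1) : i < j -> L i != L j.
Proof.
by move=> lt; apply/eqP => /lift_inj/perm_inj E; rewrite E ltnn in lt.
Qed.

Lemma hook_pair_sub (h : hook (2 * k).+1) :
  h \in H -> [set L (hook_start h); L h.2] \subset cc (Some h).
Proof.
move=> hH; apply/subsetP => v; rewrite !inE => /orP[]/eqP->.
  by rewrite value_color_lift point_color_start.
by rewrite value_color_lift point_color_target.
Qed.

Lemma blue_pair_sub : [set L ord0; ord_max] \subset cc None.
Proof.
apply/subsetP => v; rewrite !inE => /orP[]/eqP->.
  by rewrite value_color_lift point_color0.
by rewrite value_color_max.
Qed.

Lemma card_hook_pair (h : hook (2 * k).+1) : h \in H -> #|[set L (hook_start h); L h.2]| = 2.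
Proof. by move=> hH; rewrite cards2 lift_perm_neq //; case: (hook_start_lt_target valid hH). Qed.

Lemma card_blue_pair : #|[set L ord0; ord_max]| = 2.
Proof. by rewrite cards2 eq_sym neq_lift. Qed.

Lemma card_color_classes : #|rho| = k.+1.
Proof.
pose C : {set color (2 * k).+1} := None |: [set Some h | h in H].
have -> : rho = cc @: C.
  apply/setP => B; apply/idP/imsetP => [|[c]].
    move: B; apply: (color_classes_elim valid) => [|h hH]; first by exists None; rewrite ?setU11.
    by exists (Some h) => //; rewrite inE imset_f ?orbT.
  rewrite !inE => /predU1P[-> ->|/imsetP[h hH -> ->]].
    exact: color_class_in_blue.
  exact: color_class_in_hook.
rewrite card_in_imset; last first.
  move=> c c' + _ E; have inj v : v \in cc c -> c = c'.
    by move=> vc; apply: (color_class_inj vc); rewrite -/(cc c') -E.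
  rewrite !inE => /predU1P[Ec|/imsetP[h hH Ec]].
    by apply: (inj ord_max); rewrite max_in_color_class Ec.
  by apply: (inj (L h.2)); rewrite lift_in_class point_color_target // Ec.
rewrite cardsU1 card_imset; last exact: Some_inj.
have -> : None \notin [set Some h | h in H] by apply/imsetP => -[].
by have /card_uniqP-> := vhc_uniq valid; rewrite size_H.
Qed.

Lemma card_color_class B : B \in rho -> #|B| = 2.
Proof.
have le2 C : C \in rho -> 2 <= #|C| ?= iff (#|C| == 2).
  move=> Cin; split; last by rewrite eq_sym.
  move: C Cin; apply: (color_classes_elim valid) => [|h hH].
    by apply: leq_trans (subset_leq_card blue_pair_sub); rewrite card_blue_pair.
  by apply: leq_trans (subset_leq_card (hook_pair_sub hH)); rewrite card_hook_pair.
(* The lower bounds add up to [2(k+1)], the number of all values, so each of them is an equality. *)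
have := leqif_sum le2; rewrite sum_nat_const card_color_classes.
have <- := card_partition (preim_partitionP (value_color p H) setT).
rewrite cardsT card_ord => -[_ E].
have : k.+1 * 2 == (2 * k).+2 by apply/eqP; lia.
by rewrite E => /forall_inP all2 /all2/eqP.
Qed.

Lemma hook_class_pair (h : hook (2 * k).+1) :
  h \in H -> cc (Some h) = [set L (hook_start h); L h.2].
Proof.
move=> hH; apply/esym/eqP; rewrite eqEcard hook_pair_sub // card_hook_pair //.
by rewrite card_color_class ?color_class_in_hook.
Qed.

Lemma blue_class_pair : cc None = [set L ord0; ord_max].
Proof.
apply/esym/eqP; rewrite eqEcard blue_pair_sub card_blue_pair.
by rewrite card_color_class ?color_class_in_blue.
Qed.

Lemma block_max_hook (h : hook (2 * k).+1) : h \in H -> block_max (cc (Some h)) = p h.2.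
Proof.
move=> hH; rewrite hook_class_pair // block_max_pair ?lift_ord_max_val //.
by case: (hook_start_lt_target valid hH).
Qed.

Lemma block_max_blue : block_max (cc None) = (2 * k).+1.
Proof. by rewrite blue_class_pair block_max_pair // lift_ord_max_val. Qed.

Lemma block_max_classes_inj : {in rho &, injective (@block_max _)}.
Proof.
move=> B C Bin Cin; move: C Cin; move: B Bin.
apply: (color_classes_elim valid) => [|h hH]; apply: (color_classes_elim valid) => [|h' h'H] //;
  rewrite ?block_max_blue ?block_max_hook // => E.
- by have := ltn_ord (p h'.2); rewrite -E ltnn.
- by have := ltn_ord (p h.2); rewrite E ltnn.
- by move/val_inj/perm_inj/(vhc_target_inj valid hH h'H): E => ->.
Qed.

Lemma min_hat_classes_inj : {in rho &, injective (min_hat p)}.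
Proof.
move=> B C Bin Cin E; apply/eqP/negPn/negP => neq.
exact: (min_hat_neq _ valid Bin Cin neq E).
Qed.

(** Let [C] be the latest block before [B] with a larger maximum; blue always qualifies. The witness
    is the color of the point that [point_in_hook_interval] finds when the search begins at the
    start of [C] instead of position 0. *)
Lemma min_hat_normal : normal_rank rho (cc None) (min_hat p).
Proof.
move=> B Bin; move: B Bin; apply: (color_classes_elim valid) => [/eqP //|h hH _].
set B := color_class p H (Some h).
have [rB0 bB] : min_hat p B = h.1.+1 /\ block_max B = p h.2.
  by rewrite /B (min_hat_hook valid) // (hook_startE valid) // block_max_hook.
have r0 := min_hat_blue valid (ltn0Sn (2 * k)).
pose P := [pred C | [&& C \in rho, min_hat p C < min_hat p B & block_max B < block_max C]].
have P0 : P (cc None).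
  by rewrite /P /= color_class_in_blue block_max_blue /cc r0 rB0 bB ltn_ord.
case: (arg_maxnP (min_hat p) P0) => C /and3P[Cin ltC gtC] max.
have qh : min_hat p C <= h.1 by lia.
have [l [l1 l2 nh cases]] := point_in_hook_interval valid hH qh.
(* A hook that starts before [C] and extends to [l] has the start of [C] under it, so it ends higher
   than [C], hence higher than [B]. This excludes the second alternative. *)
have inner (h1 : hook (2 * k).+1) : 
    h1 \in H -> h1.1.+1 < min_hat p C -> l <= h1.2 -> block_max C < p h1.2.
  move=> h1H; move: C Cin {ltC gtC max qh cases} l1.
  apply: (color_classes_elim valid) => [|h0 h0H] l1.
    by rewrite r0.
  rewrite (min_hat_hook valid) // (hook_startE valid) // => lt le.
  rewrite block_max_hook //; apply: (vhc_inner valid) => //.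
  by move: l1; rewrite (min_hat_hook valid) // (hook_startE valid) //; lia.
case: cases => [cr|[h' [h'H pcl lt' plt']]]; last first.
  have [_ range] := point_color_range valid pcl.
  have neq : h'.1.+1 <> min_hat p C.
    move=> E; have E' : C = cc (Some h').
      apply: min_hat_classes_inj => //; first exact: color_class_in_hook.
      by rewrite (min_hat_hook valid) // (hook_startE valid).
    by move: gtC; rewrite E' bB block_max_hook //; lia.
  by have := inner h' h'H; lia.
exists (cc (point_color p H l)); split.
- by rewrite crossing_graph_classes ?color_class_in ?color_class_in_hook.
- by have := min_hat_le valid l; rewrite /cc rB0; lia.
move=> D Din /andP[gtD ltD]; rewrite ltn_neqAle leqNgt; apply/andP; split.
  by apply: contraTneq ltD => /block_max_classes_inj ->; rewrite ?ltnn ?color_class_in_hook.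
(* By the choice of [C], such a [D] starts no later than [C], so the block of [l] starts before [C].
   Being a pair, it can only have [l] as its target, and [inner] then puts [l] above [C], although
   [l] lies below the target of [h]. *)
apply/negP => gtD'.
have leD : min_hat p D <= min_hat p C by apply: max; rewrite /P /= Din ltD.
case pcl : (point_color p H l) gtD => [h1|] gtD; last first.
  have : L l \in [set L ord0; ord_max] by rewrite -blue_class_pair lift_in_class pcl.
  rewrite !inE => /orP[/eqP/lift_inj/perm_inj El|]; last by rewrite eq_sym (negPf (neq_lift _ _)).
  by move: gtD l1; rewrite El /cc r0 /=; lia.
have [h1H range] := point_color_range valid pcl.
move: gtD; rewrite /cc (min_hat_hook valid) // (hook_startE valid) // => gtD.
have : L l \in [set L (hook_start h1); L h1.2].
  by rewrite -hook_class_pair // lift_in_class pcl.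
rewrite !inE => /orP[]/eqP/lift_inj/perm_inj E.
  by have := hook_startE valid h1H; rewrite -E; lia.
by have := inner h1 h1H; move: l2; rewrite E bB in gtC *; lia.
Qed.


(** The inverse permutation, with the top value placed at the last position, so that the blue pair
    obeys the same comparisons as the pairs of hooks. *)
Definition value_position : 'S_(2 * k).+2 := lift_perm ord_max ord_max p^-1.

Lemma value_position_lift i : value_position (L i) = i :> nat.
Proof. by rewrite /value_position lift_perm_lift permK lift_ord_max_val. Qed.

Lemma value_position_max : value_position ord_max = (2 * k).+1 :> nat.
Proof. by rewrite /value_position lift_perm_id. Qed.

(* The target of a block precedes the start of a later block exactly when it
   lies below the target of a block opened in between. *)
Lemma target_before_start (h h0 : hook (2 * k).+1) :
  h \in H -> h0 \in H -> h.1 < h0.1 ->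
  (h.2 <= h0.1) = [exists D in rho,
    (min_hat p (cc (Some h)) < min_hat p D <= min_hat p (cc (Some h0))) &&
    (block_max (cc (Some h)) < block_max D)].
Proof.
move=> hH h0H lt; rewrite !(min_hat_hook valid) // !(hook_startE valid) // block_max_hook //.
apply/idP/exists_inP => [le|[D Din]]; last first.
  move: D Din; apply: (color_classes_elim valid) => [|h1 h1H].
    by rewrite (min_hat_blue valid).
  rewrite (min_hat_hook valid) // (hook_startE valid) // block_max_hook // => lts.
  rewrite leqNgt; apply/negP => lt'; have := @vhc_inner _ _ _ valid h h1 hH h1H.
  have -> : h.1 < h1.1 < h.2 by lia.
  by move=> /(_ isT); lia.
(* The first descent at or after [h.2] provides [D]: the heights increase from [h.2] up to it, so
   the hook starting there ends above the target of [h]. *)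
pose P := [pred d : 'I_(2 * k).+1 | (h.2 <= d <= h0.1) && (d \in descents p)].
have P0 : P h0.1.
  rewrite /P /= le leqnn -mem_enum /=; case: (valid) => _ <- _ _.
  exact: (map_f (fun h : hook _ => h.1)).
case: (arg_minnP (fun d : 'I_(2 * k).+1 => d : nat) P0) => d /andP[range desc] min.
have [h1 h1H Eh1] : exists2 h1 : hook (2 * k).+1, h1 \in H & h1.1 = d.
  by move: desc; rewrite inE => /existsP[j /andP[/eqP]]; apply: hook_of_descent.
have incr j : h.2 + j <= d -> forall e : 'I_(2 * k).+1, e = h.2 + j :> nat -> p h.2 <= p e.
  elim: j => [|j IH] lej e Ee.
    by have -> : e = h.2 by apply/val_inj; rewrite /= Ee addn0.
  have lt' : h.2 + j < (2 * k).+1 by have := ltn_ord d; lia.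
  have le1 : p h.2 <= p (Ordinal lt') by apply: IH => //; lia.
  rewrite leqNgt; apply/negP => lt2.
  have : Ordinal lt' \in descents p.
    by rewrite inE; apply/existsP; exists e; rewrite Ee /= addnS eqxx; lia.
  move=> desc'; have PO : P (Ordinal lt') by apply/andP; split=> //=; lia.
  by have := min _ PO; rewrite /=; lia.
have le1 : p h.2 <= p d by apply: (incr (d - h.2)); lia.
have [lt1 plt1] := vhc_hook valid h1H.
exists (cc (Some h1)); first exact: color_class_in_hook.
rewrite (min_hat_hook valid) // (hook_startE valid) // block_max_hook // Eh1.
have [lt2 _] := vhc_hook valid hH.
by rewrite Eh1 in plt1; lia.
Qed.

(** The right-hand side mentions only the partition and the order of its blocks, so it transfers to
    any configuration with the same ones. The minimum of [B] sits at its start, before all of [C];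
    for the maximum, [target_before_start] decides. *)
Lemma value_position_ltE (B C : {set 'I_(2 * k).+2}) v w :
  B \in rho -> C \in rho -> v \in B -> w \in C -> min_hat p B < min_hat p C ->
  (value_position v < value_position w) =
  (v != block_max B :> nat) ||
  [exists D in rho, (min_hat p B < min_hat p D <= min_hat p C) && (block_max B < block_max D)].
Proof.
move=> Bin Cin vB + lt; move: C Cin lt.
apply: (color_classes_elim valid) => [|h0 h0H]; first by rewrite (min_hat_blue valid).
rewrite (min_hat_hook valid) // (hook_startE valid) // => lt wC.
have [lt0 plt0] := hook_start_lt_target valid h0H.
have Es0 := hook_startE valid h0H.
have wpos : (w = L (hook_start h0) \/ w = L h0.2) /\ h0.1 < value_position w.
  move: wC; rewrite -/cc hook_class_pair // !inE => /orP[]/eqP->; split; try by [left|right].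
    by rewrite value_position_lift; lia.
  by rewrite value_position_lift; lia.
have w_lt_max : value_position w < (2 * k).+1.
  by case: (wpos) => -[]-> _; rewrite value_position_lift.
move: B Bin vB lt; apply: (color_classes_elim valid) => [|h hH].
  rewrite -/cc blue_class_pair !inE => /orP[]/eqP-> lt.
    rewrite -blue_class_pair block_max_blue value_position_lift lift_ord_max_val.
    by case: wpos => _ w0; rewrite (leq_ltn_trans (leq0n _) w0) (ltn_eqF (ltn_ord _)).
  rewrite value_position_max -blue_class_pair block_max_blue eqxx /= ltnNge ltnW //=.
  apply/esym/exists_inP => -[D Din /andP[_]]; rewrite ltnNge => /negP; apply.
  by apply/bigmax_leqP => i _; rewrite -ltnS.
rewrite (min_hat_hook valid) // (hook_startE valid) // ltnS -/cc => vB lt.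
have [lt1 plt1] := hook_start_lt_target valid hH.
have Es1 := hook_startE valid hH.
have Ew := target_before_start hH h0H lt.
rewrite !(min_hat_hook valid) // !(hook_startE valid) // in Ew.
move: vB; rewrite {1}hook_class_pair // !inE block_max_hook // => /orP[]/eqP->;
  rewrite value_position_lift lift_ord_max_val.
  rewrite (ltn_eqF plt1) /=; case: wpos => _; lia.
rewrite eqxx /= -(block_max_hook hH) -Ew; case: wpos => wE w0.
apply/idP/idP => [lt2|le]; last exact: leq_ltn_trans w0.
rewrite leqNgt; apply/negP => lt3.
have inner := @vhc_inner _ _ _ valid h h0 hH h0H; rewrite lt lt3 in inner.
case: wE lt2 => ->; rewrite value_position_lift; first lia.
move=> lt4; have := @vhc_below _ _ _ valid h0 h.2 h0H; rewrite lt4 andbT.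
by move: (inner isT); lia.
Qed.

Lemma value_position_block (B : {set 'I_(2 * k).+2}) v w : B \in rho -> v \in B -> w \in B ->
  (value_position v < value_position w) = (v < w).
Proof.
suff ex : forall B, B \in rho -> exists s t : 'I_(2 * k).+2,
    [/\ B = [set s; t], s < t & value_position s < value_position t].
  move=> Bin vB wB; have [s [t [EB lt lt']]] := ex B Bin.
  by move: vB wB; rewrite EB !inE => /orP[]/eqP-> /orP[]/eqP->; rewrite ?ltnn //; lia.
apply: (color_classes_elim valid) => [|h hH].
  exists (L ord0), ord_max; rewrite value_position_lift value_position_max lift_ord_max_val.
  by split=> //; apply: blue_class_pair.
have [lt plt] := hook_start_lt_target valid hH.
exists (L (hook_start h)), (L h.2); rewrite !value_position_lift !lift_ord_max_val.
by split=> //; apply: hook_class_pair.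
Qed.
End MatchingConfiguration.

(** * Recovering the configuration from its image *)

Lemma orientation_eq_rank m (p p' : 'S_m) rho :
  [set e : {set 'I_m.+1} * {set 'I_m.+1} |
     crossing_graph rho e.1 e.2 & min_hat p e.1 < min_hat p e.2] =
  [set e : {set 'I_m.+1} * {set 'I_m.+1} |
     crossing_graph rho e.1 e.2 & min_hat p' e.1 < min_hat p' e.2] ->
  forall B C, crossing_graph rho B C -> (min_hat p B < min_hat p C) = (min_hat p' B < min_hat p' C).
Proof. by move=> /setP E B C cr; have := E (B, C); rewrite !inE /= cr. Qed.

Lemma Phi_inj k : {in VHCh k (2 * k).+1 &, injective (@Phi (2 * k).+1)}.
Proof.
move=> [p s] [p' s'].
rewrite !inE => /andP[/asboolP V /eqP Es] /andP[/asboolP V' /eqP Es'].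
rewrite /conf_perm /conf_hooks /= in V V' Es Es'.
rewrite /Phi /conf_perm /conf_hooks /= => E.
have Erho : color_classes p s = color_classes p' s' by case: E.
have blue : color_class p s None = color_class p' s' None.
  have := top_block_blue p s; rewrite Erho (top_block_blue p' s') => /setP/(_ (color_class p' s' None)).
  by rewrite !inE eqxx => /esym/eqP.
have same : forall B C, crossing_graph (color_classes p s) B C ->
    (min_hat p B < min_hat p C) = (min_hat p' B < min_hat p' C).
  by apply: orientation_eq_rank; case: E => _; rewrite -Erho.
have order : {in color_classes p s &, forall B C,
    (min_hat p B < min_hat p C) = (min_hat p' B < min_hat p' C)}.
  apply: (normal_rank_unique (top := color_class p s None)) => //.
  - exact: block_max_classes_inj V Es.
  - exact: min_hat_classes_inj V.
  - rewrite Erho; exact: min_hat_classes_inj V'.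
  - exact: min_hat_normal V Es.
  - rewrite Erho blue; exact: min_hat_normal V' Es'.
have rho_cover v : exists2 B, B \in color_classes p s & v \in B.
  have /and3P[/eqP cov _ _] := preim_partitionP (value_color p s) setT.
  by have := in_setT v; rewrite -{1}cov => /bigcupP[B]; exists B.
have Epos : value_position p = value_position p'.
  apply: perm_ord_order.
  have cross B C v w : B \in color_classes p s -> C \in color_classes p s ->
    v \in B -> w \in C -> min_hat p B < min_hat p C ->
    (value_position p v < value_position p w) = (value_position p' v < value_position p' w).
    move=> Bin Cin vB wC lt; rewrite (value_position_ltE V Es Bin Cin vB wC lt).
    have := Bin; have := Cin; rewrite Erho => Cin' Bin'.
    rewrite (value_position_ltE V' Es' Bin' Cin' vB wC) -?order //; congr (_ || _).
    rewrite -Erho; apply: eq_existsb => D; case Din: (D \in _) => //=.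
    by rewrite (leqNgt (min_hat p D)) (leqNgt (min_hat p' D)) !order.
  move=> v w; have [B Bin vB] := rho_cover v; have [C Cin wC] := rho_cover w.
  case: (ltngtP (min_hat p B) (min_hat p C)) => [lt|lt|EBC].
  - exact: cross lt.
  - have neq : v <> w.
      move=> Evw; have /and3P[_ /trivIsetP triv _] := preim_partitionP (value_color p s) setT.
      have /triv : B != C by apply: contraTneq lt => ->; rewrite ltnn.
      by move=> /(_ Bin Cin)/pred0P/(_ v) /=; rewrite vB Evw wC.
    have flip (q : 'S_(2 * k).+2) : (q v < q w) = ~~ (q w < q v).
      have : q v <> q w by move/perm_inj.
      by case: ltngtP => // /val_inj.
    by rewrite flip [RHS]flip (cross C B).
  - have E' := min_hat_classes_inj V Bin Cin EBC.
    rewrite -E' in wC; rewrite (value_position_block V Es Bin) //.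
    by rewrite Erho in Bin; rewrite (value_position_block V' Es' Bin).
have Ep : p = p'.
  apply: invg_inj; apply/permP => i; apply: (@lift_inj _ ord_max).
  by rewrite -!(lift_perm_lift ord_max ord_max) [LHS](congr1 (fun q : 'S_ _ => q _) Epos).
subst p'; congr existT; apply/val_inj => /=.
(* With a common permutation the sources are its descents, and the target of a hook is the position
   of the maximum of its class. *)
have hook_eq (h h' : hook (2 * k).+1) : h \in tval s -> h' \in tval s' -> h.1 = h'.1 -> h = h'.
  move=> hs h's' E1.
  have Ecc : color_class p s (Some h) = color_class p s' (Some h').
    apply: (min_hat_classes_inj V); rewrite ?color_class_in_hook //.
      by rewrite Erho color_class_in_hook.
    by rewrite (min_hat_hook V) // (min_hat_hook V') //; congr nat_of_ord; rewrite /hook_start E1.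
  have := block_max_hook V Es hs; rewrite Ecc (block_max_hook V' Es') // => /val_inj/perm_inj.
  by case: h h' E1 {hs h's' Ecc} => ? ? [? ?] /= -> ->.
have Emap : [seq (h : hook (2 * k).+1).1 | h <- s] = [seq (h : hook (2 * k).+1).1 | h <- s'].
  by case: V => _ -> _ _; case: V' => _ -> _ _.
elim: (tval s) (tval s') Emap hook_eq => [|h t IH] [|h' t'] //= [E1 Et] eq_hooks.
rewrite (eq_hooks h h') ?mem_head //; congr (_ :: _).
by apply: IH => // g g' gt gt'; apply: eq_hooks; rewrite inE ?gt ?gt' orbT.
Qed.

(** * Surjectivity onto matchings *)

(* The one-line notation is built backwards: the head of [l] is the rightmost
   value, so inserting [:: t; s] puts [s t] right after the last value below
   [t].  A list of pairs to be inserted has its latest pair first. *)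
Fixpoint insert_pair (s t : nat) (l : seq nat) : seq nat :=
  if l is x :: l' then
    if t < x then x :: insert_pair s t l' else [:: t, s & l]
  else [:: t; s].

Fixpoint build (V : seq (nat * nat)) : seq nat :=
  if V is b :: V' then insert_pair b.1 b.2 (build V') else [::].

Section Build.
Variable W : seq (nat * nat).

Definition is_start (v : nat) : bool := v \in [seq b.1 | b <- W].
(** Meaningful on starts only; elsewhere it takes the value 0 from the default pair. *)
Definition partner (v : nat) : nat := (nth (0, 0) W (index v [seq b.1 | b <- W])).2.

(* The first entry below [t] lies above [s] and is not preceded by a start. *)
Fixpoint insertable (s t : nat) (l : seq nat) : bool :=
  if l is x :: l' then
    if t < x then ~~ is_start x && insertable s t l' else s < x < t
  else false.

(** In one-line notation [y] comes right after [x]. Thus descents occur exactly before starts, and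
    [x < partner y] makes the hook at such a descent rise. *)
Definition adjacent (y x : nat) : bool :=
  if is_start y then y < x < partner y else x < y.

Fixpoint buildable (V : seq (nat * nat)) : Prop :=
  if V is b :: V' then
    [/\ b \in W, b.1 < b.2, b.1 \notin build V', b.2 \notin build V' &
        build V' = [::] \/ insertable b.1 b.2 (build V')] /\ buildable V'
  else True.

(** The first entry below [t] exceeds [s], hence [t'], so the new pair lands behind it and the place
    for [s t] survives. *)
Lemma insertable_insert_below s t s' t' l :
  t' < s -> s < t -> insertable s t l -> insertable s t (insert_pair s' t' l).
Proof.
move=> lt lt'; elim: l => //= x l IH.
case: ifP => [tx /andP[nx /IH ok]|ntx /andP[sx xt]].
  have -> : t' < x by lia.
  by rewrite /= tx nx.
have -> : t' < x by lia.
by rewrite /= ntx sx xt.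
Qed.

(** Here a place for [s t] is created: whatever precedes [t'] exceeds it and is no start, so the
    first entry below [t] is at least [t'], hence above [s]. *)
Lemma insertable_insert_inside s t s' t' l :
  s < t' < t -> t \notin l -> l = [::] \/ insertable s' t' l ->
  insertable s t (insert_pair s' t' l).
Proof.
move=> lt tl [->|]; first by rewrite /= ltnNge ltnW //; lia.
elim: l tl => //= x l IH; rewrite inE negb_or => /andP[neq /IH {}IH].
case: ifP => [tx /andP[nx /IH ok]|ntx _] /=; last by rewrite ltnNge ltnW //; lia.
by rewrite nx ok; case: ifP => //; lia.
Qed.

(** Again a place is created: all entries up to [t'] exceed [t] and are no starts, and the next
    entry is [s']. *)
Lemma insertable_insert_straddle s t s' t' l :
  s < s' -> s' < t -> t < t' -> ~~ is_start t' -> l = [::] \/ insertable s' t' l ->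
  insertable s t (insert_pair s' t' l).
Proof.
move=> lt1 lt2 lt3 nt' [->|]; first by rewrite /= lt3 nt' (ltnNge t) ltnW //= lt1 lt2.
elim: l => //= x l IH.
case: ifP => [tx /andP[nx /IH ok]|ntx _] /=.
  by rewrite nx ok (ltn_trans lt3).
by rewrite lt3 nt' (ltnNge t) ltnW //= lt1 lt2.
Qed.

Lemma insert_pair_split s t l : l = [::] \/ insertable s t l ->
  exists Y X, [/\ l = Y ++ X, insert_pair s t l = Y ++ [:: t, s & X] &
    all (fun y => (t < y) && ~~ is_start y) Y].
Proof.
case=> [->|]; first by exists [::], [::].
elim: l => //= x l IH; case: ifP => [tx /andP[nx /IH]|_ _].
  by move=> [Y [X [-> -> aY]]]; exists (x :: Y), X; rewrite /= tx nx.
by exists [::], (x :: l).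
Qed.

Lemma adjacent_insert s t l : is_start s -> partner s = t -> ~~ is_start t -> s < t ->
  l = [::] \/ insertable s t l -> sorted adjacent l -> sorted adjacent (insert_pair s t l).
Proof.
move=> ss ps nt lt [->|]; first by rewrite /= /adjacent (negPf nt) lt.
have pth l' z : t < z -> ~~ is_start z -> insertable s t l' -> path adjacent z l' ->
    path adjacent z (insert_pair s t l').
  elim: l' z => //= x l' IH z tz nz; case: ifP => [tx /andP[nx ok]|_ /andP[sx xt]].
    by case/andP=> a1 a2; rewrite /= a1 IH.
  by case/andP=> _ a2; rewrite /= a2 /adjacent (negPf nz) tz (negPf nt) lt ss ps sx xt.
case: l => //= x l; case: ifP => [tx /andP[nx ok]|ntx /andP[sx xt]] srt; first exact: pth.
by rewrite /= srt /adjacent (negPf nt) lt ss ps sx xt.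
Qed.

Lemma mem_insert_pair s t l x : (x \in insert_pair s t l) = [|| x == t, x == s | x \in l].
Proof. by elim: l => //= y l IH; case: ifP => _; rewrite !inE ?IH //; do !bool_congr. Qed.

Lemma mem_build V x : (x \in build V) = has (fun b => (x == b.1) || (x == b.2)) V.
Proof. by elim: V => //= b V IH; rewrite mem_insert_pair IH orbA [(x == b.2) || _]orbC. Qed.

Lemma build_pair_mem V (b : nat * nat) : b \in V -> b.1 \in build V /\ b.2 \in build V.
Proof. by move=> bV; rewrite !mem_build; split; apply/hasP; exists b; rewrite ?eqxx ?orbT. Qed.

Section Step.
Variables (s t : nat) (l : seq nat).
Hypotheses (lt : s < t) (nsl : s \notin l) (ntl : t \notin l).
Hypothesis ok : l = [::] \/ insertable s t l.
Let l' := insert_pair s t l.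

(** Old entries keep their relative order and shift by two behind the cut [c]; the properties of
    built words below become arithmetic with this cut. *)
Lemma insert_indices : exists c,
  [/\ index t l' = c, index s l' = c.+1,
      forall u, u \in l -> index u l' = if index u l < c then index u l else (index u l).+2 &
      forall u, u \in l -> index u l < c -> t < u /\ ~~ is_start u].
Proof.
have [Y [X [E E' aY]]] := insert_pair_split ok.
have notin x : x \notin l -> (x \in Y) = false.
  by apply: contraNF => xY; rewrite E mem_cat xY.
have inY u : u \in l -> (index u l < size Y) = (u \in Y).
  move=> ul; rewrite E index_cat; case uY: (u \in Y); first by rewrite index_mem uY.
  by rewrite ltnNge leq_addr.
exists (size Y); split=> [||u ul|u ul].
- by rewrite /l' E' !index_cat notin //= eqxx addn0.
- by rewrite /l' E' !index_cat notin //= eqxx gtn_eqF // addn1.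
- rewrite inY // /l' E' E !index_cat; case: ifP => // _ /=.
  have [-> ->] : (t == u) = false /\ (s == u) = false.
    by split; [apply: contraNF ntl|apply: contraNF nsl] => /eqP->.
  by rewrite !addnS.
- by rewrite inY // => uY; case/allP/(_ u uY)/andP: aY => -> ->.
Qed.

Lemma insert_uniq : uniq l -> uniq l'.
Proof.
have [Y [X [E E' _]]] := insert_pair_split ok; rewrite /l' E' E => u.
rewrite (perm_uniq (s2 := [:: t, s & Y ++ X])); last first.
  by rewrite (perm_catCA Y [:: t; s] X).
by rewrite -E in u *; rewrite /= inE negb_or ntl nsl u !andbT gtn_eqF.
Qed.

End Step.

Hypothesis W_uniq : uniq [seq b.1 | b <- W].
Hypothesis W_targets : forall b : nat * nat, b \in W -> ~~ is_start b.2.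

Lemma is_start_pair (b : nat * nat) : b \in W -> is_start b.1.
Proof. exact: map_f. Qed.

Lemma partnerE (b : nat * nat) : b \in W -> partner b.1 = b.2.
Proof.
move=> bW; have E : nth 0 [seq b.1 | b <- W] (index b W) = b.1.
  by rewrite (nth_map (0, 0)) ?index_mem // nth_index.
by rewrite /partner -E index_uniq ?size_map ?index_mem // nth_index.
Qed.

Lemma buildable_sub V (b : nat * nat) : buildable V -> b \in V -> b \in W /\ b.1 < b.2.
Proof.
elim: V => //= c V IH [[cW lt _ _ _] bV]; rewrite inE => /predU1P[->//|].
exact: IH.
Qed.

Lemma build_uniq V : buildable V -> uniq (build V).
Proof. elim: V => //= b V IH [[_ lt n1 n2 ok] /IH].
exact: (insert_uniq lt n1 n2 ok). Qed.

Lemma build_sorted V : buildable V -> sorted adjacent (build V).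
Proof.
elim: V => //= b V IH [[bW lt n1 n2 ok] /IH]; apply: adjacent_insert => //.
- exact: is_start_pair.
- exact: partnerE.
- exact: W_targets.
Qed.

Lemma build_target_before_start V (b : nat * nat) : buildable V -> b \in V ->
  index b.2 (build V) < index b.1 (build V).
Proof.
elim: V => //= c V IH [[cW lt n1 n2 ok] bV].
have [i [Et Es old _]] := insert_indices lt n1 n2 ok.
rewrite inE => /predU1P[->|bin]; first by rewrite Et Es.
have [b1 b2] := build_pair_mem bin; move: (IH bV bin); rewrite !old // {IH}.
by move: (index _ _) (index _ _) => x y; clear; do !case: ifP; lia.
Qed.

(** No point lies above the hook of [b]: a pair inserted between the entries of [b] has passed
    [b.2], and insertion passes only entries larger than the inserted target. *)
Lemma build_below_target V (b : nat * nat) x : buildable V -> b \in V ->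
  index b.2 (build V) < index x (build V) < index b.1 (build V) -> x < b.2.
Proof.
elim: V => //= c V IH [[cW lt n1 n2 ok] bV] bin btw.
have xin : x \in build (c :: V).
  by rewrite -index_mem /=; case/andP: btw => _ /leq_trans; apply; apply: index_size.
have [i [Et Es old oldt]] := insert_indices lt n1 n2 ok.
move: bin; rewrite inE => /predU1P[Eb|bin].
  by move: btw; rewrite Eb Et Es; clear; lia.
have [b1 b2] := build_pair_mem bin.
have lt2 : index b.2 (build V) < i -> c.2 < b.2 by case/(oldt _ b2).
have {}IH := IH bV bin.
move: btw; rewrite (old _ b1) (old _ b2).
move: xin; rewrite /= mem_insert_pair => /or3P[/eqP Ex|/eqP Ex|xin].
- rewrite Ex Et; case: (ltnP (index b.2 _) i) lt2 => [_ /(_ isT) //|le _] /andP[]; clear -le; lia.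
- rewrite Ex Es; case: (ltnP (index b.2 _) i) lt2 => [_ /(_ isT) lt' _|le _]; first exact: ltn_trans lt'.
  by case/andP; clear -le; lia.
- rewrite old // => btw; apply: IH; move: btw.
  by move: (index _ _) (index _ _) (index _ _) => u v w; clear; do !case: ifP; lia.
Qed.

(** A pair enters as two adjacent entries and relative order persists. If [b] enters after [c], no
    entry of [c] gets between its two; if [c] enters after [b], both of its entries fall into the
    same gap. *)
Lemma build_nested V (b c : nat * nat) : buildable V -> b \in V -> c \in V ->
  index b.2 (build V) < index c.1 (build V) < index b.1 (build V) ->
  index b.2 (build V) < index c.2 (build V).
Proof.
elim: V => //= d V IH [[dW lt n1 n2 ok] bV].
have [i [Et Es old _]] := insert_indices lt n1 n2 ok.
rewrite !inE => /predU1P[->|bin].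
  by rewrite Et Es; clear; lia.
have [b1 b2] := build_pair_mem bin; rewrite (old _ b1) (old _ b2).
move=> /predU1P[->|cin].
  by rewrite Et Es; move: (index _ _) (index _ _) => u v; clear; do !case: ifP; lia.
have [c1 c2] := build_pair_mem cin; have /implyP := IH bV bin cin.
rewrite implybE (old _ c1) (old _ c2).
move: (index _ _) (index _ _) (index _ _) (index _ _) => u v w x; clear.
by do !case: ifP; lia.
Qed.

(** Insertion never passes a start, so from left to right in one-line notation the starts appear in
    order of insertion. *)
Lemma build_start_order V (b c : nat * nat) : buildable V -> c \in V -> index b V < index c V ->
  index b.1 (build V) < index c.1 (build V).
Proof.
elim: V => //= d V IH [[dW lt n1 n2 ok] bV].
have [i [Et Es old olds]] := insert_indices lt n1 n2 ok.
rewrite inE (eq_sym c); case: (eqVneq d c) => [->|neq] //= cin.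
have [c1 c2] := build_pair_mem cin.
have [cW _] := buildable_sub bV cin.
case: (eqVneq d b) => [<- _|neq' lt'].
  rewrite Es old //; case: (ltnP (index c.1 _) i) => [/(olds _ c1)[_]|le].
    by rewrite is_start_pair.
  by rewrite !ltnS.
rewrite ltnS in lt'; have bin : b \in V by rewrite -index_mem (leq_trans lt') ?index_size.
have [b1 _] := build_pair_mem bin; move: (IH bV cin lt'); rewrite !old //.
by move: (index _ _) (index _ _) => u v; clear; do !case: ifP; lia.
Qed.

(** The pair inserted first stays outermost: every later target is smaller than [b0.2], and a legal
    place is never behind the final entry. *)
Lemma build_first V (b0 : nat * nat) :
  buildable (rcons V b0) -> (forall b : nat * nat, b \in V -> b.2 < b0.2) ->
  index b0.2 (build (rcons V b0)) = 0 /\ index b0.1 (build (rcons V b0)) = (size V).*2.+1.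
Proof.
move=> + lt; suff: buildable (rcons V b0) ->
    exists l, build (rcons V b0) = b0.2 :: rcons l b0.1 /\ size l = (size V).*2.
  move=> ex bV; have [l [E Es]] := ex bV; have := build_uniq bV.
  rewrite E /= eqxx => /andP[]; rewrite mem_rcons inE negb_or => /andP[neq nin].
  rewrite rcons_uniq => /andP[nin' _]; split=> //.
  by rewrite (negPf neq) -cats1 index_cat (negPf nin') /= eqxx addn0 Es.
elim: V lt => [_ _|b V IH ltb]; first by exists [::].
rewrite rcons_cons /= => -[[bW lt _ _ ok] bV].
have [|l [E Es]] := IH _ bV; first by move=> c cV; apply: ltb; rewrite inE cV orbT.
case: ok => [|ok]; first by rewrite E.
have lt0 : b.2 < b0.2 by apply: ltb; rewrite mem_head.
move: ok; rewrite E /= lt0 => /andP[_ ok].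
suff [l' [-> Es']] : exists l',
    insert_pair b.1 b.2 (rcons l b0.1) = rcons l' b0.1 /\ size l' = (size l).+2.
  by exists l'; rewrite Es' Es.
elim: l {E Es} ok => [|x l IHl] /=.
  case: ifP => [_|_ _]; first by rewrite andbF.
  by exists [:: b.2; b.1].
case: ifP => [_ /andP[_ /IHl[l' [-> <-]]]|_ _]; first by exists (x :: l').
by exists [:: b.2, b.1, x & l].
Qed.

End Build.

(** * Greedy linear extensions and normal words *)

Lemma greedy_linear_extension (T : finType) (V : {set T}) (e : rel T) (r f : T -> nat) :
  (forall C B, e C B -> r C < r B) -> (forall C B, e C B -> C \in V) ->
  exists w : seq T, [/\ uniq w, w =i V,
    (forall C B, B \in w -> e C B -> index C w < index B w) &
    (forall B C, B \in V -> C \in w -> (forall D, e D B -> index D w < index C w) ->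
       index C w < index B w -> f C <= f B)].
Proof.
move=> mono eV; suff: forall i, i <= #|V| ->
    exists w : seq T, [/\ uniq w, size w = i, {subset w <= V},
    (forall C B, B \in w -> e C B -> index C w < index B w) &
    (forall B C, B \in V -> C \in w -> (forall D, e D B -> index D w < index C w) ->
       index C w < index B w -> f C <= f B)].
  move=> /(_ _ (leqnn _))[w [uw sw subw closed greedy]]; exists w; split=> //.
  have subw' : {subset w <= enum V} by move=> x /subw; rewrite mem_enum.
  have [|_ eqw] := uniq_min_size uw subw'; first by rewrite -cardE sw.
  by move=> x; rewrite eqw mem_enum.
elim=> [_|i IH lti]; first by exists [::]; split.
have [w [uw sw subw closed greedy]] := IH (ltnW lti).
pose P := [pred B | [&& B \in V, B \notin w & [forall D, e D B ==> (D \in w)]]].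
have [B1 PB1] : exists B1, P B1.
  (* An unplaced vertex of least rank [r] has all its predecessors placed, so some vertex is
     available; among the available ones [f] then decides. *)
  pose Q := [pred B in V | B \notin w].
  have [B2 QB2] : exists B2, Q B2.
    apply/existsP; apply: contraTT lti => /existsPn none; rewrite -leqNgt -sw cardE.
    apply: uniq_leq_size (enum_uniq _) _ => x; rewrite mem_enum => xV.
    by have := none x; rewrite /Q /= xV negbK.
  case: (arg_minnP r QB2) => B /andP[BV Bw] min; exists B.
  apply/and3P; split=> //; apply/forallP => D; apply/implyP => eDB.
  apply/negPn/negP => Dw; have := min D; rewrite /Q /= (eV _ _ eDB) Dw => /(_ isT).
  by rewrite leqNgt mono.
case: (arg_minnP f PB1) => B0 /and3P[B0V B0w /forallP pred0] min0.
have idx_old x : x \in w -> index x (rcons w B0) = index x w.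
  by move=> xw; rewrite -cats1 index_cat xw.
have idx_new x : x \notin w -> index x (rcons w B0) = size w + (B0 != x).
  by move=> xw; rewrite -cats1 index_cat (negPf xw) /=; case: eqP.
have in_old x : index x (rcons w B0) < size w -> x \in w.
  by apply: contraLR => xw; rewrite idx_new // -leqNgt leq_addr.
exists (rcons w B0); split.
- by rewrite rcons_uniq B0w.
- by rewrite size_rcons sw.
- by move=> x; rewrite mem_rcons inE => /predU1P[->|/subw].
- move=> C B; rewrite mem_rcons inE => /predU1P[->|Bw] eCB.
    have Cw : C \in w by have := pred0 C; rewrite eCB.
    by rewrite idx_old // idx_new // eqxx addn0 index_mem.
  have lt := closed _ _ Bw eCB.
  by rewrite !idx_old // -index_mem (ltn_trans lt) // index_mem.
- move=> B C BV; rewrite mem_rcons inE => /predU1P[->|Cw] preds.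
    rewrite idx_new // eqxx addn0 in preds *.
    case: (boolP (B \in w)) => [Bw|Bw _]; first by rewrite idx_old // ltnNge index_size.
    apply: min0; rewrite /P /= BV Bw; apply/forallP => D; apply/implyP => /preds.
    exact: in_old.
  rewrite idx_old // in preds *.
  have lts : index C w < size w by rewrite index_mem.
  move=> lt; apply: greedy => // [D eDB|].
    have lt' := preds D eDB; rewrite -idx_old //; apply: in_old; exact: ltn_trans lts.
  case: (boolP (B \in w)) => [Bw|]; first by rewrite -(idx_old B).
  by rewrite -index_mem -leqNgt; apply: leq_trans.
Qed.

Definition block_min n (B : {set 'I_n}) : nat := \big[minn/n]_(i in B) i.

Lemma block_min_pair n (x y : 'I_n) : x < y -> block_min [set x; y] = x.
Proof.
move=> lt; apply: (@bigmin_eq n [set x; y]); first by rewrite set21.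
by move=> i; rewrite !inE => /predU1P[->|/eqP->] //; apply: ltnW.
Qed.

Lemma pair_block n (B : {set 'I_n}) : #|B| = 2 ->
  exists s t : 'I_n, [/\ B = [set s; t], s < t, block_min B = s & block_max B = t].
Proof.
move=> /eqP/cards2P[x [y [neq ->]]].
have := ord_neq neq; case: (ltngtP x y) => // lt _; last rewrite setUC.
  by exists x, y; rewrite block_min_pair ?block_max_pair.
by exists y, x; rewrite block_min_pair ?block_max_pair.
Qed.

Lemma crossing_pair n (B C : {set 'I_n}) : #|B| = 2 -> #|C| = 2 -> crossing B C ->
  block_min B < block_min C < block_max B /\ block_max B < block_max C \/
  block_min C < block_min B < block_max C /\ block_max C < block_max B.
Proof.
move=> /pair_block[s [t [-> lt -> ->]]] /pair_block[s' [t' [-> lt' -> ->]]].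
case/exists_inP => i; rewrite !inE => iB /exists_inP[k]; rewrite !inE => kB.
move=> /exists_inP[j]; rewrite !inE => jC /exists_inP[l]; rewrite !inE => lC.
by case/orP: iB => /eqP->; case/orP: kB => /eqP->; case/orP: jC => /eqP->; case/orP: lC => /eqP->; lia.
Qed.

Section Matching.
Variables (n : nat) (rho : {set {set 'I_n}}).
Hypotheses (part : partition rho [set: 'I_n]) (all2 : forall B, B \in rho -> #|B| = 2).

Lemma matching_eq B C v : B \in rho -> C \in rho -> v \in B -> v \in C -> B = C.
Proof.
move=> Bin Cin vB vC; apply/eqP/negPn/negP => neq.
have /and3P[_ /trivIsetP triv _] := part.
by have /pred0P/(_ v) := triv _ _ Bin Cin neq; rewrite /= vB vC.
Qed.

Lemma matching_cover v : exists2 B, B \in rho & v \in B.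
Proof.
have /and3P[/eqP cov _ _] := part.
by have := in_setT v; rewrite -cov => /bigcupP[B]; exists B.
Qed.

Lemma matching_max_inj : {in rho &, injective (@block_max n)}.
Proof.
move=> B C Bin Cin; have [s [t [EB lt _ ->]]] := pair_block (all2 Bin).
have [s' [t' [EC lt' _ ->]]] := pair_block (all2 Cin) => /val_inj E.
by apply: (matching_eq (v := t)) => //; rewrite ?EB ?EC ?E !inE eqxx orbT.
Qed.

Lemma matching_min_inj : {in rho &, injective (@block_min n)}.
Proof.
move=> B C Bin Cin; have [s [t [EB lt -> _]]] := pair_block (all2 Bin).
have [s' [t' [EC lt' -> _]]] := pair_block (all2 Cin) => /val_inj E.
by apply: (matching_eq (v := s)) => //; rewrite ?EB ?EC ?E !inE eqxx.
Qed.

Lemma matching_min_max B C : B \in rho -> C \in rho -> block_min B <> block_max C.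
Proof.
move=> Bin Cin; have [s [t [EB lt Es _]]] := pair_block (all2 Bin).
have [s' [t' [EC lt' Es' Et']]] := pair_block (all2 Cin); rewrite Es Et' => /val_inj E.
have EBC : B = C by apply: (matching_eq (v := s)) => //; rewrite ?EB ?EC ?E !inE eqxx ?orbT.
by move: Es; rewrite EBC Es' => E'; move: lt'; rewrite -E E'; lia.
Qed.

Lemma matching_min_lt_max B : B \in rho -> block_min B < block_max B.
Proof. by move=> /all2/pair_block[s [t [_ lt -> ->]]]. Qed.

Section Word.
Variables (top : {set 'I_n}) (w : seq {set 'I_n}).
Hypotheses (uw : uniq w) (wE : w =i rho) (normal : normal_rank rho top (index^~ w)).

Definition block_pair (B : {set 'I_n}) := (block_min B, block_max B).
Let W := map block_pair w.
Let prefix i := rev (map block_pair (take i w)).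

Lemma prefixS B : B \in rho -> prefix (index B w).+1 = block_pair B :: prefix (index B w).
Proof.
rewrite -wE => Bin; rewrite /prefix (take_nth B) ?index_mem // nth_index //.
by rewrite map_rcons rev_rcons.
Qed.

Lemma mem_prefix i v : v \in build (prefix i) ->
  exists B, [/\ B \in rho, index B w < i & v = block_min B \/ v = block_max B].
Proof.
rewrite mem_build => /hasP[b]; rewrite mem_rev => /mapP[B Bin ->] /= H.
exists B; split; [by rewrite -wE (mem_take Bin)|exact: index_ltn|].
by case/orP: H => /eqP; [left|right].
Qed.

Lemma block_pair_mem B : B \in rho -> block_pair B \in W.
Proof. by rewrite -wE => Bin; apply: map_f. Qed.

Lemma word_starts_uniq : uniq [seq b.1 | b <- W].
Proof.
rewrite -map_comp map_inj_in_uniq // => B C; rewrite !wE; exact: matching_min_inj.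
Qed.

Lemma word_is_startP v : is_start W v -> exists2 B, B \in rho & v = block_min B.
Proof.
by move=> /mapP[_ /mapP[B Bin ->] ->]; exists B => //; rewrite -wE.
Qed.

Lemma word_max_not_start B : B \in rho -> ~~ is_start W (block_max B).
Proof.
by move=> Bin; apply/negP => /word_is_startP[C Cin] /esym; apply: matching_min_max.
Qed.

(** Normality is exactly what insertion requires. The witness [B'] crosses [B], so its insertion
    creates a place for [B] (inside or straddling, according to the two kinds of crossing); each
    block between [B'] and [B] has a smaller maximum and keeps or recreates one (below or
    inside). *)
Lemma word_buildable i : i <= size w -> buildable W (prefix i).
Proof.
elim/ltn_ind: i => -[|i] IH lti; first by rewrite /prefix take0.
have Bw : nth top w i \in w by rewrite mem_nth.
set B := nth top w i in Bw; have Ei : i = index B w by rewrite index_uniq.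
have Bin : B \in rho by rewrite -wE.
rewrite Ei prefixS // -Ei.
have fresh v C : C \in rho -> v \in build (prefix i) -> v = block_min B \/ v = block_max B -> False.
  move=> _ /mem_prefix[D [Din ltD Ev]] Ev'.
  have EDB : D = B.
    case: Ev Ev' => -> []; [exact: matching_min_inj| by move/matching_min_max => []
      | by move/esym/matching_min_max => [] | exact: matching_max_inj].
  by rewrite EDB -Ei ltnn in ltD.
split; last by apply: IH => //; exact: ltnW.
split; [exact: block_pair_mem|exact: matching_min_lt_max| | |].
- by apply/negP => /fresh; apply; [exact: Bin | left].
- by apply/negP => /fresh; apply; [exact: Bin | right].
case: (posnP i) => [->|i0]; first by left; rewrite /prefix take0.
have Btop : B != top.
  apply: contraTneq i0 => EB; have w0 : 0 < size w by lia.
  have := normal_rank_top normal (B := nth top w 0).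
  rewrite -wE mem_nth // => /(_ isT); rewrite -EB -Ei index_uniq //.
  by rewrite leqn0 => /eqP->.
right; have [B' [cr lt between]] := normal Bin Btop.
rewrite -Ei in lt between; case/and4P: cr => B'in _ _ cr.
have ok_prefix C : C \in rho -> index C w < i ->
    build (prefix (index C w)) = [::] \/
    insertable W (block_min C) (block_max C) (build (prefix (index C w))).
  move=> Cin ltC; have := IH (index C w).+1; rewrite prefixS // => bd.
  by case: bd => [||[]] //; apply: leq_trans ltC _; apply: ltnW.
have Bmin := matching_min_lt_max Bin.
have notin j : j <= i -> block_max B \notin build (prefix j).
  move=> lej; apply/negP => /mem_prefix[D [Din ltD Ev]].
  have EDB : D = B by case: Ev => [/esym/matching_min_max []//|/matching_max_inj->].
  by rewrite EDB -Ei ltnNge lej in ltD.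
suff ins d : index B' w + d < i ->
    insertable W (block_min B) (block_max B) (build (prefix (index B' w + d).+1)).
  have Ed : i = (index B' w + (i - (index B' w).+1)).+1 by clear -lt; lia.
  by rewrite {1}Ed; apply: ins; clear -lt; lia.
elim: d => [|d IHd] ltd.
  rewrite addn0 prefixS //=.
  case: (crossing_pair (all2 B'in) (all2 Bin) cr) => -[btw ltm].
    case/andP: btw => _ gtm; apply: insertable_insert_inside; last exact: ok_prefix.
      by rewrite gtm ltm.
    exact/notin/ltnW.
  case/andP: btw => ltm1 ltm2; apply: insertable_insert_straddle => //.
    exact: word_max_not_start.
  exact: ok_prefix.
set j := index B' w + d.+1 in ltd *; have ltj : j < size w by apply: ltn_trans lti.
set C := nth top w j; have Cw : C \in w by apply: mem_nth.
have Cin : C \in rho by rewrite -wE.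
have Ej : j = index C w by rewrite index_uniq.
have ltC : block_max C < block_max B by apply: between => //; rewrite -Ej ltd andbT /j addnS ltnS leq_addr.
have IHd' : insertable W (block_min B) (block_max B) (build (prefix j)).
  by rewrite /j addnS; apply: IHd; rewrite /j addnS in ltd; exact: ltnW.
rewrite Ej prefixS //= -Ej.
case: (ltngtP (block_min B) (block_max C)) => [lt'|lt'|].
- apply: insertable_insert_inside; [by rewrite lt'|exact/notin/ltnW|].
  by rewrite Ej; apply: ok_prefix => //; rewrite -Ej.
- exact: insertable_insert_below.
- by move/matching_min_max => [].
Qed.

End Word.
End Matching.

Lemma matching_card n (U : {set 'I_n}) (rho : {set {set 'I_n}}) :
  partition rho U -> (forall B, B \in rho -> #|B| = 2) -> (#|rho| * 2)%N = #|U|.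
Proof.
move=> part all2; have := card_partition part.
by rewrite (eq_bigr (fun=> 2)) ?sum_nat_const.
Qed.

Lemma matching_normal_word n (rho : {set {set 'I_n}}) (a : arcs n) (top : {set 'I_n}) :
  partition rho [set: 'I_n] -> (forall B, B \in rho -> #|B| = 2) ->
  orientation rho a -> acyclic a ->
  (forall B, B \in rho -> B != top -> exists C, (C, B) \in a) ->
  exists w : seq {set 'I_n}, [/\ uniq w, w =i rho, normal_rank rho top (index^~ w) &
    forall B C, (B, C) \in a -> index B w < index C w].
Proof.
move=> part all2 /forallP orient /acyclicP[r mono] pred.
have arc_cr B C : (B, C) \in a -> crossing_graph rho B C.
  by move=> BC; have /forallP/(_ C) := orient B; case: ifP => //; rewrite BC.
have arc_in B C : (B, C) \in a -> B \in rho by case/arc_cr/and4P.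
have [w [uw wE closed greedy]] :=
  greedy_linear_extension (@block_max n) mono arc_in.
exists w; split=> // [B Bin Btop|B C BC]; last first.
  by apply: closed => //; rewrite wE; case/arc_cr/and4P: BC.
have [B0 B0B] := pred B Bin Btop.
(* The witness is the last predecessor of [B]: from then on [B] is available, so whatever the greedy
   choice prefers to it has a smaller maximum. *)
case: (@arg_maxnP _ B0 (fun C => (C, B) \in a) (index^~ w) B0B) => B' BB' max.
have Bw : B \in w by rewrite wE.
exists B'; split; [exact: arc_cr|exact: closed|].
move=> C Cin /andP[lt lt']; rewrite ltn_neqAle; apply/andP; split.
  apply: contraTneq lt' => /(matching_max_inj part all2)-> //; by rewrite ltnn.
apply: greedy => // [|D DB]; first by rewrite wE.
exact: leq_ltn_trans (max D DB) lt.
Qed.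

(** * The configuration spelled by a normal word *)

Section Construction.
Variables (k : nat) (rho : {set {set 'I_(2 * k).+2}}) (top : {set 'I_(2 * k).+2}).
Variable w : seq {set 'I_(2 * k).+2}.
Hypotheses (part : partition rho [set: 'I_(2 * k).+2]).
Hypotheses (all2 : forall B, B \in rho -> #|B| = 2).
Hypotheses (top_in : top \in rho) (max_in_top : ord_max \in top).
Hypotheses (uw : uniq w) (wE : w =i rho) (normal : normal_rank rho top (index^~ w)).

Local Notation m := (2 * k).+1.
Let W := map (@block_pair _) w.
Let V := rev W.
Let l := build V.

Let buildable_V : buildable W V.
Proof. by have := word_buildable part all2 uw wE normal (leqnn _); rewrite take_size. Qed.

Let W_uniq : uniq [seq b.1 | b <- W] := word_starts_uniq part all2 uw wE.

Let W_targets (b : nat * nat) : b \in W -> ~~ is_start W b.2.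
Proof. by move=> /mapP[B Bw ->]; apply: (word_max_not_start part all2 wE); rewrite -wE. Qed.

Let card_rho : (#|rho| * 2)%N = m.+1.
Proof. by have := matching_card part all2; rewrite cardsT card_ord. Qed.

Lemma size_word : size w = k.+1.
Proof.
have /card_uniqP <- := uw; rewrite (eq_card wE).
by apply/eqP; rewrite -(eqn_pmul2r (isT : 0 < 2)) card_rho; apply/eqP; lia.
Qed.

Lemma block_pair_in_V B : B \in rho -> block_pair B \in V.
Proof. by move=> Bin; rewrite mem_rev map_f // wE. Qed.

Lemma block_values B v : B \in rho -> v \in B -> (v : nat) = block_min B \/ (v : nat) = block_max B.
Proof.
move=> /all2/pair_block[s [t [-> _ -> ->]]]; rewrite !inE.
by case/orP => /eqP->; [left|right].
Qed.

Lemma block_min_in B : B \in rho -> exists2 v, v \in B & (v : nat) = block_min B.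
Proof. by move=> /all2/pair_block[s [t [-> _ -> _]]]; exists s; rewrite ?set21. Qed.

Lemma block_max_in B : B \in rho -> exists2 v, v \in B & (v : nat) = block_max B.
Proof. by move=> /all2/pair_block[s [t [-> _ _ ->]]]; exists t; rewrite ?set22. Qed.

Lemma mem_word_list v : (v \in l) = (v < m.+1).
Proof.
apply/idP/idP => [|lt].
  rewrite mem_build => /hasP[b]; rewrite mem_rev => /mapP[B]; rewrite wE => Bin -> /=.
  have [s _ <-] := block_min_in Bin; have [t _ <-] := block_max_in Bin.
  by case/orP => /eqP->.
have [B Bin vB] := matching_cover part (Ordinal lt).
rewrite mem_build; apply/hasP; exists (block_pair B); first exact: block_pair_in_V.
by have /= := block_values Bin vB; case=> ->; rewrite eqxx ?orbT.
Qed.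

Lemma block_min_lt B : B \in rho -> block_min B < m.+1.
Proof. by move=> /block_min_in[v _ <-]. Qed.

Lemma block_max_lt B : B \in rho -> block_max B < m.+1.
Proof. by move=> /block_max_in[v _ <-]. Qed.

Lemma word_index_inj u v : u < m.+1 -> v < m.+1 -> index u l = index v l -> u = v.
Proof.
by rewrite -!mem_word_list => ul vl E; rewrite -(nth_index 0 ul) E nth_index.
Qed.

Lemma word_list_uniq : uniq l.
Proof. exact: build_uniq buildable_V. Qed.

Lemma size_word_list : size l = m.+1.
Proof.
rewrite -(size_iota 0 m.+1); apply/perm_size/uniq_perm; rewrite ?word_list_uniq ?iota_uniq //.
by move=> v; rewrite mem_word_list mem_iota.
Qed.

Lemma block_max_top : block_max top = m.
Proof.
case: (block_values top_in max_in_top) => /= E; last exact/esym.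
have := matching_min_lt_max all2 top_in; have [u _ <-] := block_max_in top_in.
by rewrite -E ltnNge -ltnS ltn_ord.
Qed.

Lemma word_list_top : index (block_max top) l = 0 /\ index (block_min top) l = m.
Proof.
have w0 : nth top w 0 = top.
  have lt0 : 0 < size w by rewrite size_word.
  have N0 : nth top w 0 \in rho by rewrite -wE mem_nth.
  have := normal_rank_top normal N0; rewrite index_uniq // leqn0 => /eqP Et.
  by have := @nth_index _ top top w; rewrite wE top_in Et => /(_ isT).
have Ew : w = top :: behead w by move: w0 size_word; case: (w) => //= B w' ->.
have EV : V = rcons (rev (map (@block_pair _) (behead w))) (block_pair top).
  by rewrite /V /W {1}Ew /= rev_cons.
have lt b : b \in rev (map (@block_pair _) (behead w)) -> b.2 < (block_pair top).2.
  rewrite mem_rev => /mapP[B Bw ->] /=.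
  have Bin : B \in rho by rewrite -wE Ew inE Bw orbT.
  have neq : B != top.
    by apply: contraTneq Bw => ->; move: uw; rewrite Ew => /andP[].
  rewrite block_max_top; have [v _ Ev] := block_max_in Bin.
  have : block_max B <> block_max top.
    by move=> /(matching_max_inj part all2 Bin top_in) E; rewrite E eqxx in neq.
  by rewrite block_max_top -Ev; have := ltn_ord v; clear; lia.
have := @build_first W; rewrite /l EV => /(_ _ _ _ lt).
rewrite -EV => /(_ buildable_V)[-> ->]; split=> //.
by rewrite size_rev size_map size_behead size_word /=; lia.
Qed.

(** The list runs from right to left and its entry 0 is the top value, which the permutation omits;
    so position [i] reads entry [m - i], from [m] down to 1. *)
Lemma nth_word_list_lt (i : 'I_m) : nth 0 l (m - i) < m.
Proof.
have lt : m - i < size l by rewrite size_word_list; lia.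
have : nth 0 l (m - i) < m.+1 by rewrite -mem_word_list mem_nth.
have [E0 _] := word_list_top; rewrite block_max_top in E0.
have : nth 0 l (m - i) <> m.
  move=> E; have := index_uniq 0 lt word_list_uniq; rewrite E E0.
  by have := ltn_ord i; lia.
lia.
Qed.

Definition word_fun (i : 'I_m) : 'I_m := Ordinal (nth_word_list_lt i).

Lemma word_fun_inj : injective word_fun.
Proof.
move=> i j /(congr1 val) /= /eqP; rewrite nth_uniq ?word_list_uniq ?size_word_list; try lia.
by move=> /eqP E; apply/val_inj => /=; have := ltn_ord i; have := ltn_ord j; lia.
Qed.

Definition word_perm : 'S_m := perm word_fun_inj.
Local Notation p := word_perm.

Lemma word_permE i : p i = nth 0 l (m - i) :> nat.
Proof. by rewrite permE. Qed.

Lemma index_word_perm i : index (p i : nat) l = m - i.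
Proof. by rewrite word_permE index_uniq ?word_list_uniq // size_word_list; lia. Qed.

Lemma word_perm_at (i : 'I_m) v : v < m.+1 -> index v l = m - i -> p i = v :> nat.
Proof. by rewrite -mem_word_list => vl E; rewrite word_permE -E nth_index. Qed.

Lemma word_perm_adjacent (i j : 'I_m) : j = i.+1 :> nat -> adjacent W (p j) (p i).
Proof.
move=> E; have := build_sorted W_uniq W_targets buildable_V; rewrite -/l => /(sortedP 0)/(_ (m - j)).
rewrite size_word_list !word_permE; have -> : m - i = (m - j).+1 by have := ltn_ord j; lia.
by apply; lia.
Qed.

Lemma descent_start (i : 'I_m) : i \in descents p ->
  exists B, [/\ B \in rho, B != top, index (block_min B) l = m - i.+1, i.+1 < m &
    block_min B < p i < block_max B /\ index (block_max B) l < m - i.+1].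
Proof.
rewrite inE => /existsP[j /andP[/eqP Ej lt]].
have := word_perm_adjacent Ej; rewrite /adjacent; case: ifP => [st|_]; last by lia.
have [B Bin EB] := word_is_startP wE st.
have idx : index (block_min B) l = m - i.+1 by rewrite -EB index_word_perm Ej.
have ltj := ltn_ord j; rewrite Ej in ltj.
rewrite EB (partnerE W_uniq (b := block_pair B)) ?map_f ?wE // => btw.
exists B; split=> //.
  apply/eqP => ET; move: idx; rewrite ET; have [_ ->] := word_list_top; lia.
split=> //; have := build_target_before_start buildable_V (block_pair_in_V Bin).
by rewrite -/l /= idx.
Qed.

Lemma start_descent B : B \in rho -> B != top -> exists2 i : 'I_m, i \in descents p &
  index (block_min B) l = m - i.+1.
Proof.
move=> Bin Btop; have [t1 t2] := word_list_top.
have vl : block_min B \in l by rewrite mem_word_list block_min_lt.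
have lt : index (block_min B) l < m.+1.
  by have := index_mem (block_min B) l; rewrite vl size_word_list.
have neq1 : index (block_min B) l <> 0.
  move=> E; apply: (matching_min_max part all2 Bin top_in).
  by apply: word_index_inj; rewrite ?block_min_lt ?block_max_lt // E t1.
have neq2 : index (block_min B) l <> m.
  move=> E; case/eqP: Btop; apply: (matching_min_inj part all2 Bin top_in).
  by apply: word_index_inj; rewrite ?block_min_lt // E t2.
have lti : m - (index (block_min B) l).+1 < m by clear -lt; lia.
have ltj : m - index (block_min B) l < m by clear -neq1; lia.
have Eji : Ordinal ltj = (Ordinal lti).+1 :> nat by rewrite /=; clear -neq2 lt; lia.
exists (Ordinal lti); last by rewrite /=; clear -neq2 lt; lia.
rewrite inE; apply/existsP; exists (Ordinal ltj); rewrite Eji eqxx /=.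
have Ep : p (Ordinal ltj) = block_min B :> nat.
  by apply: word_perm_at; [exact: block_min_lt | rewrite /=; clear -lt; lia].
have := word_perm_adjacent Eji; rewrite /adjacent Ep.
rewrite [is_start _ _](is_start_pair (b := block_pair B)) ?map_f ?wE //.
by case/andP.
Qed.

(** The value after the descent [d] is the minimum of a block, and the hook ends at the position of
    the maximum. This block is not [top], so that position is in range and [inord] is faithful. *)
Definition word_hook (d : 'I_m) : hook m :=
  (d, inord (m - index (partner W (nth 0 l (m - d.+1))) l)).

Definition word_hooks : seq (hook m) := map word_hook (enum (descents p)).

Lemma word_hooksP (h : hook m) : h \in word_hooks ->
  exists B, [/\ B \in rho, B != top, index (block_min B) l = m - h.1.+1 /\
    index (block_max B) l = m - h.2, p h.2 = block_max B :> nat &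
    block_min B < p h.1 < block_max B /\ h.1.+1 < h.2].
Proof.
move=> /mapP[d]; rewrite mem_enum => /descent_start[B [Bin Btop idx ltd [btw lt]]] ->.
exists B; rewrite /=.
have Es : nth 0 l (m - d.+1) = block_min B.
  by rewrite -idx nth_index // mem_word_list block_min_lt.
rewrite Es (partnerE W_uniq (b := block_pair B)) ?map_f ?wE //=.
have pos : 0 < index (block_max B) l.
  have [t1 _] := word_list_top; rewrite lt0n; apply/eqP => E.
  case/eqP: Btop; apply: (matching_max_inj part all2 Bin top_in).
  by apply: word_index_inj; rewrite ?block_max_lt // E t1.
have Ei : (inord (m - index (block_max B) l) : 'I_m) = m - index (block_max B) l :> nat.
  by rewrite inordK; lia.
split=> //; first by rewrite Ei; split=> //; lia.
  by apply: word_perm_at; [exact: block_max_lt | rewrite Ei; lia].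
by split=> //; rewrite Ei; lia.
Qed.

Lemma word_hooks_valid : valid_hook_configuration p word_hooks.
Proof.
have inner (h h' : hook m) : h \in word_hooks -> h' \in word_hooks -> h.1 < h'.1 ->
    hooks_compatible p h h'.
  move=> /word_hooksP[B [Bin _ [i1 i2] pB [btw lt]]] /word_hooksP[C [Cin _ [j1 j2] pC [btw' lt']]] lth.
  have neqBC : B <> C.
    by move=> EBC; move: i1 lt'; rewrite EBC j1; have := ltn_ord h'.2; lia.
  have ltB := ltn_ord h.2; have ltC := ltn_ord h'.2.
  apply: hooks_compatible_lt => // [|lt''].
    by rewrite pB pC; apply/eqP => /(matching_max_inj part all2 Bin Cin).
  have neq : h'.1.+1 <> h.2.
    move=> E; apply: (matching_min_max part all2 Cin Bin).
    by apply: word_index_inj; rewrite ?block_min_lt ?block_max_lt // j1 E i2.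
  have := build_nested buildable_V (block_pair_in_V Bin) (block_pair_in_V Cin).
  rewrite -/l /= i1 i2 j1 j2 => nested.
  have {}nested : m - h.2 < m - h'.2 by apply: nested; lia.
  rewrite pB; apply: (build_below_target (x := p h'.2) buildable_V (block_pair_in_V Bin)).
  rewrite -/l /= index_word_perm i1 i2; lia.
split.
- by move=> h /word_hooksP[B [Bin _ _ pB [btw lt]]]; rewrite /is_hook pB; lia.
- by rewrite /word_hooks -map_comp map_id_in.
- move=> [d e] /word_hooksP[B [Bin _ /= [i1 i2] pB [btw lt]]] j /= ltj; rewrite pB.
  have ltB := ltn_ord e.
  have [E|neq] := eqVneq (j : nat) d.+1.
    have -> : p j = block_min B :> nat.
      by apply: word_perm_at; [exact: block_min_lt | rewrite i1 E].
    exact: (matching_min_lt_max all2 Bin).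
  apply: (build_below_target (x := p j) buildable_V (block_pair_in_V Bin)).
  by rewrite -/l /= index_word_perm i1 i2; move: ltj neq lt ltB; clear; lia.
- move=> h h' hin h'in neq.
  have neq1 : h.1 <> h'.1 :> nat.
    move=> /val_inj E; case/eqP: neq; move/mapP: hin => [d _ Eh]; move/mapP: h'in => [d' _ Eh'].
    by move: E; rewrite Eh Eh' /= => ->.
  have [lt|lt] : h.1 < h'.1 \/ h'.1 < h.1 by lia.
    exact: inner.
  exact/hooks_compatibleC/inner.
Qed.

Lemma size_word_hooks : size word_hooks = k.
Proof.
rewrite size_map -cardE.
pose g (B : {set 'I_m.+1}) : 'I_m := inord (m - (index (block_min B) l).+1).
have gE (i : 'I_m) B : index (block_min B) l = m - i.+1 -> g B = i.
  by move=> E; apply/val_inj; rewrite /= inordK; have := ltn_ord i; lia.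
have -> : descents p = g @: (rho :\ top).
  apply/setP => i; apply/idP/imsetP => [/descent_start[B [Bin Btop idx _ _]]|[B]].
    by exists B; rewrite ?in_setD1 ?Btop // (gE i).
  rewrite in_setD1 => /andP[Btop Bin] ->; have [j jd idx] := start_descent Bin Btop.
  by rewrite (gE j).
rewrite card_in_imset.
  have := card_rho; rewrite (cardsD1 top) top_in.
  by move: #|_| => c; clear; lia.
move=> B C; rewrite !inE => /andP[Btop Bin] /andP[Ctop Cin].
have [i _ iB] := start_descent Bin Btop; have [j _ jC] := start_descent Cin Ctop.
rewrite (gE i) // (gE j) // => Eij; apply: (matching_min_inj part all2 Bin Cin).
by apply: word_index_inj; rewrite ?block_min_lt // iB Eij jC.
Qed.

Lemma lift_word_perm (i : 'I_m) (v : 'I_m.+1) : p i = v :> nat -> lift ord_max (p i) = v.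
Proof. by move=> E; apply/val_inj; rewrite -[RHS]E; apply: lift_ord_max_val. Qed.

Lemma word_color_classes : color_classes p word_hooks = rho.
Proof.
have valid := word_hooks_valid.
(* Both partitions have [k+1] blocks, so one inclusion is enough. *)
apply/eqP; rewrite eqEcard card_color_classes // ?size_word_hooks //.
have := card_rho => Ecard; apply/andP; split; last by lia.
apply/subsetP; apply: (color_classes_elim valid) => [|h hH].
  rewrite (blue_class_pair valid size_word_hooks).
  have [s [t [Et lts Es Em]]] := pair_block (all2 top_in).
  suff -> : [set lift ord_max (p ord0); ord_max] = top by [].
  rewrite Et; congr [set _; _].
    apply: lift_word_perm; apply: word_perm_at => //.
    by rewrite -Es; have [_ ->] := word_list_top; rewrite subn0.
  by apply/val_inj; have := block_max_top; rewrite Em => /esym.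
have [B [Bin Btop [i1 i2] pB [btw lt]]] := word_hooksP hH.
rewrite (hook_class_pair valid size_word_hooks hH).
have [s [t [Et lts Es Em]]] := pair_block (all2 Bin).
suff -> : [set lift ord_max (p (hook_start h)); lift ord_max (p h.2)] = B by [].
rewrite Et; congr [set _; _]; apply: lift_word_perm.
  by apply: word_perm_at => //; rewrite -Es (hook_startE valid).
by rewrite pB.
Qed.

Lemma word_min_hat B : B \in rho -> min_hat p B = m - index (block_min B) l.
Proof.
have valid := word_hooks_valid; rewrite -word_color_classes; move: B.
apply: (color_classes_elim valid) => [|h hH].
  rewrite (min_hat_blue valid) // (blue_class_pair valid size_word_hooks) block_min_pair; last first.
    by rewrite lift_ord_max_val /=.
  by rewrite lift_ord_max_val index_word_perm subn0 subnn.
rewrite (min_hat_hook valid) // (hook_class_pair valid size_word_hooks) // block_min_pair; last first.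
  by rewrite !lift_ord_max_val; case: (hook_start_lt_target valid hH).
by rewrite lift_ord_max_val index_word_perm; have := ltn_ord (hook_start h); lia.
Qed.

Lemma word_min_hat_lt B C : B \in rho -> C \in rho -> index B w < index C w ->
  min_hat p B < min_hat p C.
Proof.
move=> Bin Cin lt; rewrite !word_min_hat //.
have ltB : index (block_min B) l < m.+1.
  by have := index_mem (block_min B) l; rewrite mem_word_list block_min_lt // size_word_list.
suff : index (block_min C) l < index (block_min B) l by lia.
have Bw : B \in w by rewrite wE.
have Cw : C \in w by rewrite wE.
have uV : uniq V by rewrite rev_uniq; apply: map_uniq W_uniq.
have idx D : D \in w -> index (block_pair D) V = (size w - (index D w).+1).
  move=> Dw; have ltD : index D w < size w by rewrite index_mem.
  have ED : block_pair D = nth (0, 0) V (size w - (index D w).+1).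
    rewrite nth_rev ?size_map; last by move: ltD; clear; lia.
    have -> : size w - (size w - (index D w).+1).+1 = index D w by move: ltD; clear; lia.
    by rewrite (nth_map D) // nth_index.
  by rewrite {1}ED index_uniq // size_rev size_map; move: ltD; clear; lia.
apply: (build_start_order buildable_V (b := block_pair C) (c := block_pair B)).
  exact: block_pair_in_V.
have ltC : index C w < size w by rewrite index_mem.
by rewrite !idx //; apply: ltn_sub2l; [apply: leq_ltn_trans ltC|].
Qed.

End Construction.

Lemma Phi_VHCh_sub k H : H \in VHCh k (2 * k).+1 -> Phi H \in Mtilde (2 * k).+2.
Proof.
rewrite !inE => /andP[V sz]; apply/andP; split; last first.
  apply/forall_inP => B; rewrite /Phi /= => Bin; apply/eqP.
  by apply: (card_color_class _ _ Bin); [exact/asboolP | exact/eqP].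
by have := @Phi_in_Ptilde _ H (ltn0Sn _); rewrite !inE; apply.
Qed.

Lemma Phi_surj k x : x \in Mtilde (2 * k).+2 -> exists2 H, H \in VHCh k (2 * k).+1 & x = Phi H.
Proof.
case: x => rho a; rewrite !inE /= => /andP[/and5P[part _ orient ac /eqP src] /forall_inP all2'].
have all2 B : B \in rho -> #|B| = 2 by move=> /all2'/eqP.
have [top top_in max_in] := matching_cover part ord_max.
have topE B : B \in rho -> B != top -> exists C, (C, B) \in a.
  move=> Bin; apply: contraNP => none; apply/eqP.
  have : B \in sources rho a.
    by rewrite inE Bin; apply/forallP => C; apply/negP => CB; apply: none; exists C.
  rewrite src inE => /andP[_ /exists_inP[i iB /eqP[Ei]]].
  by apply: (matching_eq part Bin top_in (v := i)) => //; have -> : i = ord_max by apply/val_inj.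
have [w [uw wE normal mono]] := matching_normal_word part all2 orient ac topE.
pose p := word_perm part all2 top_in max_in uw wE normal.
have sz : size (word_hooks part all2 top_in max_in uw wE normal) == #|descents p|.
  by rewrite size_map -cardE.
have valid := word_hooks_valid part all2 top_in max_in uw wE normal.
have Ecc := word_color_classes part all2 top_in max_in uw wE normal.
exists (Tagged (fun p : 'S_(2 * k).+1 => (#|descents p|).-tuple (hook (2 * k).+1)) (Tuple sz)).
  rewrite inE inE /conf_hooks /= size_word_hooks eqxx andbT; exact/asboolP.
rewrite /Phi /conf_perm /conf_hooks /= Ecc; congr (_, _).
have arc_cr B C : (B, C) \in a -> crossing_graph rho B C.
  move=> BC; have /forallP/(_ B)/forallP/(_ C) := orient.
  by case: ifP => //; rewrite BC.
have arc_lt B C : (B, C) \in a -> min_hat p B < min_hat p C.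
  move=> BC; have /and4P[Bin Cin _ _] := arc_cr B C BC.
  exact: word_min_hat_lt (mono _ _ BC).
(* Since [a] directs each edge in exactly one way, it suffices that its arcs go from smaller to
   larger [min_hat]. *)
apply/setP => -[B C]; rewrite inE /=; apply/idP/andP => [BC|[cr lt]].
  by split; [exact: arc_cr|exact: arc_lt].
have /forallP/(_ B)/forallP/(_ C) := orient; rewrite cr.
case CB: ((C, B) \in a); last by rewrite addbF.
by have := arc_lt _ _ CB; rewrite ltnNge (ltnW lt).
Qed.

Lemma Phi_image k : [set Phi H | H in VHCh k (2 * k).+1] = Mtilde (2 * k).+2.
Proof.
apply/setP => x; apply/imsetP/idP => [[H Hin ->]|/Phi_surj //].
exact: Phi_VHCh_sub.
Qed.

(** * Counting oriented matchings *)

Section Pyramids.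
Variables (T : finType) (e : rel T) (top : T) (V : {set T}).
Hypotheses (e_sym : symmetric e) (e_irr : irreflexive e) (top_in : top \in V).
Implicit Types (S : {set T}) (a : {set T * T}) (x : {set T} * {set T * T}).

Definition graph_orientation S a : bool :=
  [forall B, forall C, if [&& B \in S, C \in S & e B C] then ((B, C) \in a) (+) ((C, B) \in a)
                       else (B, C) \notin a].

Definition independent S : bool := [forall u in S, forall v in S, ~~ e u v].

Lemma independentP S : reflect {in S &, forall u v, ~~ e u v} (independent S).
Proof.
apply: (iffP forall_inP) => [ind u v uS vS|ind u uS]; last by apply/forall_inP => v; apply: ind.
by have /forall_inP/(_ v vS) := ind u uS.
Qed.

(** The name is that of heaps of pieces: an acyclic orientation with a single source is a pyramid in
    which each vertex of [x.1] occurs once, and the independent complement is a trivial heap. *)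
Definition pyramid x : bool :=
  [&& x.1 \subset V, independent (V :\: x.1), graph_orientation x.1 x.2, acyclic_arcs x.2 &
      (top \in x.1) && [forall B in x.1, (B == top) == [forall C, (C, B) \notin x.2]]].

Lemma graph_orientationP S a :
  reflect ((forall B C, (B, C) \in a -> [/\ B \in S, C \in S & e B C]) /\
           (forall B C, B \in S -> C \in S -> e B C -> ((B, C) \in a) = ((C, B) \notin a)))
          (graph_orientation S a).
Proof.
apply: (iffP idP) => [/forallP or|[or1 or2]].
  split=> [B C BC|B C BS CS eBC].
    by have /forallP/(_ C) := or B; case: ifP => [/and3P[]|_] //; rewrite BC.
  have /forallP/(_ C) := or B; rewrite BS CS eBC /=; by do 2!case: (_ \in a).
apply/forallP => B; apply/forallP => C; case: ifP => [/and3P[BS CS eBC]|not].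
  by rewrite (or2 _ _ BS CS eBC); case: (_ \in a).
by apply/negP => /or1[BS CS eBC]; rewrite BS CS eBC in not.
Qed.

(* A vertex that can be moved across the cut, either as a sink of the pyramid
   leaving the rest independent, or as a new sink. *)
Definition movable x (u : T) : bool :=
  [&& u \in V, u != top & if u \in x.1 then [forall C, (u, C) \notin x.2] &&
                                         [forall t in V :\: x.1, ~~ e u t]
                          else [exists s in x.1, e u s]].

Definition move_vertex (u : T) x : {set T} * {set T * T} :=
  if u \in x.1 then (x.1 :\ u, [set c in x.2 | (c.1 != u) && (c.2 != u)])
  else (u |: x.1, x.2 :|: [set c | [&& c.1 \in x.1, e c.1 u & c.2 == u]]).

(** All edges at a sink point to it, so the arcs lost with the vertex are those created when it
    returns. *)
Lemma move_vertexK x u : pyramid x -> movable x u -> move_vertex u (move_vertex u x) = x.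
Proof.
case: x => S a /and5P[/= _ _ /graph_orientationP[or1 or2] _ _] /and3P[/= uV utop].
rewrite /move_vertex /=; case: ifP => uS /=.
  case/andP=> /forallP sink _; rewrite in_setD1 eqxx /= setD1K //; congr (_, _).
  apply/setP => -[B C]; rewrite !inE /=.
  have [->|Cu] /= := eqVneq C u; last first.
    rewrite andbT !andbF orbF; apply: andb_idr => BC.
    by apply: contraTneq BC => ->; apply: sink.
  rewrite !andbF andbT /=; apply/idP/idP => [/andP[/andP[_ BS] eB]|Bu].
    by rewrite (or2 _ _ BS uS eB) sink.
  have [BS _ eB] := or1 _ _ Bu; rewrite BS eB !andbT.
  by apply: contraTneq Bu => ->; apply: sink.
move=> _; rewrite setU11 /= setU1K ?uS //; congr (_, _).
apply/setP => -[B C]; rewrite !inE /=; apply/idP/idP => [|BC].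
  case/andP=> /orP[//|/and3P[_ _ ->]]; by rewrite andbF.
have [BS CS _] := or1 _ _ BC; rewrite BC /=.
by apply/andP; split; apply: contraFneq uS => <-.
Qed.

Lemma move_vertex_pyramid x u : pyramid x -> movable x u -> pyramid (move_vertex u x).
Proof.
case: x => S a /and5P[/= SV /independentP ind /graph_orientationP[or1 or2] /acyclic_arcsP[r mono]].
move=> /andP[topS /forall_inP src] /and3P[/= uV utop].
rewrite /move_vertex /=; case: ifP => uS /=.
  case/andP=> /forallP sink /forall_inP nonbr; apply/and5P; split=> /=.
  - by apply: subset_trans SV; apply: subsetDl.
  - have inV v : v \in V :\: (S :\ u) -> v = u \/ v \in V :\: S.
      by rewrite !inE negb_and negbK; have [->|_] := eqVneq v u; [left|right].
    apply/independentP => v t /inV vin /inV tin.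
    case: vin tin => [->|vin] [->|tin]; first by rewrite e_irr.
    + exact: nonbr.
    + by rewrite e_sym nonbr.
    + exact: ind.
  - apply/graph_orientationP; split=> [B C|B C]; rewrite !inE /=.
      by case/andP=> /or1[-> -> ->] /andP[-> ->].
    by move=> /andP[Bu BS] /andP[Cu CS] eBC; rewrite Bu Cu !andbT or2.
  - by apply/acyclic_arcsP; exists r => B C; rewrite inE => /andP[/mono].
  - rewrite !inE eq_sym utop topS /=; apply/forall_inP => B; rewrite !inE => /andP[Bu BS].
    rewrite (eqP (src B BS)); apply/eqP; apply: eq_forallb => C; rewrite inE /= Bu andbT.
    by have [->|] := eqVneq C u; rewrite ?andbT ?andbF ?sink.
case/exists_inP=> s0 s0S us0; have nuS B C : (B, C) \in a -> (B != u) && (C != u).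
  by move=> /or1[BS CS _]; apply/andP; split; apply: contraFneq uS => <-.
apply/and5P; split=> /=.
- by rewrite subUset sub1set uV.
- apply/independentP => v t; rewrite !inE !negb_or -!andbA => /and3P[_ vS vV] /and3P[_ tS tV].
  by apply: ind; rewrite inE ?vS ?tS.
- apply/graph_orientationP; split=> [B C|B C]; rewrite !inE /=.
    case/orP=> [/or1[-> -> ->]|/and3P[BS eB /eqP->]]; first by rewrite !orbT.
    by rewrite BS orbT eqxx.
  have nu B' C' : (u, B') \in a = false /\ (C', u) \in a = false.
    by split; apply/negP => /nuS; rewrite eqxx ?andbF.
  move=> /predU1P[->|BS] /predU1P[->|CS] eBC; first by rewrite e_irr in eBC.
  + by rewrite (proj1 (nu C u)) (proj2 (nu u C)) uS CS e_sym eBC eqxx.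
  + by rewrite (proj1 (nu B u)) (proj2 (nu u B)) uS BS eBC eqxx.
  + have neq C' : C' \in S -> (C' == u) = false by move=> C'S; apply: contraFF uS => /eqP <-.
    by rewrite !neq // !andbF !orbF or2.
- apply/acyclic_arcsP; exists (fun B => if B == u then (\max_B r B).+1 else r B) => B C.
  rewrite !inE /= => /orP[BC|/and3P[BS eB /eqP->]].
    by have /andP[/negPf-> /negPf->] := nuS _ _ BC; apply: mono.
  have /negPf-> : B != u by apply: contraFneq uS => <-.
  by rewrite eqxx ltnS leq_bigmax.
- rewrite !inE topS orbT /=; apply/forall_inP => B; rewrite !inE => /predU1P[->|BS].
    rewrite (negPf utop); apply/eqP/esym/forallP => /(_ s0).
    by rewrite !inE s0S e_sym us0 eqxx orbT.
  have Bu : B != u by apply: contraFneq uS => <-.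
  rewrite (eqP (src B BS)); apply/eqP; apply: eq_forallb => C.
  by rewrite !inE /= (negPf Bu) !andbF orbF.
Qed.

Lemma movable_self x u : pyramid x -> movable x u -> movable (move_vertex u x) u.
Proof.
case: x => S a /and5P[/= SV /independentP ind /graph_orientationP[or1 or2] /acyclic_arcsP[r mono]].
move=> /andP[topS /forall_inP src] /and3P[/= uV utop].
rewrite /movable uV utop /move_vertex /=; case: ifP => uS /=.
  case/andP=> /forallP sink _; rewrite setD11 /=.
  have := src u uS; rewrite (negPf utop) eq_sym eqbF_neg negb_forall.
  move=> /existsP[C]; rewrite negbK => Cu.
  have [CS _ eCu] := or1 _ _ Cu; apply/exists_inP; exists C; last by rewrite e_sym.
  by rewrite in_setD1 CS andbT; apply: contraTneq Cu => ->; apply: sink.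
move=> _; rewrite setU11; apply/andP; split.
  apply/forallP => C; rewrite !inE /= uS /= orbF; apply/negP => /or1[].
  by rewrite uS.
apply/forall_inP => t; rewrite !inE negb_or -andbA => /and3P[_ tS tV].
by apply: ind; rewrite inE ?uS ?tS.
Qed.

(** This makes the choice of a movable vertex the same before and after a move. If [v] is in the
    pyramid, an edge to [u] blocks it either way: it is an arc out of [v] while [u] is a sink, and
    spoils independence once [u] is outside. If [v] is outside, it has no edge to [u], for otherwise
    [u] could not leave. *)
Lemma movable_move x u v : pyramid x -> movable x u ->
  movable (move_vertex u x) v = movable x v.
Proof.
have [->|vu px mx] := eqVneq v u; first by move=> px mx; rewrite mx movable_self.
wlog uS : x px mx / u \in x.1 => [wlog_in|].
  case: (boolP (u \in x.1)) => [|uS]; first exact: (wlog_in x px mx).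
  rewrite -{2}(move_vertexK px mx) (wlog_in (move_vertex u x)) ?move_vertex_pyramid ?movable_self //.
  by rewrite /move_vertex (negPf uS) setU11.
case: x px mx uS => S a /and5P[/= SV /independentP ind /graph_orientationP[or1 or2] _ _].
move=> /and3P[/= uV utop] + uS; rewrite uS => /andP[/forallP sink /forall_inP nonbr].
rewrite /movable /move_vertex /= uS /= in_setD1 vu /=; case vV: (v \in V) => //=.
case: (v != top) => //=; case: ifP => vS.
  apply/andP/andP => -[/forallP snk /forall_inP nb]; split.
  - apply/forallP => C; apply/negP => vC; have := snk C; rewrite !inE vC vu /= => /negP; apply.
    apply/negP => /eqP EC; have := nb u; rewrite !inE eqxx uV => /(_ isT).
    by have [_ _] := or1 _ _ vC; rewrite EC => ->.
  - apply/forall_inP => t; rewrite inE => /andP[tS tV].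
    by apply: nb; rewrite !inE negb_and tS orbT.
  - by apply/forallP => C; rewrite !inE negb_and snk.
  - apply/forall_inP => t; rewrite !inE negb_and negbK => /andP[/predU1P[->|tS] tV].
      apply/negP => evu; have := or2 _ _ vS uS evu.
      by rewrite (negPf (snk u)) sink.
    by apply: nb; rewrite inE tS.
apply/exists_inP/exists_inP => -[s sS evs]; exists s => //; first by move: sS; rewrite inE => /andP[].
rewrite in_setD1 sS andbT; apply: contraTneq evs => ->.
by rewrite e_sym nonbr // inE vS.
Qed.

(** If the pyramid has a vertex besides [top], its last one is a sink; when it cannot leave, it has
    a neighbor outside, and that neighbor can enter. So only [top] remains, and it has no neighbor
    outside either. *)
Lemma pyramid_no_movable x : pyramid x && [forall u, ~~ movable x u] =
  (x == ([set top], set0)) && independent V.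
Proof.
apply/andP/andP => [[]|[/eqP-> /independentP ind]].
  case: x => S a /and5P[/= SV /independentP ind /graph_orientationP[or1 or2] /acyclic_arcsP[r mono]].
  move=> /andP[topS /forall_inP src] /forallP nomove.
  have ES : S = [set top].
    apply/eqP; rewrite eq_sym eqEsubset sub1set topS /=; apply/subsetP => B0 B0S.
    rewrite inE; apply/negPn/negP => B0top.
    have P0 : [pred B in S | B != top] B0 by rewrite /= B0S.
    case: (arg_maxnP r P0) => B /andP[/= BS Btop] max.
    have snk : [forall C, (B, C) \notin a].
      apply/forallP => C; apply/negP => BC; have [_ CS _] := or1 _ _ BC.
      have Ctop : C != top.
        apply/negP => Ct; have := src C CS; rewrite Ct eq_sym => /eqP/forallP/(_ B).
        by rewrite BC.
      by have := max C; rewrite /= CS Ctop => /(_ isT); rewrite /= leqNgt mono.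
    have := nomove B; rewrite /movable /= (subsetP SV) // Btop BS snk /=.
    rewrite negb_forall => /existsP[t]; rewrite negb_imply negbK => /andP[tin eBt].
    have := nomove t; move: (tin); rewrite inE => /andP[tS tV].
    rewrite /movable /= tV (negPf tS) /=.
    have -> : t != top by apply: contraNneq tS => ->.
    by move=> /negP; apply; apply/exists_inP; exists B; rewrite // e_sym.
  split.
    apply/eqP; rewrite ES; congr (_, _); apply/setP => -[B C]; rewrite in_set0; apply/negP => /or1.
    by rewrite ES !inE => -[/eqP-> /eqP->]; rewrite e_irr.
  have ntop v : v \in V -> e v top -> False.
    move=> vV evt; have := nomove v; rewrite /movable vV /= ES inE.
    have /negPf-> : v != top by apply: contraTneq evt => ->; rewrite e_irr.
    by move=> /negP; apply; apply/exists_inP; exists top; rewrite ?inE.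
  apply/independentP => u v uV vV.
  have [Eu|utop] := eqVneq u top; first by rewrite Eu e_sym; apply/negP; apply: ntop.
  have [Ev|vtop] := eqVneq v top; first by rewrite Ev; apply/negP; apply: ntop.
  by apply: ind; rewrite ES !inE ?utop ?vtop.
have nbr u v : u \in V -> v \in V -> e u v = false.
  by move=> uV vV; apply/negbTE/ind.
split; last first.
  apply/forallP => u; apply/negP => /and3P[/= uV utop].
  by rewrite inE (negPf utop) => /exists_inP[s]; rewrite inE => /eqP->; rewrite nbr.
apply/and5P; split=> /=.
- by rewrite sub1set.
- by apply/independentP => u v; rewrite !inE => /andP[_ uV] /andP[_ vV]; rewrite nbr.
- apply/graph_orientationP; split=> [B C|B C]; rewrite ?inE // => /eqP-> /eqP->.
  by rewrite e_irr.
- by apply/acyclic_arcsP; exists (fun=> 0) => B C; rewrite inE.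
- rewrite set11 /=; apply/forall_inP => B; rewrite inE => /eqP->; rewrite eqxx.
  by apply/eqP/esym/forallP => C; rewrite inE.
Qed.

Local Open Scope ring_scope.

(* Moving a canonical movable vertex is a sign-reversing involution. *)
Lemma sum_sign_pyramids :
  \sum_(x : {set T} * {set T * T} | pyramid x) (-1) ^+ #|x.1| = - (independent V)%:R :> int.
Proof.
pose P x := pyramid x && [exists u, movable x u].
pose phi x := if [pick u | movable x u] is Some u then move_vertex u x else x.
have phiP x : P x -> exists u,
  [/\ movable x u, phi x = move_vertex u x & P (phi x) /\ phi (phi x) = x].
  move=> /andP[px /existsP[u0 mu0]].
  have [u mu Eu] : exists2 u, movable x u & [pick u | movable x u] = Some u.
    by case: pickP => [u mu|/(_ u0)]; [exists u | rewrite mu0].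
  have E : phi x = move_vertex u x by rewrite /phi Eu.
  exists u; split=> //; rewrite E; split.
    rewrite /P move_vertex_pyramid //; apply/existsP; exists u; exact: movable_self.
  by rewrite /phi (eq_pick (fun w => movable_move w px mu)) Eu move_vertexK.
have sgn x : P x -> (-1) ^+ #|(phi x).1| = - (-1) ^+ #|x.1| :> int.
  move=> /[dup] /phiP[u [mu -> _]] /andP[px _]; rewrite /move_vertex; case: ifP => /= uS.
    by rewrite [in RHS](cardsD1 u) uS exprS mulN1r opprK.
  by rewrite cardsU1 uS exprS mulN1r.
rewrite (bigID (fun x => [exists u, movable x u])) /=.
have -> : \sum_(x | P x) (-1) ^+ #|x.1| = 0 :> int.
  suff E : \sum_(x | P x) (-1) ^+ #|x.1| = - \sum_(x | P x) (-1) ^+ #|x.1| :> int by lia.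
  rewrite {1}(reindex_onto phi phi) => [|x /phiP[u [_ _ [_ ->]]] //].
  rewrite -sumrN; apply: eq_big => [x|x /andP[Px /eqP E]].
    apply/andP/idP => [[Px /eqP <-]|/phiP[u [_ _ [Px ->]]] //].
    by have [_ [_ _ [Px' _]]] := phiP _ Px.
  by apply: sgn; rewrite -E; have [_ [_ _ [Px' _]]] := phiP _ Px.
rewrite add0r (eq_bigl (fun x => (x == ([set top], set0)) && independent V)); last first.
  by move=> x; rewrite -pyramid_no_movable negb_exists.
case: (independent V); last by rewrite big1 ?oppr0 // => x; rewrite andbF.
by rewrite (eq_bigl (pred1 ([set top], set0))) ?big_pred1_eq ?cards1 // => x; rewrite andbT.
Qed.

End Pyramids.

(** * Oriented matchings of subsets, up to relabelling *)

Definition matching_of n (U : {set 'I_n}) (M : {set {set 'I_n}}) : bool :=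
  partition M U && [forall B in M, #|B| == 2].

Definition block_cross n : rel {set 'I_n} := fun B C => (B != C) && crossing B C.

Definition noncrossing_matchings n (U : {set 'I_n}) : {set {set {set 'I_n}}} :=
  [set M | matching_of U M && independent (@block_cross n) M].

(** The analogue of [Mtilde] on a point set [U]. Connectedness follows from the single source, as
    each other block has an incoming arc to trace back; see [Mtilde_oriented]. *)
Definition oriented_matchings n (U : {set 'I_n}) : {set oriented_partition n} :=
  [set x : oriented_partition n | [&& matching_of U x.1, orientation x.1 x.2, acyclic x.2 &
      sources x.1 x.2 == top_block x.1]].

Lemma monotone_enumeration n q (U : {set 'I_n}) : #|U| = q ->
  exists f : 'I_q -> 'I_n, (forall i j, (f i < f j) = (i < j)) /\ f @: [set: 'I_q] = U.
Proof.
move=> <-; exists (fun i => enum_val i); split; last first.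
  apply/setP => v; apply/imsetP/idP => [[i _ ->]|vU]; first exact: enum_valP.
  by exists (enum_rank_in vU v); rewrite ?enum_rankK_in.
have mono (i j : 'I_#|U|) : i < j -> enum_val i < enum_val j.
  move=> lt; have lti : i < size (enum U) by rewrite -cardE.
  have ltj : j < size (enum U) by rewrite -cardE.
  have srt : sorted ltn [seq (v : 'I_n) : nat | v <- enum U].
    apply: (subseq_sorted ltn_trans (s2 := [seq val v | v <- enum 'I_n])).
      by rewrite enumT; apply: map_subseq; apply: filter_subseq.
    by rewrite val_enum_ord iota_ltn_sorted.
  have := sorted_ltn_nth ltn_trans 0 srt.
  move=> /(_ i j); rewrite !inE !size_map => /(_ lti ltj lt).
  by rewrite !(nth_map (enum_val i)) // -!enum_val_nth.
move=> i j; case: (ltngtP i j) => [/mono|/mono|/val_inj ->] //; last by rewrite ltnn.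
by move=> lt; rewrite ltnNge ltnW.
Qed.

Lemma ltn_mono_inj q n (f : 'I_q -> 'I_n) :
  (forall i j, (f i < f j) = (i < j)) -> injective f.
Proof.
move=> mono i j E; apply/val_inj; have := mono i j; have := mono j i.
by rewrite E ltnn => /esym; case: ltngtP.
Qed.

Section Transport.
Variables (q n : nat) (f : 'I_q -> 'I_n).
Hypothesis f_mono : forall i j, (f i < f j) = (i < j).

Let f_inj : injective f := ltn_mono_inj f_mono.

Let F (B : {set 'I_q}) : {set 'I_n} := f @: B.
Let FF (c : {set 'I_q} * {set 'I_q}) := (F c.1, F c.2).

Let F_inj : injective F.
Proof. exact: imset_inj. Qed.

Let FF_inj : injective FF.
Proof. by move=> [B C] [B' C'] [/F_inj-> /F_inj->]. Qed.

Let mem_F i B : (f i \in F B) = (i \in B).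
Proof. exact: mem_imset. Qed.

Let mem_FF B C (a : arcs q) : ((F B, F C) \in FF @: a) = ((B, C) \in a).
Proof. exact: (mem_imset _ (B, C)). Qed.

Lemma crossing_transport B C : crossing (F B) (F C) = crossing B C.
Proof.
apply/exists_inP/exists_inP => [[_ /imsetP[i iB ->]]|[i iB]] /exists_inP[].
  move=> _ /imsetP[k kB ->] /exists_inP[_ /imsetP[j jC ->]] /exists_inP[_ /imsetP[l lC ->]].
  rewrite !f_mono => lt; exists i => //; apply/exists_inP; exists k => //.
  by apply/exists_inP; exists j => //; apply/exists_inP; exists l.
move=> k kB /exists_inP[j jC] /exists_inP[l lC] lt.
exists (f i); rewrite ?mem_F //; apply/exists_inP; exists (f k); rewrite ?mem_F //.
apply/exists_inP; exists (f j); rewrite ?mem_F //.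
by apply/exists_inP; exists (f l); rewrite ?mem_F // !f_mono.
Qed.

Lemma matching_of_transport (U : {set 'I_q}) (rho : {set {set 'I_q}}) :
  matching_of (F U) (F @: rho) = matching_of U rho.
Proof.
rewrite /matching_of (imset_partition _ _ f_inj); congr (_ && _).
apply/forall_inP/forall_inP => all2 B.
  by move=> Bin; have := all2 (F B); rewrite card_imset // mem_imset //; apply.
by move=> /imsetP[C Cin ->]; rewrite card_imset // all2.
Qed.

Lemma crossing_graph_transport (rho : {set {set 'I_q}}) B C :
  crossing_graph (F @: rho) (F B) (F C) = crossing_graph rho B C.
Proof. by rewrite /crossing_graph !mem_imset // (inj_eq F_inj) crossing_transport. Qed.

Lemma orientation_transport (rho : {set {set 'I_q}}) (a : arcs q) :
  orientation (F @: rho) (FF @: a) = orientation rho a.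
Proof.
apply/forallP/forallP => or B; apply/forallP => C.
  by have /forallP/(_ (F C)) := or (F B); rewrite crossing_graph_transport !mem_FF.
have none : (B, C) \in FF @: a -> exists B' C', B = F B' /\ C = F C'.
  by move=> /imsetP[[B' C'] _ [-> ->]]; exists B', C'.
case: ifP => [/[dup] cr /and3P[/imsetP[B' _ EB] /imsetP[C' _ EC] _]|ncr].
  have /forallP/(_ C') := or B'; rewrite -crossing_graph_transport -EB -EC cr.
  by rewrite -!mem_FF -EB -EC.
apply/negP => /[dup] BC /none[B' [C' [EB EC]]].
have /forallP/(_ C') := or B'; rewrite -crossing_graph_transport -EB -EC ncr.
by rewrite -mem_FF -EB -EC BC.
Qed.

Lemma acyclic_transport (a : arcs q) : acyclic (FF @: a) = acyclic a.
Proof.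
apply/idP/idP => /acyclicP[r mono].
  by apply/acyclicP; exists (r \o F) => B C BC; apply: mono; rewrite mem_FF.
apply/acyclicP; exists (fun B : {set 'I_n} => r (f @^-1: B)) => _ _ /imsetP[[B C] BC [-> ->]].
have FK D : f @^-1: F D = D by apply/setP => i; rewrite inE mem_F.
by rewrite !FK mono.
Qed.

(** The largest element in [top_block] is that of the ambient type, so the relabelling has to match
    the two largest elements. *)
Hypothesis f_max : forall i, ((f i).+1 == n) = (i.+1 == q).

Lemma sources_transport (rho : {set {set 'I_q}}) (a : arcs q) :
  (sources (F @: rho) (FF @: a) == top_block (F @: rho)) = (sources rho a == top_block rho).
Proof.
have -> : sources (F @: rho) (FF @: a) = F @: sources rho a.
  apply/setP => B; apply/idP/imsetP => [|[B']]; rewrite inE => /andP[].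
    move=> /imsetP[B' Bin ->] /forallP none; exists B' => //; rewrite inE Bin.
    by apply/forallP => C; rewrite -mem_FF none.
  move=> Bin /forallP none ->; rewrite inE mem_imset // Bin; apply/forallP => C.
  by apply/negP => /imsetP[[C' B''] CB [_ /F_inj EB]]; have := none C'; rewrite EB CB.
have -> : top_block (F @: rho) = F @: top_block rho.
  apply/setP => B; apply/idP/imsetP => [|[B']]; rewrite inE => /andP[].
    move=> /imsetP[B' Bin ->] /exists_inP[_ /imsetP[i iB ->]]; rewrite f_max => Ei.
    by exists B' => //; rewrite inE Bin; apply/exists_inP; exists i.
  move=> Bin /exists_inP[i iB Ei] ->; rewrite inE mem_imset // Bin.
  by apply/exists_inP; exists (f i); rewrite ?mem_F ?f_max.
by rewrite (inj_eq (imset_inj F_inj)).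
Qed.

Lemma card_oriented_transport :
  #|oriented_matchings (f @: [set: 'I_q])| = #|oriented_matchings [set: 'I_q]|.
Proof.
pose psi (x : oriented_partition q) : oriented_partition n := (F @: x.1, FF @: x.2).
have psi_inj : injective psi.
  move=> [rho a] [rho' a'] [E E']; congr (_, _).
    exact: (imset_inj F_inj E).
  exact: (imset_inj FF_inj E').
rewrite -[RHS](card_imset _ psi_inj); apply: eq_card => -[rho a].
have psiE x : (psi x \in oriented_matchings (F setT)) = (x \in oriented_matchings setT).
  by rewrite !inE /= matching_of_transport orientation_transport acyclic_transport sources_transport.
apply/idP/imsetP => [/[dup] xin|[x xin ->]]; last by rewrite psiE.
rewrite inE /= => /and4P[/andP[part _] or _ _].
have FK B : B \in rho -> F (f @^-1: B) = B.
  move=> Bin; apply/setP => v; apply/imsetP/idP => [[i]|vB]; first by rewrite inE => iB ->.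
  have /imsetP[i _ Ev] : v \in f @: [set: 'I_q].
    by rewrite -(cover_partition part); apply/bigcupP; exists B.
  by exists i; rewrite // inE -Ev.
have rhoK : F @: [set f @^-1: (B : {set 'I_n}) | B in rho] = rho.
  rewrite -imset_comp -[RHS]imset_id; apply: eq_in_imset => B Bin; exact: FK.
have aK : FF @: [set (f @^-1: (c.1 : {set 'I_n}), f @^-1: (c.2 : {set 'I_n})) | c in a] = a.
  rewrite -imset_comp -[RHS]imset_id; apply: eq_in_imset => -[B C] BC.
  have /forallP/(_ B)/forallP/(_ C) := or; case: ifP => [/and4P[Bin Cin _ _] _|]; last by rewrite BC.
  by rewrite /FF /= !FK.
pose x : oriented_partition q := ([set f @^-1: (B : {set 'I_n}) | B in rho],
  [set (f @^-1: (c.1 : {set 'I_n}), f @^-1: (c.2 : {set 'I_n})) | c in a]).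
have Ex : (rho, a) = psi x by rewrite /psi /= rhoK aK.
by exists x => //; rewrite -psiE -Ex.
Qed.

End Transport.

Lemma card_oriented_matchings n q (U : {set 'I_n.+1}) :
  ord_max \in U -> #|U| = q -> #|oriented_matchings U| = #|oriented_matchings [set: 'I_q]|.
Proof.
move=> maxU cU; have [f [mono EU]] := monotone_enumeration cU; rewrite -EU.
apply: card_oriented_transport => // i; rewrite -EU in maxU.
have /imsetP[j _ Ej] := maxU; have Ej' : f j = n :> nat by rewrite -Ej.
have max (l : 'I_q) : l <= j by rewrite leqNgt -mono Ej' -leqNgt -ltnS.
have Eq : j.+1 = q.
  apply/eqP; rewrite eqn_leq ltn_ord /=; rewrite leqNgt; apply/negP => lt.
  by have := max (Ordinal lt); rewrite /= ltnn.
apply/eqP/eqP => [[Ei]|Ei].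
  have le1 := max i; have le2 : j <= i by rewrite leqNgt -mono Ej' Ei ltnn.
  by move: le1 le2 Eq; clear; lia.
have -> : i = j by apply/val_inj => /=; move: Ei Eq; clear; lia.
by rewrite Ej'.
Qed.

(** * Catalan numbers and noncrossing matchings *)

Lemma catalanE n : catalan n * n.+1 = 'C(2 * n, n).
Proof.
(* The quotient is the ballot difference, because [(n+1) C(2n, n+1) = n C(2n, n)]. *)
rewrite /catalan divnK //; apply/dvdnP; exists ('C(2 * n, n) - 'C(2 * n, n.+1)).
have := mul_bin_left (2 * n) n; have -> : 2 * n - n = n by lia.
by nia.
Qed.

Lemma catalanS n : n.+2 * catalan n.+1 = (4 * n + 2) * catalan n.
Proof.
have E1 : (2 * n).+2 * 'C((2 * n).+1, n) = n.+1 * 'C((2 * n).+2, n.+1).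
  exact: (mul_bin_diag (2 * n).+2 n).
have E2 : (2 * n).+1 * 'C(2 * n, n) = n.+1 * 'C((2 * n).+1, n).
  by have := mul_bin_down (2 * n).+1 n; have -> : (2 * n).+1 - n = n.+1 by lia.
have C1 := catalanE n.+1; have C0 := catalanE n.
rewrite (_ : 2 * n.+1 = (2 * n).+2) in C1; last lia.
apply/eqP; rewrite -(eqn_pmul2r (isT : 0 < n.+1)) -(eqn_pmul2r (isT : 0 < n.+1)).
rewrite -C0 -?C1 in E1 E2; nia.
Qed.

(* Comparing sums weighted by the index with their reversals turns the ratio of
   consecutive Catalan numbers into the convolution identity. *)
Lemma catalan_convolution n :
  \sum_(i < n.+1) catalan i * catalan (n - i) = catalan n.+1.
Proof.
pose S t := \sum_(i < t.+1) catalan i * catalan (t - i).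
pose R t := \sum_(i < t.+1) i * (catalan i * catalan (t - i)).
have RS t : 2 * R t = t * S t.
  have E : R t = \sum_(i < t.+1) (t - i) * (catalan i * catalan (t - i)).
    rewrite /R (reindex_inj rev_ord_inj) /=; apply: eq_bigr => i _.
    rewrite subSS; have -> : t - (t - i) = i by have := ltn_ord i; lia.
    by congr (_ * _); rewrite mulnC.
  rewrite mul2n -addnn {2}E -big_split /= /S big_distrr /=; apply: eq_bigr => i _.
  by rewrite -mulnDl; congr (_ * _); have := ltn_ord i; lia.
rewrite -/(S n); elim: n => [|n IH]; first by rewrite /S big_ord_recl big_ord0.
(* The weight [i + 1] lets [catalanS] lower the index: the terms past the first give
   [4 R n + 2 S n], which is [(2n + 2) S n] by [RS]. *)
have rec : R n.+1 + S n.+1 = catalan n.+1 + (2 * n + 2) * S n.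
  have E : R n.+1 + S n.+1 = \sum_(i < n.+2) i.+1 * (catalan i * catalan (n.+1 - i)).
    by rewrite -big_split; apply: eq_bigr => i _ /=; rewrite mulSn addnC.
  rewrite E big_ord_recl /= /bump /= mul1n subn0 {1}/catalan mul1n; congr (_ + _).
  have E' : \sum_(i < n.+1) (i.+2 * catalan i.+1) * catalan (n - i) = 4 * R n + 2 * S n.
    rewrite /R /S !big_distrr -big_split /=; apply: eq_bigr => i _.
    by rewrite catalanS; lia.
  rewrite (eq_bigr (fun i : 'I_n.+1 => (i.+2 * catalan i.+1) * catalan (n - i))).
    by rewrite E'; have := RS n; nia.
  by move=> i _; rewrite /= add1n subSS mulnA.
have := RS n.+1; have := catalanS n.+1; rewrite IH in rec; nia.
Qed.

(* The moments of the semicircle law. *)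
Definition aerated_catalan (q : nat) : nat := if odd q then 0 else catalan q./2.

Lemma sum_even_index (g : nat -> nat) t : (forall i, odd i -> g i = 0) ->
  \sum_(i < (2 * t).+1) g i = \sum_(i < t.+1) g (2 * i).
Proof.
move=> g0; elim: t => [|t IH]; first by rewrite !big_ord_recl !big_ord0.
rewrite big_ord_recr [RHS]big_ord_recr /= -IH.
have -> : 2 * t.+1 = (2 * t).+2 by lia.
rewrite big_ord_recr /= [g (2 * t).+1]g0 ?addn0 //.
by rewrite /= mul2n odd_double.
Qed.

Lemma aerated_catalan_convolution q :
  \sum_(i < q.+1) aerated_catalan i * aerated_catalan (q - i) = aerated_catalan q.+2.
Proof.
case: (boolP (odd q)) => oq.
  rewrite {3}/aerated_catalan /= negbK oq big1 // => i _; rewrite /aerated_catalan.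
  rewrite oddB; last by rewrite -ltnS.
  by rewrite oq; case: (odd i); rewrite ?muln0.
have even t : aerated_catalan (2 * t) = catalan t.
  by rewrite /aerated_catalan mul2n odd_double doubleK.
have Eq : q = 2 * q./2 by rewrite mul2n even_halfK.
rewrite Eq (sum_even_index (g := fun i => aerated_catalan i * aerated_catalan (2 * q./2 - i))).
  have -> : (2 * q./2).+2 = 2 * q./2.+1 by lia.
  by rewrite even -catalan_convolution; apply: eq_bigr => i _; rewrite -mulnBr !even.
by move=> i oi; rewrite /aerated_catalan oi.
Qed.

Lemma matching_ofP n (U : {set 'I_n}) (M : {set {set 'I_n}}) :
  reflect [/\ forall B, B \in M -> #|B| = 2, forall B, B \in M -> B \subset U,
              forall v, v \in U -> exists2 B, B \in M & v \in B &
              forall B C v, B \in M -> C \in M -> v \in B -> v \in C -> B = C]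
          (matching_of U M).
Proof.
apply: (iffP idP) => [/andP[/and3P[/eqP cov /trivIsetP triv _] /forall_inP all2]|[all2 sub cov uni]].
  split=> [B /all2/eqP //|B Bin|v|B C v Bin Cin vB vC].
  - by rewrite -cov; apply: bigcup_sup.
  - by rewrite -cov => /bigcupP[B]; exists B.
  - apply/eqP/negPn/negP => neq.
    by have /pred0P/(_ v) := triv _ _ Bin Cin neq; rewrite /= vB vC.
apply/andP; split; last by apply/forall_inP => B /all2 ->.
apply/and3P; split.
- apply/eqP/setP => v; apply/bigcupP/idP => [[B /sub/subsetP subB /subB //]|/cov[B]].
  by exists B.
- apply/trivIsetP => B C Bin Cin neq; apply/pred0P => v /=; apply/negP => /andP[vB vC].
  by case/eqP: neq; apply: (uni _ _ v).
- by apply/negP => /all2; rewrite cards0.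
Qed.

Lemma noncrossing_matchingP n (U : {set 'I_n}) M :
  (M \in noncrossing_matchings U) = matching_of U M && independent (@block_cross n) M.
Proof. by rewrite inE. Qed.

Section RemoveLastArc.
Variables (n : nat) (U : {set 'I_n}) (u v : 'I_n).
Hypotheses (uU : u \in U) (vU : v \in U) (v_max : forall x, x \in U -> x <= v) (uv : u < v).

Let L := [set x in U | x < u].
Let R := [set x in U | u < x < v].

Let pair_cross (x y z w : 'I_n) : x < y -> z < w -> ~~ block_cross [set x; y] [set z; w] ->
  ~~ ((x < z < y) && (y < w)) /\ ~~ ((z < x < w) && (w < y)).
Proof.
move=> xy zw; rewrite /block_cross negb_and negbK => nc.
have cr : ~~ crossing [set x; y] [set z; w].
  case/orP: nc => // /eqP ->; apply/negP => /exists_inP[i].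
  rewrite !inE => iB /exists_inP[j]; rewrite !inE => jB /exists_inP[k]; rewrite !inE => kB.
  move=> /exists_inP[l]; rewrite !inE => lB.
  by case/orP: iB => /eqP->; case/orP: jB => /eqP->; case/orP: kB => /eqP->; case/orP: lB => /eqP->; lia.
split; apply: contra cr => /andP[in1 in2].
  by rewrite crossingC; apply: (@crossing_interval _ _ _ x y z w); rewrite ?set21 ?set22 //; lia.
by apply: (@crossing_interval _ _ _ z w x y); rewrite ?set21 ?set22 //; lia.
Qed.

(** An arc not crossing [[set u; v]] lies entirely to the left of [u] or strictly between [u] and
    [v], nothing being to the right of [v]; arcs of the two kinds never cross each other, so the
    sides are independent. *)
Lemma card_noncrossing_last_arc :
  #|[set M in noncrossing_matchings U | [set u; v] \in M]| =
  #|noncrossing_matchings L| * #|noncrossing_matchings R|.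
Proof.
pose g (x : {set {set 'I_n}} * {set {set 'I_n}}) := [set u; v] |: (x.1 :|: x.2).
have notL x : x \in L -> x \notin R by rewrite !inE => /andP[_ lt]; lia.
have uvL : ~~ ([set u; v] \subset L).
  by apply/negP => /subsetP/(_ u); rewrite set21 inE ltnn andbF => /(_ isT).
have uvR : ~~ ([set u; v] \subset R).
  by apply/negP => /subsetP/(_ u); rewrite set21 inE ltnn andbF => /(_ isT).
have subLR (B : {set 'I_n}) : #|B| = 2 -> B \subset L -> B \subset R -> False.
  move=> /pair_block[s [t [-> _ _ _]]] /subsetP/(_ s) sL /subsetP/(_ s) sR.
  by have := notL s (sL (set21 _ _)); rewrite (sR (set21 _ _)).
have gL M1 M2 : matching_of L M1 -> matching_of R M2 -> M1 = [set B in g (M1, M2) | B \subset L].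
  move=> /matching_ofP[_ sub1 _ _] /matching_ofP[two2 sub2 _ _].
  apply/setP => B; rewrite !inE; apply/idP/andP => [B1|[/or3P[/eqP->|//|B2] BL]].
  - by rewrite B1 orbT sub1.
  - by rewrite BL in uvL.
  - by case: (subLR _ (two2 _ B2) BL (sub2 _ B2)).
have gR M1 M2 : matching_of L M1 -> matching_of R M2 -> M2 = [set B in g (M1, M2) | B \subset R].
  move=> /matching_ofP[two1 sub1 _ _] /matching_ofP[_ sub2 _ _].
  apply/setP => B; rewrite !inE; apply/idP/andP => [B1|[/or3P[/eqP->|B1|//] BR]].
  - by rewrite B1 !orbT sub2.
  - by rewrite BR in uvR.
  - by case: (subLR _ (two1 _ B1) (sub1 _ B1) BR).
rewrite -cardsX -(card_in_imset (f := g)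
  (D := setX (noncrossing_matchings L) (noncrossing_matchings R))).
  apply: eq_card => M; apply/idP/imsetP; last first.
    move=> [[M1 M2]]; rewrite in_setX /= !noncrossing_matchingP.
    move=> /andP[/andP[/matching_ofP[two1 sub1 cov1 uni1] /independentP nc1]
                 /andP[/matching_ofP[two2 sub2 cov2 uni2] /independentP nc2]] ->.
    have LU : L \subset U by apply/subsetP => x; rewrite inE => /andP[].
    have RU : R \subset U by apply/subsetP => x; rewrite inE => /andP[].
    have uvU : [set u; v] \subset U by rewrite subUset !sub1set uU.
    have disj12 B C x : B \in M1 -> C \in M2 -> x \in B -> x \in C -> False.
      move=> /sub1/subsetP B1 /sub2/subsetP C2 /B1 xL /C2 xR.
      by have := notL x xL; rewrite xR.
    have disj01 B x : B \in M1 -> x \in B -> x \in [set u; v] -> False.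
      by move=> /sub1/subsetP B1 /B1; rewrite !inE => /andP[_ lt] /orP[]/eqP E; move: lt (uv); rewrite E; clear; lia.
    have disj02 B x : B \in M2 -> x \in B -> x \in [set u; v] -> False.
      by move=> /sub2/subsetP B1 /B1; rewrite !inE => /andP[_ lt] /orP[]/eqP E; move: lt (uv); rewrite E; clear; lia.
    have nc12 B C : B \in M1 -> C \in M2 -> ~~ block_cross B C.
      move=> B1 C2; apply/negP => /andP[_ cr].
      have /pair_block[s [t [EB st Es Et]]] := two1 B B1.
      have /pair_block[s' [t' [EC st' Es' Et']]] := two2 C C2.
      have := subsetP (sub1 B B1) t; rewrite EB set22 inE => /(_ isT)/andP[_ tu].
      have := subsetP (sub2 C C2) s'; rewrite EC set21 inE => /(_ isT)/andP[_ su].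
      by case: (crossing_pair (two1 B B1) (two2 C C2) cr); rewrite Es Et Es' Et'; move: st st' tu su; clear; lia.
    have nc01 B : B \in M1 -> ~~ block_cross B [set u; v].
      move=> B1; apply/negP => /andP[_ cr].
      have /pair_block[s [t [EB st Es Et]]] := two1 B B1.
      have := subsetP (sub1 B B1) t; rewrite EB set22 inE => /(_ isT)/andP[_ tu].
      have two0 : #|[set u; v]| = 2 by rewrite cards2; case: eqP uv => // ->; rewrite ltnn.
      by case: (crossing_pair (two1 B B1) two0 cr); rewrite Es Et block_min_pair // block_max_pair //;
        move: st tu (uv); clear; lia.
    have nc02 B : B \in M2 -> ~~ block_cross B [set u; v].
      move=> B2; apply/negP => /andP[_ cr].
      have /pair_block[s [t [EB st Es Et]]] := two2 B B2.
      have := subsetP (sub2 B B2) t; rewrite EB set22 inE => /(_ isT)/andP[_ tu].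
      have := subsetP (sub2 B B2) s; rewrite EB set21 inE => /(_ isT)/andP[_ su].
      have two0 : #|[set u; v]| = 2 by rewrite cards2; case: eqP uv => // ->; rewrite ltnn.
      by case: (crossing_pair (two2 B B2) two0 cr); rewrite Es Et block_min_pair // block_max_pair //;
        move: st tu su (uv); clear; lia.
    have bcC B C : block_cross B C = block_cross C B by rewrite /block_cross eq_sym crossingC.
    rewrite inE noncrossing_matchingP setU11 andbT; apply/andP; split.
      apply/matching_ofP; split.
      - move=> B; rewrite !inE => /or3P[/eqP->|/two1//|/two2//].
        by rewrite cards2; case: eqP uv => // ->; rewrite ltnn.
      - move=> B; rewrite !inE => /or3P[/eqP->//|/sub1 s|/sub2 s]; first exact: subset_trans LU.
        exact: subset_trans RU.
      - move=> x xU; have := v_max xU; rewrite leq_eqVlt => /predU1P[/val_inj ->|xv].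
          by exists [set u; v]; rewrite ?set22 ?setU11.
        case: (ltngtP x u) => [xu|xu|/val_inj ->]; last by exists [set u; v]; rewrite ?set21 ?setU11.
          by have [|B B1 xB] := cov1 x; [rewrite inE xU|exists B; rewrite // !inE B1 orbT].
        by have [|B B1 xB] := cov2 x; [rewrite inE xU xu|exists B; rewrite // !inE B1 !orbT].
      - move=> B C x; rewrite !inE => /or3P[/eqP->|B1|B2] /or3P[/eqP->|C1|C2] // xB xC.
        + by case: (disj01 C x).
        + by case: (disj02 C x).
        + by case: (disj01 B x).
        + exact: uni1 xB xC.
        + by case: (disj12 B C x).
        + by case: (disj02 B x).
        + by case: (disj12 C B x).
        + exact: uni2 xB xC.
    apply/independentP => B C; rewrite !inE => /or3P[/eqP->|B1|B2] /or3P[/eqP->|C1|C2].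
    - by rewrite /block_cross eqxx.
    - by rewrite bcC nc01.
    - by rewrite bcC nc02.
    - exact: nc01.
    - exact: nc1.
    - exact: nc12.
    - exact: nc02.
    - by rewrite bcC nc12.
    - exact: nc2.
  rewrite inE noncrossing_matchingP => /andP[/andP[/matching_ofP[two sub cov uni] /independentP nc] uvM].
  have cases B : B \in M -> [\/ B = [set u; v], B \subset L | B \subset R].
    move=> BM; have [s [t [EB st _ _]]] := pair_block (two B BM).
    have [->|neq] := eqVneq B [set u; v]; first by constructor 1.
    have ns x : x \in B -> x != u /\ x != v.
      by move=> xB; split; apply: contra neq => /eqP Ex; apply/eqP/(uni _ _ x) => //;
         rewrite Ex ?set21 ?set22.
    have sB : s \in B by rewrite EB set21.
    have tB : t \in B by rewrite EB set22.
    have [/ord_neq su sv] := ns s sB; have [/ord_neq tu /ord_neq tv] := ns t tB.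
    have sU : s \in U by apply: (subsetP (sub B BM)).
    have tU : t \in U by apply: (subsetP (sub B BM)).
    have tv' : t < v by have := v_max tU; move: tv; clear; lia.
    have := nc _ _ BM uvM; rewrite EB => /(pair_cross st uv)[n1 n2].
    case: (ltnP t u) => [lt|le].
      constructor 2; apply/subsetP => x; rewrite !inE => /orP[]/eqP->;
        rewrite ?sU ?tU /=; move: lt st; clear; lia.
    constructor 3; apply/subsetP => x; rewrite !inE => /orP[]/eqP->;
      rewrite ?sU ?tU /=; move: le st su tu tv' n1 n2; clear; lia.
  exists ([set B in M | B \subset L], [set B in M | B \subset R]).
    rewrite in_setX /= !noncrossing_matchingP; apply/andP; split; apply/andP; split.
    - apply/matching_ofP; split.
      + by move=> B; rewrite inE => /andP[/two].
      + by move=> B; rewrite inE => /andP[].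
      + move=> x xL; have xU : x \in U by move: xL; rewrite inE => /andP[].
        have [B BM xB] := cov x xU; exists B => //; rewrite inE BM /=.
        case: (cases B BM) => [EB| //|/subsetP/(_ x xB) xR].
          by move: xL xB; rewrite EB !inE => /andP[_ lt] /orP[]/eqP E; move: lt (uv); rewrite E; clear; lia.
        by have := notL x xL; rewrite xR.
      + by move=> B C x; rewrite !inE => /andP[BM _] /andP[CM _]; apply: uni.
    - by apply/independentP => B C; rewrite !inE => /andP[BM _] /andP[CM _]; apply: nc.
    - apply/matching_ofP; split.
      + by move=> B; rewrite inE => /andP[/two].
      + by move=> B; rewrite inE => /andP[].
      + move=> x xR; have xU : x \in U by move: xR; rewrite inE => /andP[].
        have [B BM xB] := cov x xU; exists B => //; rewrite inE BM /=.
        case: (cases B BM) => [EB|/subsetP/(_ x xB) xL|//].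
          by move: xR xB; rewrite EB !inE => /andP[_ lt] /orP[]/eqP E; move: lt (uv); rewrite E; clear; lia.
        by have := notL x xL; rewrite xR.
      + by move=> B C x; rewrite !inE => /andP[BM _] /andP[CM _]; apply: uni.
    - by apply/independentP => B C; rewrite !inE => /andP[BM _] /andP[CM _]; apply: nc.
  apply/setP => B; rewrite !inE; apply/idP/or3P => [BM|[/eqP->|/andP[]|/andP[]]] //.
  by case: (cases B BM) => [->|s|s]; [constructor 1|constructor 2; rewrite BM|constructor 3; rewrite BM].
move=> [M1 M2] [M1' M2']; rewrite !inE /= => /andP[/andP[m1 _] /andP[m2 _]] /andP[/andP[m1' _] /andP[m2' _]] E.
have {}E : g (M1, M2) = g (M1', M2') := E.
by congr (_, _); [rewrite (gL _ _ m1 m2) E -gL | rewrite (gR _ _ m1 m2) E -gR].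
Qed.

End RemoveLastArc.

Lemma card_ord_gt q (i : 'I_q) : #|[set j : 'I_q | i < j]| = q - i.+1.
Proof.
rewrite cardsCs card_ord; congr (_ - _); rewrite -[RHS](card_ord_lt (ltn_ord i)).
by apply: eq_card => j; rewrite !inE ltnS [in RHS]leqNgt.
Qed.

(** Splitting by the partner of the largest element gives the convolution. The aerated numbers
    absorb parity: a side of odd size contributes zero. *)
Lemma card_noncrossing_matchings n (U : {set 'I_n}) :
  #|noncrossing_matchings U| = aerated_catalan #|U|.
Proof.
have [k] := ubnP #|U|; elim: k U => // k IH U ltk.
have [E|[x0 x0U]] := set_0Vmem U.
  rewrite E cards0 (_ : noncrossing_matchings _ = [set set0]) ?cards1 //.
  apply/setP => M; rewrite noncrossing_matchingP in_set1; apply/andP/eqP => [[/matching_ofP[two sub _ _] _]|->].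
    apply/setP => B; rewrite in_set0; apply/negP => BM.
    by have := two B BM; move: (sub B BM); rewrite subset0 => /eqP->; rewrite cards0.
  split; last by apply/independentP => B C; rewrite in_set0.
  by apply/matching_ofP; split=> [B|B|v|B C v]; rewrite in_set0.
case: (arg_maxnP (fun x : 'I_n => x : nat) x0U) => v v_in v_ge.
have vU : v \in U := v_in.
have v_max x : x \in U -> x <= v := v_ge x.
pose W := U :\ v.
have W_lt u : u \in W -> u \in U /\ u < v.
  rewrite in_setD1 => /andP[uv uU]; split=> //; have := v_max u uU; have := ord_neq uv; clear; lia.
(* The default [v] lies outside [W], so membership in [W] certifies a genuine partner. *)
pose mate (M : {set {set 'I_n}}) : 'I_n := odflt v [pick u in W | [set u; v] \in M].
have mate_in (M : {set {set 'I_n}}) :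
    M \in noncrossing_matchings U -> mate M \in W /\ [set mate M; v] \in M.
  rewrite noncrossing_matchingP /mate => /andP[/matching_ofP[two sub cov _] _].
  case: pickP => [u /andP[]|none] //=.
  have [B BM vB] := cov v vU; have [s [t [EB st _ _]]] := pair_block (two B BM).
  have sU : s \in U by apply: (subsetP (sub B BM)); rewrite EB set21.
  have tU : t \in U by apply: (subsetP (sub B BM)); rewrite EB set22.
  have Ev : v = t.
    move: vB; rewrite EB !inE => /orP[]/eqP // Ev.
    by have := v_max t tU; rewrite Ev /= leqNgt st.
  have := none s; rewrite in_setD1 sU Ev -EB BM.
  by have -> : s != t by apply: contraTneq st => ->; rewrite ltnn.
rewrite -sum1_card (partition_big mate (mem W)) => [|M /mate_in[]] //.
have arc u : u \in W -> \sum_(M in noncrossing_matchings U | mate M == u) 1 =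
    aerated_catalan #|[set x in U | x < u]| * aerated_catalan #|[set x in U | u < x < v]|.
  move=> uW; have [uU uv] := W_lt u uW.
  have small (A : {set 'I_n}) : A \subset W -> #|A| < k.
    by move=> /subset_leq_card le; move: ltk; rewrite (cardsD1 v) vU -/W add1n ltnS; apply: leq_ltn_trans.
  have ltL : #|[set x in U | x < u]| < k.
    apply/small/subsetP => x; rewrite !inE => /andP[-> lt]; rewrite andbT.
    by apply: contraTneq lt => ->; rewrite -leqNgt ltnW.
  have ltR : #|[set x in U | u < x < v]| < k.
    apply/small/subsetP => x; rewrite !inE => /and3P[-> _ lt]; rewrite andbT.
    by apply: contraTneq lt => ->; rewrite ltnn.
  rewrite sum1_card -(IH _ ltL) -(IH _ ltR).
  rewrite -card_noncrossing_last_arc //; apply: eq_card => M.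
  rewrite !inE -noncrossing_matchingP; apply: andb_id2l => MU; have [mW mM] := mate_in M MU.
  apply/eqP/idP => [<- //|uM].
  move: MU; rewrite noncrossing_matchingP => /andP[/matching_ofP[_ _ _ uni] _].
  have := uni _ _ v mM uM (set22 _ _) (set22 _ _) => /setP/(_ (mate M)).
  rewrite !inE eqxx /= => /esym/orP[/eqP //|/eqP Ev].
  by have [_] := W_lt _ mW; rewrite Ev ltnn.
rewrite (eq_bigr _ arc) /=.
have [f [mono Ef]] := monotone_enumeration (erefl #|W|).
have f_inj := ltn_mono_inj mono.
rewrite -Ef big_imset /=; last by move=> i j _ _; apply: f_inj.
have cU : #|U| = #|W|.+1 by rewrite (cardsD1 v) vU.
have fW i : f i \in W by rewrite -Ef imset_f.
have inW x : x \in W -> exists j, x = f j.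
  by move=> xW; have /imsetP[j _ ->] : x \in f @: [set: _] by [rewrite Ef]; exists j.
have Lf i : [set x in U | x < f i] = f @: [set j : 'I_#|W| | j < i].
  apply/setP => x; rewrite inE; apply/andP/imsetP => [[xU lt]|[j]]; last first.
    by rewrite inE -mono => lt ->; have [] := W_lt _ (fW j).
  have : x \in W.
    by rewrite in_setD1 xU andbT; apply: contraTneq lt => ->; have [_ lt] := W_lt _ (fW i); rewrite -leqNgt ltnW.
  by move=> /inW[j Ej]; exists j => //; rewrite inE -mono -Ej.
have Rf i : [set x in U | f i < x < v] = f @: [set j : 'I_#|W| | i < j].
  apply/setP => x; rewrite inE; apply/andP/imsetP => [[xU /andP[lt ltv]]|[j]]; last first.
    by rewrite inE -mono => lt ->; have [? ->] := W_lt _ (fW j); rewrite lt.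
  have : x \in W by rewrite in_setD1 xU andbT; apply: contraTneq ltv => ->; rewrite ltnn.
  by move=> /inW[j Ej]; exists j => //; rewrite inE -mono -Ej.
rewrite cU (eq_bigr (fun i : 'I_#|W| => aerated_catalan i * aerated_catalan (#|W| - i.+1))); last first.
  by move=> i _; rewrite Lf Rf !card_imset // card_ord_lt 1?ltnW // card_ord_gt.
rewrite (eq_bigl xpredT) => [|i]; last by rewrite inE.
case: #|W| => [|w]; first by rewrite big_ord0.
rewrite -aerated_catalan_convolution; apply: eq_bigr => i _; by rewrite subSS.
Qed.

(** * The signed recurrence for oriented matchings *)

Lemma sub_setC1 (T : finType) (A : {set T}) x : (A \subset [set~ x]) = (x \notin A).
Proof. by rewrite subsetC sub1set inE. Qed.

Lemma exists_max_in n (B : {set 'I_n.+1}) : [exists i in B, i.+1 == n.+1 :> nat] = (ord_max \in B).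
Proof.
apply/exists_inP/idP => [[i iB /eqP[Ei]]|]; last by exists ord_max.
by have <- : i = ord_max by apply/val_inj.
Qed.

Lemma orientation_arc n (rho : {set {set 'I_n}}) (a : arcs n) B C :
  orientation rho a -> (B, C) \in a -> crossing_graph rho B C.
Proof.
by move=> /forallP/(_ B)/forallP/(_ C); case: ifP => // _ /negPf->.
Qed.

Lemma Mtilde_oriented n : Mtilde n.+1 = oriented_matchings [set: 'I_n.+1].
Proof.
apply/setP => -[rho a]; rewrite !inE /= /matching_of; apply/andP/and4P.
  by move=> [/and5P[part _ or ac src] all2]; split=> //; rewrite part.
move=> [/andP[part all2] or ac src]; split=> //; apply/and5P; split=> //.
have [r mono] := acyclicP a ac.
have [top top_in max_in] := matching_cover part ord_max.
apply: (@connected_from_top _ _ top r) => B Bin Btop.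
suff [C CB] : exists C, (C, B) \in a by exists C; [exact: orientation_arc CB|exact: mono].
have : B \notin sources rho a.
  rewrite (eqP src) inE Bin exists_max_in; apply: contra Btop => maxB.
  by apply/eqP/(matching_eq part Bin top_in maxB).
by rewrite inE Bin negb_forall => /existsP[C]; rewrite negbK; exists C.
Qed.

Lemma matching_of_card n (U : {set 'I_n}) M : matching_of U M -> (#|M| * 2)%N = #|U|.
Proof. by case/andP=> part /forall_inP all2; apply: matching_card => // B /all2/eqP. Qed.

Section CoveringPyramid.
Variable n : nat.
Implicit Types (M S : {set {set 'I_n.+1}}) (x : oriented_partition n.+1).

Let pyr M x := pyramid (@block_cross n.+1) (pblock M ord_max) M x.
Let rooted x := (x \in oriented_matchings (cover x.1)) && (ord_max \in cover x.1).

Lemma sub_matching M S : matching_of [set: 'I_n.+1] M -> S \subset M ->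
  matching_of (cover S) S /\ matching_of (~: cover S) (M :\: S).
Proof.
move=> /matching_ofP[two _ cov uni] /subsetP SM; split; apply/matching_ofP; split.
- by move=> B /SM/two.
- by move=> B BS; apply: bigcup_sup.
- by move=> v /bigcupP[B]; exists B.
- by move=> B C v /SM BM /SM CM; apply: uni.
- by move=> B; rewrite inE => /andP[_ /two].
- move=> B; rewrite inE => /andP[BS BM]; apply/subsetP => v vB; rewrite inE.
  apply: contra BS => /bigcupP[C CS vC]; by rewrite (uni B C v BM (SM _ CS) vB vC).
- move=> v; rewrite inE => vS; have [B BM vB] := cov v (in_setT v).
  exists B => //; rewrite inE BM andbT; apply: contra vS => BS.
  by apply/bigcupP; exists B.
- by move=> B C v; rewrite !inE => /andP[_ BM] /andP[_ CM]; apply: uni.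
Qed.

Lemma join_matching (U : {set 'I_n.+1}) S M : matching_of U S -> matching_of (~: U) M ->
  matching_of [set: 'I_n.+1] (S :|: M) /\ [disjoint S & M].
Proof.
move=> /matching_ofP[two1 sub1 cov1 uni1] /matching_ofP[two2 sub2 cov2 uni2].
have dis B C v : B \in S -> C \in M -> v \in B -> v \in C -> False.
  by move=> /sub1/subsetP sB /sub2/subsetP sC /sB vU /sC; rewrite inE vU.
split.
  apply/matching_ofP; split.
  - by move=> B; rewrite inE => /orP[/two1|/two2].
  - by move=> B _; apply: subsetT.
  - move=> v _; case: (boolP (v \in U)) => vU.
      by have [B BS vB] := cov1 v vU; exists B; rewrite // inE BS.
    by have [|B BM vB] := cov2 v; [rewrite inE|exists B; rewrite // inE BM orbT].
  - move=> B C v; rewrite !inE => /orP[B1|B2] /orP[C1|C2] vB vC.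
    + exact: uni1 vB vC.
    + by case: (dis B C v).
    + by case: (dis C B v).
    + exact: uni2 vB vC.
apply/pred0P => B /=; apply/negP => /andP[BS BM].
have [s [t [EB _ _ _]]] := pair_block (two1 B BS).
by apply: (dis B B s); rewrite // EB set21.
Qed.

Lemma block_is_top M B : matching_of [set: 'I_n.+1] M -> B \in M ->
  (B == pblock M ord_max) = (ord_max \in B).
Proof.
move=> /[dup] /andP[part _] /matching_ofP[_ _ _ uni] BM.
have maxM : ord_max \in cover M by rewrite (cover_partition part) in_setT.
apply/eqP/idP => [->|maxB]; first by rewrite mem_pblock.
by apply: (uni _ _ ord_max); rewrite ?pblock_mem ?mem_pblock.
Qed.

(** Two readings of one triple: a pyramid among the blocks of a matching of all points, or an
    oriented matching of the points covered by [x.1] together with a noncrossing matching of the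
    other points. *)
Lemma covering_pyramidP M x :
  (matching_of [set: 'I_n.+1] M && pyr M x) =
  [&& rooted x, x.1 \subset M & M :\: x.1 \in noncrossing_matchings (~: cover x.1)].
Proof.
case: x => S a; rewrite /pyr /rooted noncrossing_matchingP !inE /=.
apply/andP/and3P => [[MM /and5P[/= SM ind or ac /andP[topS /forall_inP src]]]|].
  have [mS mT] := sub_matching MM SM; split=> //; last by rewrite mT.
  apply/andP; split; last first.
    apply/bigcupP; exists (pblock M ord_max) => //.
    by rewrite -(block_is_top MM) ?(subsetP SM).
  apply/and4P; split=> //; apply/eqP/setP => B; rewrite !inE exists_max_in.
  apply: andb_id2l => BS; rewrite -(eqP (src B BS)).
  by rewrite (block_is_top MM) ?(subsetP SM).
move=> [/andP[/and4P[mS or ac /eqP/setP src] maxS] SM /andP[mT ind]].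
have EM : S :|: M :\: S = M by rewrite -[RHS](setID M S) (setIidPr SM).
have [MM _] := join_matching mS mT; rewrite EM in MM; split=> //.
have topE B : B \in S -> (B == pblock M ord_max) = (ord_max \in B).
  by move=> BS; rewrite (block_is_top MM) ?(subsetP SM).
apply/and5P; split=> //=; apply/andP; split.
  case/bigcupP: maxS => B BS; rewrite -topE // => /eqP <- //.
apply/forall_inP => B BS; have := src B; rewrite !inE BS exists_max_in /= => ->.
by rewrite topE.
Qed.

Lemma card_covering_pyramid x :
  #|[set M | matching_of [set: 'I_n.+1] M && pyr M x]| =
  if rooted x then #|noncrossing_matchings (~: cover x.1)| else 0.
Proof.
case: ifP => rx; last first.
  by apply: eq_card0 => M; rewrite inE covering_pyramidP rx.
have mx : matching_of (cover x.1) x.1 by case/andP: rx => + _; rewrite inE => /and4P[].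
have dis T : T \in noncrossing_matchings (~: cover x.1) -> (x.1 :|: T) :\: x.1 = T.
  rewrite noncrossing_matchingP => /andP[mT _]; have [_ dis] := join_matching mx mT.
  rewrite setDUl setDv set0U; apply/setDidPl; by rewrite disjoint_sym.
rewrite -(card_in_imset (f := fun T => x.1 :|: T) (D := noncrossing_matchings _)); last first.
  by move=> T T' /dis ET /dis ET' E; rewrite -ET E ET'.
apply: eq_card => M; rewrite inE covering_pyramidP rx /=; apply/andP/imsetP.
  move=> [SM mT]; exists (M :\: x.1) => //.
  by rewrite -[LHS](setID M x.1) (setIidPr SM).
by move=> [T Tin ->]; rewrite subsetUl dis.
Qed.

Local Open Scope ring_scope.

(** The triples are summed by covered point set on the left. Summed by matching instead,
    [sum_sign_pyramids] leaves [-1] for each noncrossing matching of all points. *)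
Lemma sum_oriented_matchings :
  \sum_(U : {set 'I_n.+1} | ord_max \in U) \sum_(x in oriented_matchings U)
     (-1) ^+ #|x.1| * (#|noncrossing_matchings (~: U)|)%:Z
  = - (aerated_catalan n.+1)%:Z.
Proof.
have cov x U : x \in oriented_matchings U -> cover x.1 = U.
  by rewrite inE => /and4P[/andP[/cover_partition]].
transitivity (\sum_(x | rooted x)
    (-1) ^+ #|x.1| * (#|noncrossing_matchings (~: cover x.1)|)%:Z : int).
  rewrite (partition_big (fun x : oriented_partition n.+1 => cover x.1)
    (fun U => ord_max \in U)) => [|x /andP[] //].
  apply: eq_bigr => U maxU; apply: eq_big => [x|x /cov -> //].
  apply/idP/andP => [xU|[/andP[xc _] /eqP <-] //].
  by rewrite /rooted (cov _ _ xU) xU maxU.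
transitivity (\sum_(x : oriented_partition n.+1)
    \sum_(M | matching_of [set: 'I_n.+1] M && pyr M x) (-1) ^+ #|x.1| : int).
  rewrite big_mkcond; apply: eq_bigr => x _.
  rewrite sumr_const -(cardsE (fun M => _ && _)) card_covering_pyramid.
  by case: ifP; rewrite ?mulr0n // -mulr_natr natz.
rewrite (exchange_big_dep (matching_of [set: 'I_n.+1])) /= => [|x M _ /andP[] //].
rewrite -[in RHS](card_ord n.+1) -cardsT -card_noncrossing_matchings -sum1_card.
rewrite (eq_bigr (fun M => - (independent (@block_cross n.+1) M)%:R)); last first.
  move=> M MM; rewrite (eq_bigl (pyr M)) => [|x]; last by rewrite MM.
  apply: sum_sign_pyramids.
  - by move=> B C; rewrite /block_cross eq_sym crossingC.
  - by move=> B; rewrite /block_cross eqxx.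
  - have /andP[part _] := MM.
    by rewrite pblock_mem // (cover_partition part) in_setT.
rewrite sumrN; congr (- _); rewrite -natz natr_sum big_mkcond [RHS]big_mkcond.
apply: eq_bigr => M _; rewrite noncrossing_matchingP.
by case: (matching_of _ _); case: (independent _ _).
Qed.

Definition oriented_matching_number (q : nat) : nat := #|oriented_matchings [set: 'I_q]|.

Lemma oriented_matching_number_odd q : odd q -> oriented_matching_number q = 0%N.
Proof.
move=> oq; apply: eq_card0 => x; apply/negbTE/negP; rewrite inE => /and4P[/matching_of_card E _ _ _].
by move: oq; rewrite -[q]card_ord -cardsT -E muln2 odd_double.
Qed.

Lemma card_sets_with_max j :
  #|[set U : {set 'I_n.+1} | (ord_max \in U) && (#|U| == j.+1)]| = 'C(n, j).
Proof.
have cT : #|[set~ (ord_max : 'I_n.+1)]| = n by rewrite cardsC1 card_ord.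
rewrite -[in RHS]cT -cards_draws.
rewrite -(card_in_imset (f := fun A : {set 'I_n.+1} => ord_max |: A)
  (D := [set A : {set 'I_n.+1} | A \subset [set~ ord_max] & #|A| == j])); last first.
  move=> A A'; rewrite !inE !sub_setC1 => /andP[nA _] /andP[nA' _] E.
  by rewrite -(setU1K nA) E setU1K.
apply: eq_card => U; rewrite inE; apply/andP/imsetP => [[maxU cU]|[A]].
  exists (U :\ ord_max); last by rewrite setD1K.
  by rewrite inE sub_setC1 setD11 /=; move: cU; rewrite (cardsD1 ord_max) maxU.
rewrite inE sub_setC1 => /andP[nA /eqP cA] ->.
by rewrite setU11 cardsU1 nA cA.
Qed.

(** The summand depends on [U] only through its size [j+1]: the largest point is in [U], the other
    [j] are chosen among [n], and every matching of [U] has [(j+1)/2] blocks, which is the exponent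
    of the sign. *)
Lemma oriented_matching_recurrence :
  \sum_(j < n.+1) ('C(n, j))%:Z * ((-1) ^+ (j.+1)./2 *
     (oriented_matching_number j.+1)%:Z * (aerated_catalan (n - j))%:Z)
  = - (aerated_catalan n.+1)%:Z.
Proof.
rewrite -sum_oriented_matchings.
have inner (U : {set 'I_n.+1}) : ord_max \in U ->
    \sum_(x in oriented_matchings U) (-1) ^+ #|x.1| * (#|noncrossing_matchings (~: U)|)%:Z =
    (-1) ^+ #|U|./2 * (oriented_matching_number #|U|)%:Z * (aerated_catalan (n.+1 - #|U|))%:Z :> int.
  move=> maxU; rewrite card_noncrossing_matchings cardsCs setCK card_ord.
  rewrite (eq_bigr (fun=> (-1) ^+ #|U|./2 * (aerated_catalan (n.+1 - #|U|))%:Z)).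
    rewrite sumr_const (card_oriented_matchings maxU erefl) -/(oriented_matching_number _).
    by rewrite -mulr_natr natz mulrAC.
  move=> x; rewrite inE => /and4P[/matching_of_card <- _ _ _].
  by rewrite muln2 doubleK.
rewrite [RHS](eq_bigr _ inner).
have cardU (U : {set 'I_n.+1}) : ord_max \in U -> (#|U|.-1 < n.+1)%N.
  move=> maxU; have := max_card (mem U); rewrite card_ord.
  have : (0 < #|U|)%N by rewrite card_gt0; apply/set0Pn; exists ord_max.
  by move: #|_| => c; lia.
rewrite (partition_big (fun U : {set 'I_n.+1} => inord #|U|.-1 : 'I_n.+1) xpredT) //=.
apply: eq_bigr => j _.
rewrite (eq_bigl (fun U =>
  U \in [set U : {set 'I_n.+1} | (ord_max \in U) && (#|U| == j.+1)])); last first.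
  move=> U; rewrite inE; apply: andb_id2l => maxU.
  have c0 : (0 < #|U|)%N by rewrite card_gt0; apply/set0Pn; exists ord_max.
  rewrite -val_eqE /= inordK ?cardU //; by case: #|U| c0.
rewrite (eq_bigr (fun=> (-1) ^+ (j.+1)./2 * (oriented_matching_number j.+1)%:Z *
    (aerated_catalan (n - j))%:Z)); last first.
  by move=> U; rewrite inE => /andP[_ /eqP ->]; rewrite subSS.
by rewrite sumr_const card_sets_with_max -[RHS]mulr_natl natz.
Qed.

End CoveringPyramid.

Local Open Scope ring_scope.

(** * Lassalle's recurrence *)

Lemma sum_odd_index (g : nat -> int) t : (forall i, ~~ odd i -> g i = 0) ->
  \sum_(i < 2 * t) g i = \sum_(i < t) g (2 * i).+1.
Proof.
move=> g0; elim: t => [|t IH]; first by rewrite !big_ord0.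
have -> : (2 * t.+1 = (2 * t).+2)%N by lia.
rewrite [RHS]big_ord_recr /= -IH.
by rewrite !big_ord_recr /= [g (2 * t)%N]g0 ?addr0 // mul2n odd_double.
Qed.

(** The term [i = t] has binomial and Catalan factors 1 and is solved for. In the other terms
    [j = t - i] and [m = t + 1] turn [2i + 1] into [2m - 2j - 1], and the signs combine to
    [(-1)^(j-1)]. *)
Lemma lassalle_recurrence (A : nat -> int) :
  (forall t, \sum_(i < t.+1) ('C((2 * t).+1, (2 * i).+1))%:Z *
     ((-1) ^+ i.+1 * A i.+1 * (catalan (t - i))%:Z) = - (catalan t.+1)%:Z) ->
  forall t, A t.+1 = lassalle_rhs A t.+1.
Proof.
move=> recA t; have := recA t; rewrite big_ord_recr /= subnn binn.
have -> : catalan 0 = 1%N by [].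
rewrite mul1r mulr1 => /(canRL (addKr _)) E.
have -> : A t.+1 = (-1) ^+ t.+1 * ((-1) ^+ t.+1 * A t.+1).
  by rewrite mulrA -exprMn mulrNN mulr1 expr1n mul1r.
rewrite E mulrDr mulrN addrC mulrN; congr (_ + _).
  by rewrite subn1 /= exprS mulN1r mulNr opprK.
rewrite big_add1 /= big_mkord (reindex_inj rev_ord_inj) /=.
rewrite -mulrN -sumrN big_distrr /=; apply: eq_bigr => i _.
have lti := ltn_ord i.
have -> : (t - (t - i.+1) = i.+1)%N by lia.
have -> : ((2 * (t - i.+1)).+1 = 2 * t.+1 - 2 * i.+1 - 1)%N by lia.
have -> : ((2 * t).+1 = 2 * t.+1 - 1)%N by lia.
have -> : ((t - i.+1).+1 = t.+1 - i.+1)%N by lia.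
have -> : (i.+1 - 1 = i)%N by lia.
have -> : (-1) ^+ t.+1 = (-1) ^+ i * (-1) ^+ (t.+1 - i.+1) * (-1) :> int.
  by rewrite -exprD -exprSr; congr (_ ^+ _); lia.
have sq : (-1) ^+ (t.+1 - i.+1) * (-1) ^+ (t.+1 - i.+1) = 1 :> int.
  by rewrite -exprMn mulrNN mulr1 expr1n.
suff regroup (x z b a c : int) : z * z = 1 -> x * z * -1 * - (b * (z * a * c)) = x * b * a * c.
  exact: regroup.
by move=> zz; transitivity (z * z * (x * b * a * c)); [ring | rewrite zz mul1r].
Qed.

Lemma lassalle_unique (A : nat -> int) :
  (forall t, A t.+1 = lassalle_rhs A t.+1) -> forall t, A t.+1 = lassalle t.+1.
Proof.
move=> recA; elim/ltn_ind => t IH; rewrite recA lassalleE // /lassalle_rhs; congr (_ + _).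
apply: eq_big_nat => j /andP[j0 jt]; congr (_ * _ * _).
by have -> : (t.+1 - j = (t - j).+1)%N by [lia]; apply: IH; lia.
Qed.

(** The signed recurrence is taken at [n = 2t + 1], where only odd [j], that is point sets of even
    size, contribute. *)
Lemma card_Mtilde k : Posz #|Mtilde (2 * k).+2| = lassalle k.+1.
Proof.
rewrite Mtilde_oriented -/(oriented_matching_number (2 * k).+2).
have -> : ((2 * k).+2 = 2 * k.+1)%N by lia.
apply: (lassalle_unique (A := fun t => (oriented_matching_number (2 * t))%:Z)).
apply: lassalle_recurrence => t.
have := oriented_matching_recurrence (2 * t).+1.
have -> : ((2 * t).+2 = 2 * t.+1)%N by lia.
pose g j : int := ('C((2 * t).+1, j))%:Z * ((-1) ^+ (j.+1)./2 *
     (oriented_matching_number j.+1)%:Z * (aerated_catalan ((2 * t).+1 - j))%:Z).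
rewrite (sum_odd_index (g := g)); last first.
  by move=> i oi; rewrite /g oriented_matching_number_odd //= mulr0 mul0r mulr0.
have even s : aerated_catalan (2 * s) = catalan s.
  by rewrite /aerated_catalan mul2n odd_double doubleK.
rewrite even => <-; apply: eq_bigr => i _; rewrite /g.
have -> : ((2 * t).+1 - (2 * i).+1 = 2 * (t - i))%N by lia.
have -> : ((2 * i).+2 = 2 * i.+1)%N by lia.
by rewrite even (_ : (2 * i.+1)%N./2 = i.+1) // mul2n doubleK.
Qed.

Theorem corollary5p5 (k : nat) :
  [/\ {in VHC (2 * k).+1, forall H, Phi H \in Ptilde (2 * k).+2},
      {in VHCh k (2 * k).+1 &, injective (@Phi (2 * k).+1)},
      [set Phi H | H in VHCh k (2 * k).+1] = Mtilde (2 * k).+2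
    & Posz #|VHCh k (2 * k).+1| = lassalle k.+1].
Proof.
split.
- by move=> H; apply: Phi_in_Ptilde.
- exact: Phi_inj.
- exact: Phi_image.
- by rewrite -card_Mtilde -Phi_image card_in_imset //; apply: Phi_inj.
Qed.
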